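(* Assume $0<\rho_b<\rho_h$ and $\rho_b+\rho_h\le1$, and $p\in[0,1]$. For the golf process on $\mathbb{Z}$ with these parameters, for every integer $\ell_0\ge0$, $$\mathbb{P}(\Delta_0H^1=\ell_0)=(\rho_h-\rho_b)\sum_{b_0:\,2b_0\le\ell_0}\frac{\ell_0+1}{b_0+1}\binom{\ell_0}{b_0,\,b_0,\,\ell_0-2b_0}\rho_b^{b_0}\rho_h^{b_0+1}(1-\rho_b-\rho_h)^{\ell_0-2b_0}.$$
   Context: Golf process on $\mathbb{Z}$: initial states i.i.d., ball with probability $\rho_b$, hole with probability $\rho_h$, neutral otherwise; clocks i.i.d. uniform on $[0,1]$; at its clock time each ball performs an independent random walk (step $+1$ w.p. $p$, $-1$ w.p. $1-p$) from its vertex, stopped at the first currently free hole, which it fills. $H^1$ is the set of holes free at time $1$ (a.s. infinite in both directions under the hypotheses); $H^1_0$ is its largest nonpositive element, $H^1_1$ its smallest positive element, and $\Delta_0H^1=H^1_1-H^1_0-1$. *)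

(* Defs.v *)
From HB Require Import structures.
From mathcomp Require Import all_boot all_order all_algebra.
From mathcomp Require Import all_classical all_reals all_analysis.
Set Implicit Arguments. Unset Strict Implicit. Unset Printing Implicit Defensive.
Import Order.TTheory GRing.Theory Num.Theory.
Local Open Scope classical_set_scope.
Local Open Scope ring_scope.

Inductive site := Ball | Hole | Neutral.

Section Golf.
Context {d : measure_display} {Omega : measurableType d} {R : realType}.
Variable P : probability Omega R.
Variables (eta : int -> Omega -> site) (U : int -> Omega -> R)
          (xi : int -> nat -> Omega -> bool).

Definition golf_indep : Prop :=
  forall (J1 J2 : seq int) (J3 : seq (int * nat))
         (A1 : int -> set site) (A2 : int -> set R) (A3 : int * nat -> set bool),
    uniq J1 -> uniq J2 -> uniq J3 -> (forall b, measurable (A2 b)) ->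
    fine (P [set w | (forall b, b \in J1 -> A1 b (eta b w)) /\
                     (forall b, b \in J2 -> A2 b (U b w)) /\
                     (forall bn, bn \in J3 -> A3 bn (xi bn.1 bn.2 w))]) =
    (\prod_(b <- J1) fine (P [set w | A1 b (eta b w)])) *
    (\prod_(b <- J2) fine (P [set w | A2 b (U b w)])) *
    (\prod_(bn <- J3) fine (P [set w | A3 bn (xi bn.1 bn.2 w)])).

Definition golf_laws (rho_b rho_h p : R) : Prop :=
  (forall b s, measurable [set w | eta b w = s]) /\
  (forall b A, measurable A -> measurable [set w | A (U b w)]) /\
  (forall b n, measurable [set w | xi b n w = true]) /\
  (forall b, P [set w | eta b w = Ball] = rho_b%:E) /\
  (forall b, P [set w | eta b w = Hole] = rho_h%:E) /\
  (forall b, P [set w | eta b w = Neutral] = (1 - rho_b - rho_h)%:E) /\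
  (forall b A, measurable A ->
     P [set w | A (U b w)] = (@lebesgue_measure R) (A `&` `[0, 1]%classic)) /\
  (forall b n, P [set w | xi b n w = true] = p%:E).

Definition walk (w : Omega) (b : int) (n : nat) : int :=
  b + \sum_(k < n) (if xi b k w then 1 else -1).

(** F w b = Some h : the ball initially at b ends in hole h; None otherwise.
    Hole h is free at time t if it is initially a hole and no ball with
    clock < t has been put into it. *)
Definition free_at (F : Omega -> int -> option int) (w : Omega) (t : R) (h : int) : Prop :=
  eta h w = Hole /\
  ~ (exists b', eta b' w = Ball /\ U b' w < t /\ F w b' = Some h).

Definition golf_consistent (F : Omega -> int -> option int) (w : Omega) : Prop :=
  forall b,
    (eta b w <> Ball -> F w b = None) /\
    (eta b w = Ball -> forall h,
       F w b = Some h <->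
       exists n, walk w b n = h /\ free_at F w (U b w) h /\
                 forall m, (m < n)%N -> ~ free_at F w (U b w) (walk w b m)).

Definition golf_process (F : Omega -> int -> option int) : Prop :=
  (forall b h, measurable [set w | F w b = Some h]) /\
  {ae P, forall w, golf_consistent F w}.

(** Event {Delta_0 H^1 = l}, where H^1 = set of holes free at time 1,
    H^1_0 its largest nonpositive element, H^1_1 its smallest positive one. *)
Definition gap_event (F : Omega -> int -> option int) (l : nat) : set Omega :=
  [set w | exists h0 h1 : int,
     h0 <= 0 /\ 0 < h1 /\ h1 - h0 - 1 = l%:Z /\
     free_at F w 1 h0 /\ free_at F w 1 h1 /\
     forall x : int, h0 < x -> x < h1 -> ~ free_at F w 1 x].

End Golf.

(* Main.v *)
Require Import Defs.
From HB Require Import structures.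
From mathcomp Require Import all_boot all_order all_algebra.
From mathcomp Require Import all_classical all_reals all_analysis.
From mathcomp Require Import zify ring lra.
Import Order.TTheory GRing.Theory Num.Theory.
Set Implicit Arguments. Unset Strict Implicit. Unset Printing Implicit Defensive.
Local Open Scope classical_set_scope.
Local Open Scope ring_scope.

(** For a hole at [h0] and a hole at [h1] to be consecutive free holes at time 1, no ball may leave the
    block between them, every hole of the block must be filled from inside it, and nothing may
    reach [h0] from the left or [h1] from the right. These conditions depend on disjoint parts
    of the environment, so the probability is [K * beta l], where [beta l] is the probability that
    a block of [l] sites is closed in this sense. Rotating the environment of a cycle of [l + 1]
    sites shows that [(l + 1) * rho_h * beta l] is the probability that [l + 1] sites carry exactly
    one more hole than balls, whatever [p] is. Since the gap around the origin is almost surely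
    finite, its probabilities add up to 1, and comparison with the Green function of the walk
    whose steps count holes minus balls gives [K = rho_h * (rho_h - rho_b)].

    The map [F] is only assumed to be consistent, so its restriction to the far left and the far
    right has to be controlled. Call a hole safe if every interval containing it has more holes than
    balls. Safe holes exist in every long interval with probability close to 1. A safe hole can only be
    filled if all holes on one side of it are filled by a given time; if two safe holes
    were filled, this would happen while a hole further on is still free. That is impossible: if
    the walks drift away from this hole only boundedly many balls cross a far site, and otherwise
    infinitely many balls would hit the free hole. Between safe holes the dynamics is finite, hence
    unique, and coincides with the dynamics of any large window. *)

(** * Golf dynamics on an arbitrary vertex set *)

(** All that is known about [F] is a fixed-point property, and on an infinite line nothing says a
    priori that it determines [F]. Every comparison therefore rests on one principle: a site still
    available at some time is a wall up to that time, and between two walls only finitely many balls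
    move. One lemma about two systems and a map between their vertices covers a stretch of the line,
    a cycle cut open at a free hole, and a rotated cycle. The two one-sided factors inside [K] vary
    with [p] and are never computed. They are the same for all gaps, so that total mass 1 fixes
    their product. On the cycle [p] disappears because a walk visits every residue whether it is
    recurrent or drifts to either side; hence one hole left free forces every ball to land. The
    constant [theta] is the square root of [rho_b / rho_h]. It is the [z] that minimises the mean of
    [z ^ excess1], and it gives all estimates on the environment the common rate [decay]. *)

(* A sink is available to every ball at every time; sinks model the outside of a window. *)
Record golf_sys (R : realType) (V : eqType) := GolfSys {
  isball : V -> Prop; ishole : V -> Prop; issink : V -> Prop;
  clock : V -> R; traj : V -> nat -> V }.

Section Dynamics.
Context {R : realType} {V : eqType}.
Implicit Types (S : golf_sys R V) (G : V -> option V) (t : R).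

Definition avail S G t h :=
  issink S h \/ (ishole S h /\ ~ exists b, isball S b /\ clock S b < t /\ G b = Some h).

Definition stops S G b h n := traj S b n = h /\ avail S G (clock S b) h /\
  forall m, (m < n)%N -> ~ avail S G (clock S b) (traj S b m).

(** A fixed-point description: an infinite vertex set has no first ball from which the stops could
    be computed recursively. The strict inequality in [avail] keeps a ball from blocking its own
    hole. *)
Definition consistent S G := forall b, (~ isball S b -> G b = None) /\
  (isball S b -> forall h, G b = Some h <-> exists n, stops S G b h n).

Lemma avail_le S G t t' h : t <= t' -> avail S G t' h -> avail S G t h.
Proof.
move=> tt [|[hh hn]]; first by left.
by right; split=> // -[b [bb [bt Gb]]]; apply: hn; exists b; split=> //; split=> //;
  exact: lt_le_trans bt tt.
Qed.

Lemma cons_ball S G b h : consistent S G -> G b = Some h -> isball S b.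
Proof. by move=> cG Gb; apply/not_notP => /(cG b).1; rewrite Gb. Qed.

Lemma cons_stops S G b h : consistent S G -> G b = Some h -> exists n, stops S G b h n.
Proof. by move=> cG Gb; apply/(cG b).2 => //; exact: cons_ball cG Gb. Qed.

Lemma cons_inj S G b b' h : consistent S G -> ~ issink S h ->
  G b = Some h -> G b' = Some h -> clock S b < clock S b' -> False.
Proof.
move=> cG nh Gb Gb' bb'; have [n [_ [[//|[_ +]] _]]] := cons_stops cG Gb'.
by apply; exists b; split; [exact: cons_ball cG Gb|].
Qed.

Lemma first_hit (Q : nat -> Prop) n : Q n ->
  exists m, [/\ (m <= n)%N, Q m & forall k, (k < m)%N -> ~ Q k].
Proof.
move=> Qn; have [m /asboolP Qm mmin] := ex_minnP (ex_intro (fun n => `[< Q n >]) n (asboolT Qn)).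
exists m; split=> //; first by apply: mmin; apply/asboolP.
by move=> k km Qk; have := mmin k (asboolT Qk); rewrite leqNgt km.
Qed.

Lemma stops_uniq S G b h n h' n' : stops S G b h n -> stops S G b h' n' -> h = h' /\ n = n'.
Proof.
move=> [ph [fh mh]] [ph' [fh' mh']].
case: (ltngtP n n') => nn.
- by case: (mh' _ nn); rewrite ph.
- by case: (mh _ nn); rewrite ph'.
- by rewrite -ph -ph' nn.
Qed.

Lemma cons_some S G b n : consistent S G -> isball S b -> avail S G (clock S b) (traj S b n) ->
  exists h m, [/\ (m <= n)%N, G b = Some h & stops S G b h m].
Proof.
move=> cG bb fn; have [m [mn fm mm]] := @first_hit (fun n => avail S G (clock S b) (traj S b n)) n fn.
exists (traj S b m), m; have st : stops S G b (traj S b m) m by [].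
by split=> //; apply/(cG b).2 => //; exists m.
Qed.

End Dynamics.

(* Removing the ball with the largest clock from a finite system does not change the trajectories of the others. *)
Lemma consistent_exists (R : realType) (V : eqType) (S : golf_sys R V) (s : seq V) :
  (forall b, isball S b <-> b \in s) -> {in s &, injective (clock S)} ->
  exists G, consistent S G.
Proof.
(* Decreasing clocks put the ball that moves last at the head: it sees all the others and none of
   them sees it. *)
wlog ss : s / sorted (fun b b' => clock S b' <= clock S b) s /\ uniq s.
  move=> H hs ci; pose s' := sort (fun b b' => clock S b' <= clock S b) (undup s).
  have ms' b : (b \in s') = (b \in s) by rewrite mem_sort mem_undup.
  apply: (H s').
  - split; last by rewrite sort_uniq undup_uniq.
    by apply: sort_sorted => x y; exact: le_total.
  - by move=> b; rewrite ms'.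
  - by move=> x y; rewrite !ms'; exact: ci.
elim: s S ss => [|b0 s IH] S [ss us] hs ci.
  exists (fun=> None) => b; split=> // /hs; by rewrite in_nil.
have tr : transitive (fun b b' : V => clock S b' <= clock S b).
  by move=> y x z xy yz; exact: le_trans yz xy.
pose S0 := GolfSys (fun b => isball S b /\ b != b0) (ishole S) (issink S) (clock S) (traj S).
have lt0 b : b \in s -> clock S b < clock S b0.
  move=> bs; have /allP/(_ b bs) /= le0 := order_path_min tr ss.
  rewrite lt_neqAle le0 andbT; apply/eqP => e.
  move: us; rewrite /= => /andP[/negP + _]; apply.
  by rewrite -(ci b b0) ?inE ?eqxx ?bs ?orbT.
have [G0 cG0] : exists G, consistent S0 G.
  apply: IH => //.
  - by split; [exact: path_sorted ss|case/andP: us].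
  - move=> b; split=> /= [[/hs]|bs]; first by rewrite inE => /orP[/eqP->|//]; rewrite eqxx.
    split; first by apply/hs; rewrite inE bs orbT.
    by apply/eqP => e; move: (lt0 b bs); rewrite e ltxx.
  - by move=> x y xs ys; apply: ci; rewrite inE ?xs ?ys orbT.
pose c0 := clock S b0.
pose v0 : option V := if pselect (exists h n, stops S0 G0 b0 h n) is left H
   then Some (projT1 (cid H)) else None.
pose G b := if b == b0 then v0 else G0 b.
have bE b : isball S b -> clock S b <= c0.
  by move/hs; rewrite inE => /orP[/eqP->//|/lt0/ltW].
have fE t h : t <= c0 -> avail S G t h <-> avail S0 G0 t h.
  move=> tc; split=> -[?|[hh hn]]; [by left| |by left|].
  - right; split=> // -[b [[/= bb bb0] [bt Gb]]]; apply: hn; exists b; split=> //; split=> //.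
    by rewrite /G (negbTE bb0).
  - right; split=> // -[b [bb [bt]]]; rewrite /G; case: eqP => [e|/eqP ne Gb].
      by move: bt; rewrite e ltNge tc.
    by apply: hn; exists b; split=> //.
have sE b h n : clock S b <= c0 -> stops S G b h n <-> stops S0 G0 b h n.
  move=> bc; rewrite /stops; split=> -[p [f m]]; split=> //; split.
  - exact/fE.
  - by move=> k kn /fE; move/(_ bc); exact: m.
  - exact/fE.
  - by move=> k kn /fE; move/(_ bc); exact: m.
exists G => b; split=> [nb|bb h].
  rewrite /G; case: eqP => [e|ne]; last by apply: (cG0 b).1 => -[].
  by case: nb; apply/hs; rewrite e inE eqxx.
have bc := bE b bb.
have -> : (exists n, stops S G b h n) <-> (exists n, stops S0 G0 b h n).
  by split=> -[n /sE]; move/(_ bc) => ?; exists n.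
rewrite /G; case: (eqVneq b b0) => [->|ne]; last by apply: (cG0 b).2.
rewrite /v0; case: pselect => [H1|nH].
  have [n2 H2] := projT2 (cid H1).
  split=> [[<-]|[n Hn]]; first by exists n2.
  by have [->] := stops_uniq Hn H2.
by split=> // -[n Hn]; case: nH; exists h, n.
Qed.

(** * Comparing two systems along a map of vertices *)

Section Comparison.
Context {R : realType} {V V' : eqType}.
Variables (S : golf_sys R V) (S' : golf_sys R V') (phi : V' -> V).
Variables (G : V -> option V) (G' : V' -> option V') (t : R) (s : seq V').
Hypotheses (cG : consistent S G) (cG' : consistent S' G').
(** [S'] is a restriction of [S] along [phi], and its sinks mark where it is cut. [bdS] says that
    the places of exit are available in [S] up to time [t], [outS] that before [t] no ball from
    outside ends inside. Injectivity is asked only off the sinks, since both ends of a window become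
    the same vertex of a cycle. *)
Hypothesis ballS : forall v, isball S' v -> [/\ v \in s, isball S (phi v), ~ issink S' v,
  clock S' v = clock S (phi v) & forall n, phi (traj S' v n) = traj S (phi v) n].
Hypothesis holeS : forall v, ~ issink S' v -> (ishole S' v <-> ishole S (phi v)) /\ ~ issink S (phi v).
Hypothesis phi_inj : forall v v', ~ issink S' v -> ~ issink S' v' -> phi v = phi v' -> v = v'.
Hypothesis bdS : forall v n, isball S' v -> (forall m, (m < n)%N -> ~ issink S' (traj S' v m)) ->
  issink S' (traj S' v n) -> avail S G t (phi (traj S' v n)) /\
  forall x, ~ issink S' x -> phi x <> phi (traj S' v n).
Hypothesis outS : forall b x, isball S b -> clock S b < t -> ~ issink S' x -> G b = Some (phi x) ->
  exists v, isball S' v /\ phi v = b.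

(* Induction along the clocks: before the first exit the stopping sites are available simultaneously
   in both systems, and an exit is an arrival at a site that is available in the large system. *)
Lemma comparison v : isball S' v -> clock S' v <= t -> G (phi v) = omap phi (G' v).
Proof.
pose mu v := size [seq x <- undup s | clock S' x < clock S' v].
have [N] := ubnP (mu v); elim: N v => // N IH v; rewrite ltnS => muN bv vt.
have [vs bphi nv cv pv] := ballS bv.
have IH' u : isball S' u -> clock S' u < clock S' v -> G (phi u) = omap phi (G' u).
  move=> bu uv; have [us _ _ _ _] := ballS bu.
  apply: IH => //; last by apply: le_trans vt; exact: ltW.
  apply: leq_trans muN.
  have -> : mu u = size [seq x <- [seq x <- undup s | clock S' x < clock S' v] | clock S' x < clock S' u].
    rewrite -filter_predI /mu; congr size; apply: eq_filter => x /=.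
    by case: (ltP (clock S' x) (clock S' u)) => //= xu; rewrite (lt_trans xu uv).
  rewrite -[X in (_ < X)%N](count_predC (fun x => clock S' x < clock S' u)) size_filter -addn1 leq_add2l.
  rewrite -has_count; apply/hasP; exists u; last by rewrite /= ltxx.
  by rewrite mem_filter uv mem_undup.
have frE x : ~ issink S' x -> avail S' G' (clock S' v) x <-> avail S G (clock S (phi v)) (phi x).
  move=> nx; have [hE nsx] := holeS nx; rewrite -cv; split=> -[//|[hx hn]].
  - right; split; first exact/hE.
    move=> [b [bb [bt Gb]]]; apply: hn.
    have [u [bu ub]] := outS bb (lt_le_trans bt vt) nx Gb.
    have [_ _ nu cu _] := ballS bu.
    have uv : clock S' u < clock S' v by rewrite cu ub.
    exists u; split=> //; split=> //.
    move: Gb; rewrite -ub IH' //; case G'u: (G' u) => [y|//] [pyx].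
    have [n Hn] := cons_stops cG' G'u.
    have [sy|ny] := pselect (issink S' y); last by rewrite (phi_inj ny nx pyx).
    have [yn [fy my]] := Hn.
    have nsk m : (m < n)%N -> ~ issink S' (traj S' u m) by move=> mn sk; apply: (my m mn); left.
    rewrite -yn in sy; have [_ /(_ x nx)] := bdS bu nsk sy.
    by rewrite yn pyx.
  - right; split; first exact/hE.
    move=> [u [bu [ut G'u]]]; apply: hn; exists (phi u).
    have [_ bpu nu cu _] := ballS bu.
    by rewrite -cu; split=> //; split=> //; rewrite IH' // G'u.
have trans x n : stops S' G' v x n -> stops S G (phi v) (phi x) n.
  move=> [px [fx mx]]; have nsk m : (m < n)%N -> ~ issink S' (traj S' v m).
    by move=> mn sk; apply: (mx m mn); left.
  split; first by rewrite -pv px.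
  split; last by move=> m mn; rewrite -pv => /(frE _ (nsk m mn)); exact: mx.
  have [sx|nx] := pselect (issink S' x); last exact/frE.
  rewrite -px in sx *; have [f _] := bdS bv nsk sx.
  by apply: avail_le f; rewrite -cv.
case G'v: (G' v) => [x|] /=.
  have [n Hn] := cons_stops cG' G'v.
  by apply/(cG (phi v)).2 => //; exists n; exact: trans.
case Gv: (G (phi v)) => [y|//]; exfalso.
have [n [py [fy my]]] := cons_stops cG Gv.
have ex_or : exists m, avail S' G' (clock S' v) (traj S' v m).
  have [[m [mn sk]]|nsk] := pselect (exists m, (m <= n)%N /\ issink S' (traj S' v m)).
    by exists m; left.
  exists n; apply/frE; first by move=> sk; apply: nsk; exists n.
  by rewrite pv py.
have [m fm] := ex_or.
have [h [k [_ + _]]] := cons_some cG' bv fm.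
by rewrite G'v.
Qed.

End Comparison.

(** * The line *)

Record data (R : realType) := Data {
  dsite : int -> site; dclock : int -> R; dstep : int -> nat -> bool }.

Definition dwalk (R : realType) (y : data R) (b : int) (n : nat) : int :=
  b + \sum_(k < n) (if dstep y b k then 1 else -1).

(** Every site outside [I] absorbs, so a walk is followed only up to its first exit from [I]. *)
Definition int_sys (R : realType) (y : data R) (I : int -> Prop) : golf_sys R int :=
  GolfSys (fun k => I k /\ dsite y k = Ball) (fun k => I k /\ dsite y k = Hole)
    (fun k => ~ I k) (dclock y) (dwalk y).

Definition translate (R : realType) (s : int) (y : data R) : data R :=
  Data (fun k => dsite y (s + k)) (fun k => dclock y (s + k)) (fun k => dstep y (s + k)).

Definition hole_site (x : site) := if x is Hole then true else false.
Definition ball_site (x : site) := if x is Ball then true else false.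

Definition excess1 (x : site) : int :=
  match x with Ball => -1 | Hole => 1 | Neutral => 0 end.

Definition sites (x : int) (n : nat) : seq int := [seq x + i%:Z | i <- iota 0 n].

Definition excess (e : int -> site) (x : int) (n : nat) : int :=
  \sum_(z <- sites x n) excess1 (e z).

Definition safe (e : int -> site) (h : int) : Prop :=
  forall j k : nat, 1 <= excess e (h - j%:Z) (j + k + 1).

Lemma mem_sites x n z : (z \in sites x n) = (x <= z < x + n%:Z).
Proof.
apply/mapP/idP => [[i]|H]; first by rewrite mem_iota => ? ->; lia.
by exists (absz (z - x)%R); rewrite ?mem_iota; lia.
Qed.

Lemma uniq_sites x n : uniq (sites x n).
Proof. by rewrite map_inj_uniq ?iota_uniq // => i j; lia. Qed.

Lemma sites_cat x m n : sites x (m + n) = sites x m ++ sites (x + m%:Z) n.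
Proof.
rewrite /sites iotaD map_cat add0n; congr (_ ++ _).
rewrite -{1}[m]addn0 iotaDl -map_comp; apply: eq_map => i /=; lia.
Qed.

Lemma excess_cat e x m n : excess e x (m + n) = excess e x m + excess e (x + m%:Z) n.
Proof. by rewrite /excess sites_cat big_cat. Qed.

Lemma excess_count e x n : excess e x n =
  (count (fun z => hole_site (e z)) (sites x n))%:Z -
  (count (fun z => ball_site (e z)) (sites x n))%:Z.
Proof.
rewrite /excess; elim: (sites x n) => [|z s IH]; first by rewrite big_nil.
by rewrite big_cons IH /=; case: (e z) => /=; lia.
Qed.

Lemma safe_excess e h x c : safe e h -> x < h < c -> 1 <= excess e (x + 1) (absz (c - x - 1)%R).
Proof.
move=> sh H; have := sh (absz (h - x - 1)%R) (absz (c - h - 1)%R).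
rewrite (_ : h - (absz (h - x - 1)%R)%:Z = x + 1); last lia.
by rewrite (_ : (absz (h - x - 1)%R + absz (c - h - 1)%R + 1)%N = absz (c - x - 1)%R); last lia.
Qed.

Lemma safe_hole e h : safe e h -> e h = Hole.
Proof.
move=> /(_ 0%N 0%N); rewrite /excess /sites /= big_seq1 /excess1 subr0 addr0.
by case: (e h).
Qed.

(** * Nearest-neighbour walks between available sites *)

Section Walk.
Context {R : realType}.
Implicit Types (y : data R) (G : int -> option int).

Lemma dwalk0 y b : dwalk y b 0 = b.
Proof. by rewrite /dwalk big_ord0 addr0. Qed.

Lemma dwalkS y b n : dwalk y b n.+1 = dwalk y b n + 1 \/ dwalk y b n.+1 = dwalk y b n - 1.
Proof. by rewrite /dwalk big_ord_recr /= addrA; case: (dstep _ _ _); [left|right]. Qed.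

Lemma dwalk_shift s y b n : dwalk y (s + b) n = s + dwalk (translate s y) b n.
Proof. by rewrite /dwalk -addrA. Qed.

Lemma dwalk_up y b n c : b <= c -> c <= dwalk y b n -> exists2 m, (m <= n)%N & dwalk y b m = c.
Proof.
elim: n => [|n IH] bc; first by rewrite dwalk0 => cb; exists 0%N => //; rewrite dwalk0; lia.
move=> cn; have [/(IH bc)[m mn <-]|lt] := leP c (dwalk y b n); first by exists m => //; lia.
by exists n.+1 => //; have [] := dwalkS y b n; lia.
Qed.

Lemma dwalk_down y b n c : c <= b -> dwalk y b n <= c -> exists2 m, (m <= n)%N & dwalk y b m = c.
Proof.
elim: n => [|n IH] bc; first by rewrite dwalk0 => cb; exists 0%N => //; rewrite dwalk0; lia.
move=> cn; have [/(IH bc)[m mn <-]|lt] := leP (dwalk y b n) c; first by exists m => //; lia.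
by exists n.+1 => //; have [] := dwalkS y b n; lia.
Qed.

Lemma dwalk_exit y b n (a c : int) : a < b < c ->
  (forall m, (m < n)%N -> a < dwalk y b m < c) -> ~ (a < dwalk y b n < c) ->
  dwalk y b n = a \/ dwalk y b n = c.
Proof.
move=> ab; case: n => [|n] H nn; first by move: nn; rewrite dwalk0.
by have := H n (leqnn _); have := dwalkS y b n; lia.
Qed.

Variables (y : data R) (I : int -> Prop) (G : int -> option int).
Hypothesis cG : consistent (int_sys y I) G.
Notation av := (avail (int_sys y I) G).

(** A nearest-neighbour walk cannot jump over [a], and at an available site it stops. *)
Lemma no_cross_right b h a : G b = Some h -> av (dclock y b) a -> b <= a -> h <= a.
Proof.
move=> Gb fa ba; have [n [pn [_ mn]]] := cons_stops cG Gb.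
rewrite leNgt; apply/negP => ah.
have [m mn' pm] : exists2 m, (m <= n)%N & dwalk y b m = a by apply: dwalk_up => //; move: pn => /=; lia.
apply: (mn m); last by rewrite /= pm.
by rewrite ltn_neqAle mn' andbT; apply/eqP => e; move: pn; rewrite -e /= pm; lia.
Qed.

Lemma no_cross_left b h a : G b = Some h -> av (dclock y b) a -> a <= b -> a <= h.
Proof.
move=> Gb fa ba; have [n [pn [_ mn]]] := cons_stops cG Gb.
rewrite leNgt; apply/negP => ah.
have [m mn' pm] : exists2 m, (m <= n)%N & dwalk y b m = a by apply: dwalk_down => //; move: pn => /=; lia.
apply: (mn m); last by rewrite /= pm.
by rewrite ltn_neqAle mn' andbT; apply/eqP => e; move: pn; rewrite -e /= pm; lia.
Qed.

Lemma filledP t z : I z -> dsite y z = Hole -> ~ av t z ->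
  exists b, [/\ I b, dsite y b = Ball, dclock y b < t & G b = Some z].
Proof.
move=> Iz hz nf; apply: contra_notP nf => nb; right; split=> // -[b [[Ib bb] [bt Gb]]].
by apply: nb; exists b.
Qed.

(** Distinct holes are filled by distinct balls, and the available ends let no ball in from outside.
    So the holes of the interval inject into its balls. *)
Lemma filled_count t a c : a < c -> av t a -> av t c ->
  (forall z, a < z < c -> I z /\ ~ av t z) -> excess (dsite y) (a + 1) (absz (c - a - 1)%R) <= 0.
Proof.
move=> ac fa fc H; rewrite excess_count subr_le0 lez_nat -!size_filter.
set s := sites _ _; pose holes := [seq z <- s | hole_site (dsite y z)].
have ms z : (z \in s) = (a < z < c) by rewrite mem_sites; lia.
have ex z : z \in holes -> exists b, [/\ I b, dsite y b = Ball, dclock y b < t & G b = Some z].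
  rewrite mem_filter ms => /andP[hz zac]; have [Iz nz] := H _ zac.
  by apply: filledP Iz _ nz; move: hz; rewrite /hole_site; case: (dsite y z).
pose beta z := if pselect (z \in holes) is left h then projT1 (cid (ex z h)) else 0.
have bP z : z \in holes -> [/\ I (beta z), dsite y (beta z) = Ball, dclock y (beta z) < t & G (beta z) = Some z].
  by move=> zh; rewrite /beta; case: pselect => // h; exact: projT2 (cid (ex z h)).
rewrite -/holes -(size_map beta); apply: uniq_leq_size.
  rewrite map_inj_in_uniq ?filter_uniq ?uniq_sites // => z z' /bP[_ _ _ e1] /bP[_ _ _ e2] e.
  by move: e1; rewrite e e2 => -[].
move=> _ /mapP[z zh ->]; have [Ib bb bt Gb] := bP z zh.
rewrite mem_filter bb ms /=; move: zh; rewrite mem_filter ms => /andP[_ zac].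
have := no_cross_right Gb (avail_le (ltW bt) fa); have := no_cross_left Gb (avail_le (ltW bt) fc).
lia.
Qed.

Lemma nearest_left (Q : int -> Prop) a h : Q a -> a < h ->
  exists x, [/\ a <= x < h, Q x & forall z, x < z < h -> ~ Q z].
Proof.
move=> Qa ah; have [|m [mn Qm mm]] := @first_hit (fun n : nat => Q (h - 1 - n%:Z)) (absz (h - 1 - a)%R).
  by rewrite (_ : h - 1 - _ = a) //; lia.
exists (h - 1 - m%:Z); split=> //; first lia.
move=> z Hz; have := mm (absz (h - 1 - z)%R) ltac:(lia).
by rewrite (_ : h - 1 - (absz (h - 1 - z)%R)%:Z = z) //; lia.
Qed.

Lemma nearest_right (Q : int -> Prop) c h : Q c -> h < c ->
  exists x, [/\ h < x <= c, Q x & forall z, h < z < x -> ~ Q z].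
Proof.
move=> Qa ah; have [|m [mn Qm mm]] := @first_hit (fun n : nat => Q (h + 1 + n%:Z)) (absz (c - h - 1)%R).
  by rewrite (_ : h + 1 + _ = c) //; lia.
exists (h + 1 + m%:Z); split=> //; first lia.
move=> z Hz; have := mm (absz (z - h - 1)%R) ltac:(lia).
by rewrite (_ : h + 1 + (absz (z - h - 1)%R)%:Z = z) //; lia.
Qed.

(** Otherwise the nearest available sites on both sides of [h] enclose an interval of excess at most
    0 by [filled_count], although it contains a safe hole. *)
Lemma safe_avail t a h c : safe (dsite y) h -> a < h < c -> av t a -> av t c ->
  (forall z, a < z < c -> I z) -> av t h.
Proof.
move=> sh ahc fa fc HI; apply: contrapT => nh.
have [x [xh fx mx]] := nearest_left fa (proj1 (andP ahc)).
have [x' [xh' fx' mx']] := nearest_right fc (proj2 (andP ahc)).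
have := @safe_excess _ h x x' sh ltac:(lia).
have : excess (dsite y) (x + 1) (absz (x' - x - 1)%R) <= 0; last lia.
apply: (@filled_count t x x') => //; first lia.
move=> z zx; split; first by apply: HI; lia.
by case: (ltgtP z h) => [zh|zh|->] //; [apply: mx|apply: mx']; lia.
Qed.

(** Two sites available until time [t] act like the sinks of a window up to that time. *)
Lemma window_compare s (a c : int) G' t :
  (forall k, a < k < c -> I (s + k)) ->
  consistent (int_sys (translate s y) (fun k => a < k < c)) G' ->
  av t (s + a) -> av t (s + c) ->
  forall v, a < v < c -> dsite y (s + v) = Ball -> dclock y (s + v) <= t ->
  G (s + v) = omap (fun k => s + k) (G' v).
Proof.
move=> HI cG' fa fc v vac bv vt.
apply: (@comparison R int int (int_sys y I) (int_sys (translate s y) (fun k => a < k < c))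
  (fun k => s + k) G G' t (sites a (absz (c - a)%R))) => //.
- move=> u [/= uac bu]; split=> //.
  + by rewrite mem_sites; lia.
  + by split=> //; exact: HI.
  + by move=> n; rewrite dwalk_shift.
- move=> u /= /contrapT uac; split; last by move=> nI; apply: nI; exact: HI.
  by split=> -[_ ?]; split=> //; exact: HI.
- by move=> u u' _ _; exact: addrI.
- move=> u n /= [uac bu] mn en.
  have [->|->] : dwalk (translate s y) u n = a \/ dwalk (translate s y) u n = c.
  + by apply: dwalk_exit => // m /mn /contrapT.
  + by split=> // x /contrapT xac /addrI; lia.
  + by split=> // x /contrapT xac /addrI; lia.
- move=> b x /= [Ib bb] bt /contrapT xac Gb; exists (b - s).
  have := no_cross_right Gb (avail_le (ltW bt) fa); have := no_cross_left Gb (avail_le (ltW bt) fc).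
  by rewrite [s + (b - s)]addrC subrK => H1 H2; split=> //; split=> //; lia.
Qed.

End Walk.

Definition window (n : nat) (k : int) : Prop := 0 < k < n%:Z + 1.

(** * Safe holes stay free *)

Section Exhaust.
Context {R : realType} (y : data R) (G : int -> option int).
Notation S := (int_sys y (fun=> True)).
Notation av := (avail S G).

(* The only obstruction to a safe hole staying free: its side of the line is exhausted by balls
   arriving from arbitrarily far away. *)
Definition rogue_left := exists (u u' : R) (x g : int),
  [/\ 0 <= u, u < u' & u' <= 1] /\ [/\ x < g, av u' g & forall z, z <= x -> ~ av u z].
Definition rogue_right := exists (u u' : R) (x g : int),
  [/\ 0 <= u, u < u' & u' <= 1] /\ [/\ g < x, av u' g & forall z, x <= z -> ~ av u z].

Hypothesis cG : consistent S G.
Hypothesis clock01 : forall b, 0 <= dclock y b < 1.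
Hypothesis clock_inj : injective (dclock y).
Hypotheses (nrl : ~ rogue_left) (nrr : ~ rogue_right).
Hypothesis safe_l : forall n, exists2 h, h < n & safe (dsite y) h.
Hypothesis safe_r : forall n, exists2 h, n < h & safe (dsite y) h.

(** Say [g1] is filled first. Until the later clock [g2] is free, so by [safe_avail] any available
    site to the right of [g1] would keep [g1] free. Hence everything from [g1] on is exhausted while
    [g2] is free, which makes [rogue_right]. The time [u] is a midpoint because [avail] and the
    rogue condition both need strict inequalities. *)
Lemma two_safe_filled g2 g1 t : safe (dsite y) g1 -> safe (dsite y) g2 -> g2 < g1 ->
  ~ av t g1 -> ~ av t g2 -> False.
Proof.
move=> s1 s2 g21 n1 n2.
have [b1 [_ B1 t1 G1]] := @filledP _ y (fun=> True) G t g1 Logic.I (safe_hole s1) n1.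
have [b2 [_ B2 t2 G2]] := @filledP _ y (fun=> True) G t g2 Logic.I (safe_hole s2) n2.
have /andP[c10 c11] := clock01 b1; have /andP[c20 c21] := clock01 b2.
have f1 : av (dclock y b1) g1 by have [n [_ []]] := cons_stops cG G1.
have f2 : av (dclock y b2) g2 by have [n [_ []]] := cons_stops cG G2.
have fill b g u : dsite y b = Ball -> G b = Some g -> dclock y b < u -> ~ av u g.
  by move=> Bb Gb bu [nT|[_ nx]]; [exact: nT|apply: nx; exists b].
have mid (p q : R) : p < q -> p < (p + q) / 2 /\ (p + q) / 2 < q.
  by move=> pq; split; lra.
case: (ltgtP (dclock y b1) (dclock y b2)) => [lt|lt|/clock_inj e].
- have [m1 m2] := mid _ _ lt; set u := (_ / 2) in m1 m2.
  apply: nrr; exists u, (dclock y b2), g1, g2; split; split=> //; try lra.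
  move=> z zg fz; apply: (fill b1 g1 u) => //.
  have [e|zn] := eqVneq z g1; first by rewrite -e.
  apply: (@safe_avail _ y _ G cG u g2 g1 z) => //; first lia.
  exact: avail_le (ltW m2) f2.
- have [m1 m2] := mid _ _ lt; set u := (_ / 2) in m1 m2.
  apply: nrl; exists u, (dclock y b1), g2, g1; split; split=> //; try lra.
  move=> z zg fz; apply: (fill b2 g2 u) => //.
  have [e|zn] := eqVneq z g2; first by rewrite -e.
  apply: (@safe_avail _ y _ G cG u z g2 g1) => //; first lia.
  exact: avail_le (ltW m2) f1.
- by move: G1; rewrite e G2 => -[]; lia.
Qed.

(** Of two safe holes at most one is ever filled. If [h] were filled, the safe holes on its two
    sides would be free and would protect it. *)
Lemma safe_always_avail h t : safe (dsite y) h -> av t h.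
Proof.
move=> sh; apply: contrapT => nh.
have [a ah sa] := safe_l h; have [c hc sc] := safe_r h.
apply: (nh); apply: (@safe_avail _ y _ G cG t a h c) => //; first lia.
- by apply: contrapT => na; exact: (@two_safe_filled a h t sh sa ah nh na).
- by apply: contrapT => nc; exact: (@two_safe_filled h c t sc sh hc nc nh).
Qed.
End Exhaust.

(** * Gaps as conditions on three disjoint windows *)

Section Gap.
Context {R : realType}.
Implicit Types (y : data R) (G F : int -> option int).

Definition gap_at y F (h0 : int) (n : nat) : Prop :=
  [/\ avail (int_sys y (fun=> True)) F 1 h0,
      avail (int_sys y (fun=> True)) F 1 (h0 + (n%:Z + 1)) &
      forall x, h0 < x < h0 + (n%:Z + 1) -> ~ avail (int_sys y (fun=> True)) F 1 x].

(** This and the next two conditions speak of a consistent map of the window instead of [F], so that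
    they are events of the data inside the window and independence applies to them. *)
Definition no_exit_right (n : nat) y := exists G,
  consistent (int_sys y (window n)) G /\ forall b, G b <> Some (n%:Z + 1).

Definition no_exit_left (n : nat) y := exists G,
  consistent (int_sys y (window n)) G /\ forall b, G b <> Some 0.

Definition closed_block (n : nat) y := exists G,
  consistent (int_sys y (window n)) G /\
  (forall b, G b <> Some 0 /\ G b <> Some (n%:Z + 1)) /\
  (forall h, window n h -> dsite y h = Hole -> exists b, G b = Some h).

Lemma translate0 y : translate 0 y = y.
Proof. by case: y => e u z; congr Data; apply: funext => k; rewrite add0r. Qed.

Lemma excess_shift e s x n : excess (fun k => e (s + k)) x n = excess e (s + x) n.
Proof.
rewrite /excess /sites !big_map; apply: eq_bigr => i _; congr (excess1 (e _)).
by rewrite addrA.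
Qed.

Lemma safe_shift e s h : safe e (s + h) -> safe (fun k => e (s + k)) h.
Proof. by move=> H j k; rewrite excess_shift addrA; exact: H. Qed.

Lemma window_exists y (a c : int) : injective (dclock y) ->
  exists G, consistent (int_sys y (fun k => a < k < c)) G.
Proof.
move=> ci; pose s := [seq z <- sites a (absz (c - a)%R) | (a < z < c) && ball_site (dsite y z)].
have := @consistent_exists R int (int_sys y (fun k => a < k < c)) s.
apply.
  move=> b; rewrite mem_filter mem_sites /=; split=> [[H ->]|/andP[/andP[H]]]; first by rewrite /=; lia.
  by rewrite /ball_site; case: (dsite y b).
by move=> x z _ _; exact: ci.
Qed.

(** Both maps are compared with a third one, the dynamics of the small window from [a] to [c], whose
    ends stay available in either system. *)
Lemma window_compare_part y I F s (lo hi a c : int) G' t : injective (dclock y) ->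
  consistent (int_sys y I) F -> (forall k, a < k < c -> I (s + k)) ->
  lo <= a -> c <= hi ->
  consistent (int_sys (translate s y) (fun k => lo < k < hi)) G' ->
  avail (int_sys y I) F t (s + a) -> avail (int_sys y I) F t (s + c) ->
  (forall t', avail (int_sys (translate s y) (fun k => lo < k < hi)) G' t' a) ->
  (forall t', avail (int_sys (translate s y) (fun k => lo < k < hi)) G' t' c) ->
  forall v, a < v < c -> dsite y (s + v) = Ball -> dclock y (s + v) <= t ->
  F (s + v) = omap (fun k => s + k) (G' v).
Proof.
move=> ci cF HI la ch cG' fa fc ga gc v vac bv vt.
have ci' : injective (dclock (translate s y)) by move=> u u' /= /ci /addrI.
have [Ga cGa] := @window_exists (translate s y) a c ci'.
rewrite (window_compare cF HI cGa fa fc vac bv vt).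
have := @window_compare _ (translate s y) _ G' cG' 0 a c Ga t.
rewrite translate0 !add0r => /(_ _ cGa (ga t) (gc t) v vac).
rewrite !add0r => -> //; first by case: (Ga v) => //= k; rewrite add0r.
by move=> k kac; rewrite add0r; lia.
Qed.

Variables (y : data R) (F : int -> option int) (n N : nat) (h0 a c : int).
Let h1 := h0 + (n%:Z + 1).
Let sL := h0 - (N%:Z + 1).
Notation av := (avail (int_sys y (fun=> True)) F).
Hypotheses (cF : consistent (int_sys y (fun=> True)) F) (ci : injective (dclock y))
  (clt1 : forall b, dclock y b < 1).
Hypotheses (aL : sL < a < h0) (cR : h1 < c < h1 + (N%:Z + 1)).
Hypotheses (sa : safe (dsite y) a) (sc : safe (dsite y) c)
  (fa : forall t, av t a) (fc : forall t, av t c).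

Let window_sink (m : nat) s G t k : ~ window m k -> avail (int_sys (translate s y) (window m)) G t k.
Proof. by move=> nk; left. Qed.

(** The safe hole [a] is available on the line and also in the window, where it lies between two
    sinks. It therefore shields the sites on its right from the far end. *)
Let left_compare GL t v : consistent (int_sys (translate sL y) (window N)) GL -> av t h0 ->
  a < sL + v < h0 -> dsite y (sL + v) = Ball -> dclock y (sL + v) <= t ->
  F (sL + v) = omap (fun k => sL + k) (GL v).
Proof.
move=> cG f0 vac bv vt.
apply: (@window_compare_part y _ F sL 0 (N%:Z + 1) (a - sL) (N%:Z + 1) GL t) => //.
- by move: vac aL; rewrite /sL; lia.
- by rewrite addrC subrK.
- by rewrite /sL subrK.
- move=> t'; apply: (@safe_avail _ (translate sL y) _ GL cG t' 0 (a - sL) (N%:Z + 1)).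
  + by apply: safe_shift; rewrite addrC subrK.
  + by move: aL; rewrite /sL; lia.
  + by apply: window_sink; rewrite /window; lia.
  + by apply: window_sink; rewrite /window; lia.
  + by move=> z; rewrite /window.
- by move=> t'; apply: window_sink; rewrite /window; lia.
- by move: vac; rewrite /sL; lia.
Qed.

Let right_compare GR t v : consistent (int_sys (translate h1 y) (window N)) GR -> av t h1 ->
  h1 < h1 + v < c -> dsite y (h1 + v) = Ball -> dclock y (h1 + v) <= t ->
  F (h1 + v) = omap (fun k => h1 + k) (GR v).
Proof.
move=> cG f0 vac bv vt.
apply: (@window_compare_part y _ F h1 0 (N%:Z + 1) 0 (c - h1) GR t) => //.
- by lia.
- by rewrite addr0.
- by rewrite addrC subrK.
- by move=> t'; apply: window_sink; rewrite /window; lia.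
- move=> t'; apply: (@safe_avail _ (translate h1 y) _ GR cG t' 0 (c - h1) (N%:Z + 1)).
  + by apply: safe_shift; rewrite addrC subrK.
  + by lia.
  + by apply: window_sink; rewrite /window; lia.
  + by apply: window_sink; rewrite /window; lia.
  + by move=> z; rewrite /window.
- by lia.
Qed.

Let block_compare GB t v : consistent (int_sys (translate h0 y) (window n)) GB -> av t h0 -> av t h1 ->
  h0 < h0 + v < h1 -> dsite y (h0 + v) = Ball -> dclock y (h0 + v) <= t ->
  F (h0 + v) = omap (fun k => h0 + k) (GB v).
Proof.
move=> cG f0 f1 vac bv vt.
apply: (@window_compare _ y _ F cF h0 0 (n%:Z + 1) GB t) => //.
- by rewrite addr0.
- by move: vac; rewrite /h1; lia.
Qed.

Let not_filled t h b : av t h -> F b = Some h -> dclock y b < t -> False.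
Proof.
move=> fh Fb bt; case: fh => [|[_]]; first by move=> nT; exact: nT.
by apply; exists b; split; [exact: cons_ball cF Fb|].
Qed.

Let av_hole t h : av t h -> dsite y h = Hole.
Proof. by case=> [nT|[[]]] //; case: nT. Qed.

Let hole_av t h : dsite y h = Hole -> (forall b, dclock y b < t -> F b <> Some h) -> av t h.
Proof. by move=> hh nb; right; split=> // -[b [_ [bt Fb]]]; exact: (nb b bt Fb). Qed.

Let Fball b x : F b = Some x -> dsite y b = Ball.
Proof. by move=> Fb; have [] := cons_ball cF Fb. Qed.

(** For the converse, consider the first ball to land in [h0] or [h1]. Up to its clock both holes
    are free, so it moves as in one of the three windows, and none of them lets it out. Both holes
    are treated together because the block in the middle needs two walls. *)
Lemma gap_at_windows : gap_at y F h0 n <->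
  [/\ no_exit_right N (translate sL y), dsite y h0 = Hole, closed_block n (translate h0 y),
      dsite y h1 = Hole & no_exit_left N (translate h1 y)].
Proof.
have cis s : injective (dclock (translate s y)) by move=> u u' /= /ci /addrI.
split=> [[f0 f1 mid]|].
- split; [|exact: av_hole f0| |exact: av_hole f1|].
  + have [GL cGL] := @window_exists _ 0 (N%:Z + 1) (cis sL).
    exists GL; split=> // v Gv.
    have [[vW bv]] := cons_ball cGL Gv.
    (* From the other side of [a] the ball could not reach the right end of the window, as [a] stays
       available there. *)
    have aW : a < sL + v.
      rewrite ltNge; apply/negP => va.
      have := @no_cross_right _ _ _ _ cGL v (N%:Z + 1) (a - sL) Gv.
      have fa' : avail (int_sys (translate sL y) (fun k => 0 < k < N%:Z + 1)) GL (dclock (translate sL y) v) (a - sL).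
        apply: (@safe_avail _ (translate sL y) _ GL cGL _ 0 (a - sL) (N%:Z + 1)).
        * by apply: safe_shift; rewrite addrC subrK.
        * by move: aL; rewrite /sL; lia.
        * by left => /=; lia.
        * by left => /=; lia.
        * by [].
      by move=> /(_ fa'); move: aL va; rewrite /sL; lia.
    have Fv : F (sL + v) = Some h0.
      rewrite (left_compare cGL f0) //; first by rewrite Gv /= /sL subrK.
      * by move: (vW) aW; rewrite /= /sL; lia.
      * exact: ltW.
    exact: not_filled f0 Fv (clt1 _).
  + have [GB cGB] := @window_exists _ 0 (n%:Z + 1) (cis h0).
    have cmp v : window n v -> dsite y (h0 + v) = Ball -> F (h0 + v) = omap (fun k => h0 + k) (GB v).
      move=> vW bv; apply: (block_compare cGB f0 f1) => //; last exact: ltW.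
      by move: (vW); rewrite /window /h1 /=; lia.
    exists GB; split=> //; split.
    * move=> v; split=> Gv; have [vW bv] := cons_ball cGB Gv; have := cmp v vW bv; rewrite Gv /=.
      - by rewrite addr0 => Fv; exact: not_filled f0 Fv (clt1 _).
      - by move=> Fv; exact: not_filled f1 Fv (clt1 _).
    * move=> h hW hh.
      have nf : ~ av 1 (h0 + h) by apply: mid; move: (hW); rewrite /window; lia.
      have [b [_ bb bt Fb]] := @filledP _ y (fun=> True) F 1 (h0 + h) Logic.I hh nf.
      have b0 : b <> h0 by move=> e; move: bb; rewrite e (av_hole f0).
      have b1 : b <> h1 by move=> e; move: bb; rewrite e (av_hole f1).
      have L0 := no_cross_right cF Fb (avail_le (ltW bt) f0).
      have L1 := no_cross_left cF Fb (avail_le (ltW bt) f1).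
      have bW : window n (b - h0) by move: hW b1 L1; rewrite /window /h1; lia.
      exists (b - h0); have := cmp (b - h0) bW; rewrite [h0 + _]addrC subrK Fb => /(_ bb).
      by case: (GB (b - h0)) => [x|] //= [/addrI ->].
  + have [GR cGR] := @window_exists _ 0 (N%:Z + 1) (cis h1).
    exists GR; split=> // v Gv.
    have [[vW bv]] := cons_ball cGR Gv.
    have aW : h1 + v < c.
      rewrite ltNge; apply/negP => va.
      have := @no_cross_left _ _ _ _ cGR v 0 (c - h1) Gv.
      have fa' : avail (int_sys (translate h1 y) (fun k => 0 < k < N%:Z + 1)) GR (dclock (translate h1 y) v) (c - h1).
        apply: (@safe_avail _ (translate h1 y) _ GR cGR _ 0 (c - h1) (N%:Z + 1)).
        * by apply: safe_shift; rewrite addrC subrK.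
        * by lia.
        * by left => /=; lia.
        * by left => /=; lia.
        * by [].
      by move=> /(_ fa'); lia.
    have Fv : F (h1 + v) = Some h1.
      rewrite (right_compare cGR f1) //; first by rewrite Gv /= addr0.
      * by move: (vW) aW; rewrite /=; lia.
      * exact: ltW.
    exact: not_filled f1 Fv (clt1 _).
case=> -[GL [cGL nGL]] hh0 [GB [cGB [nGB fillB]]] hh1 [GR [cGR nGR]].
have h01 : h0 < h1 by rewrite /h1; lia.
pose Q b := F b = Some h0 \/ F b = Some h1.
(* There are infinitely many balls, but three with decreasing clocks cannot share two target holes.
   So one replacement already yields a minimal clock. *)
have minQ : forall b, Q b -> exists b', Q b' /\ forall b'', Q b'' -> ~ dclock y b'' < dclock y b'.
  move=> b Qb; have [[b' [Qb' bb']]|nb] := pselect (exists b', Q b' /\ dclock y b' < dclock y b); last first.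
    by exists b; split=> // b'' Q'' lt; apply: nb; exists b''.
  exists b'; split=> // b'' Q'' lt.
  have nT x : ~ issink (int_sys y (fun=> True)) x by move=> nT; exact: nT.
  have lt2 := lt_trans lt bb'.
  case: Qb Qb' Q'' => e [] e' [] e''; first [exact: (cons_inj cF (@nT _) e' e bb')
    | exact: (cons_inj cF (@nT _) e'' e' lt) | exact: (cons_inj cF (@nT _) e'' e lt2)].
have noQ b : ~ Q b.
  move=> /minQ [{}b [Qb mb]].
  have f0 : av (dclock y b) h0 by apply: hole_av => // b' lt Fb'; apply: (mb b') => //; left.
  have f1 : av (dclock y b) h1 by apply: hole_av => // b' lt Fb'; apply: (mb b') => //; right.
  have bb : dsite y b = Ball by case: Qb => /Fball.
  have [lt|] := ltP b h0.
    have Fb : F b = Some h0.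
      by case: Qb => // Fb; have := no_cross_right cF Fb f0 (ltW lt); lia.
    have ab : a < b by rewrite ltNge; apply/negP => /(no_cross_right cF Fb (fa _)); lia.
    have := @left_compare GL (dclock y b) (b - sL) cGL f0.
    rewrite [sL + _]addrC subrK Fb => /(_ ltac:(lia) bb (lexx _)).
    case Gv: (GL (b - sL)) => [x|] //= [e]; apply: (nGL (b - sL)); rewrite Gv; congr Some.
    by move: e; rewrite /sL; lia.
  rewrite le_eqVlt => /orP[/eqP e|lt0]; first by move: bb; rewrite -e hh0.
  have [lt|] := ltP b h1.
    have := @block_compare GB (dclock y b) (b - h0) cGB f0 f1.
    rewrite [h0 + _]addrC subrK => /(_ ltac:(lia) bb (lexx _)).
    have [n0 n1] := nGB (b - h0).
    case Gv: (GB (b - h0)) => [x|] /=; last by case: Qb => ->.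
    case: Qb => -> [e]; [apply: n0|apply: n1]; rewrite Gv; congr Some; first lia.
    by move: e; rewrite /h1; lia.
  rewrite le_eqVlt => /orP[/eqP e|lt1]; first by move: bb; rewrite -e hh1.
  have Fb : F b = Some h1.
    by case: Qb => // Fb; have := no_cross_left cF Fb f1 (ltW lt1); lia.
  have ab : b < c by rewrite ltNge; apply/negP => /(no_cross_left cF Fb (fc _)); lia.
  have := @right_compare GR (dclock y b) (b - h1) cGR f1.
  rewrite [h1 + _]addrC subrK Fb => /(_ ltac:(lia) bb (lexx _)).
  case Gv: (GR (b - h1)) => [x|] //= [e]; apply: (nGR (b - h1)); rewrite Gv; congr Some; lia.
have f0 t : av t h0 by apply: hole_av => // b _ Fb; apply: (noQ b); left.
have f1 t : av t h1 by apply: hole_av => // b _ Fb; apply: (noQ b); right.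
split=> // x xW fx; have hx := av_hole fx.
have xW' : window n (x - h0) by rewrite /window; lia.
have := fillB (x - h0) xW'; rewrite /= [h0 + _]addrC subrK => /(_ hx) [v Gv].
have [vW bv] := cons_ball cGB Gv.
have Fv : F (h0 + v) = Some x.
  rewrite (@block_compare GB 1 v cGB (f0 _) (f1 _)) //.
  - by rewrite Gv /= [h0 + _]addrC subrK.
  - by move: (vW); rewrite /window /h1 /=; lia.
  - exact: ltW.
exact: not_filled fx Fv (clt1 _).
Qed.

End Gap.

(** * The cycle *)

Section Cycle.
Context {R : realType} (l : nat).
Implicit Types (y : data R).

Definition residue (x : int) : 'I_l.+1 := inord (absz (x %% l.+1%:Z)%Z).

(** Walks run on the integers and only their positions are reduced, so hitting statements on the
    line apply directly. *)
Definition cyc_sys y : golf_sys R ('I_l.+1) :=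
  GolfSys (fun i : 'I_l.+1 => dsite y i%:Z = Ball) (fun i : 'I_l.+1 => dsite y i%:Z = Hole)
    (fun=> False) (fun i : 'I_l.+1 => dclock y i%:Z) (fun i n => residue (dwalk y i%:Z n)).

Definition cyc_free y (i : 'I_l.+1) := exists G, [/\ consistent (cyc_sys y) G,
  dsite y i%:Z = Hole & forall b, G b <> Some i].

Lemma residueE x : (residue x : nat)%:Z = (x %% l.+1%:Z)%Z.
Proof.
have H1 : (0 <= x %% l.+1%:Z)%Z by apply: modz_ge0.
have H2 : (x %% l.+1%:Z < l.+1%:Z)%Z by apply: ltz_pmod.
by rewrite /residue inordK; lia.
Qed.

Lemma residue_eqP x z : (residue x == residue z) = (x == z %[mod l.+1%:Z])%Z.
Proof.
apply/eqP/eqP => [e|e]; first by rewrite -!residueE e.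
by rewrite /residue e.
Qed.

Lemma residue_ord (i : 'I_l.+1) : residue i%:Z = i.
Proof. by apply: val_inj; apply/eqP; rewrite -eqz_nat residueE modz_small //; have := ltn_ord i; lia. Qed.

Lemma residue_small x : 0 <= x < l.+1%:Z -> (residue x : nat)%:Z = x.
Proof. by move=> H; rewrite residueE modz_small. Qed.

Lemma residue0 : residue 0 = ord0. Proof. by apply: val_inj; apply/eqP; rewrite -eqz_nat residueE mod0z. Qed.
Lemma residue_max : residue (l%:Z + 1) = ord0.
Proof. by rewrite -residue0; apply/eqP; rewrite residue_eqP (_ : l%:Z + 1 = l.+1%:Z) ?modzz ?mod0z //; lia. Qed.

Lemma residue_ne0 x : window l x -> residue x <> ord0.
Proof.
move=> H /(congr1 (fun i : 'I_l.+1 => (i : nat)%:Z)); by rewrite residue_small /=; move: H; rewrite /window; lia.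
Qed.

Lemma window_residue_inj x z : window l x -> window l z -> residue x = residue z -> x = z.
Proof.
move=> Hx Hz /(congr1 (fun i : 'I_l.+1 => (i : nat)%:Z)).
by rewrite !residue_small //; move: Hx Hz; rewrite /window; lia.
Qed.

Lemma residue_onto (i : 'I_l.+1) : i <> ord0 -> window l i%:Z.
Proof.
move=> ni; have := ltn_ord i; have : (i : nat) != 0%N by apply/eqP => e; apply: ni; exact: val_inj.
by rewrite /window; lia.
Qed.

Definition ball_set y := [set i : 'I_l.+1 | ball_site (dsite y i%:Z)]%SET.
Definition hole_set y := [set i : 'I_l.+1 | hole_site (dsite y i%:Z)]%SET.

Lemma excess_cyc y : excess (dsite y) 0 l.+1 = #|hole_set y|%:Z - #|ball_set y|%:Z.
Proof.
have cE (Q : int -> bool) : count Q (sites 0 l.+1) = #|[set i : 'I_l.+1 | Q i%:Z]%SET|.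
  rewrite cardsE -sum1_card /sites count_map -sum1_count.
  rewrite -[n in iota _ n]subn0 -/(index_iota 0 l.+1) big_mkord.
  by apply: eq_bigl => i; rewrite /= add0r unfold_in.
by rewrite excess_count !cE.
Qed.

Lemma ball_setP y (i : 'I_l.+1) : reflect (dsite y i%:Z = Ball) (i \in ball_set y).
Proof. by rewrite inE /ball_site; apply: (iffP idP); case: (dsite _ _). Qed.
Lemma hole_setP y (i : 'I_l.+1) : reflect (dsite y i%:Z = Hole) (i \in hole_set y).
Proof. by rewrite inE /hole_site; apply: (iffP idP); case: (dsite _ _). Qed.

Variable y : data R.
Hypothesis ci : injective (dclock y).
Hypothesis cover : forall b (c : 'I_l.+1), exists n, residue (dwalk y b n) = c.

Lemma cyc_clock_inj z : injective (dclock z) -> injective (clock (cyc_sys z)).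
Proof. by move=> cz i j /cz /eqP; rewrite eqz_nat => /eqP; exact: val_inj. Qed.

Lemma cyc_exists z : injective (dclock z) -> exists G, consistent (cyc_sys z) G.
Proof.
move=> cz; apply: (@consistent_exists _ _ _ (enum (ball_set z))).
  by move=> b; rewrite mem_enum; split=> /ball_setP.
by move=> i j _ _; exact: cyc_clock_inj.
Qed.

(** A comparison of the cycle with itself; without sinks there is no boundary condition to check. *)
Lemma cyc_unique G G' : consistent (cyc_sys y) G -> consistent (cyc_sys y) G' -> G = G'.
Proof.
move=> cG cG'; apply: funext => v.
have [bv|nb] := pselect (isball (cyc_sys y) v); last by rewrite (cG v).1 // (cG' v).1.
have -> : G v = omap id (G' v).
  apply: (@comparison R _ _ (cyc_sys y) (cyc_sys y) id G G' (clock (cyc_sys y) v) (enum 'I_l.+1)) => //.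
  - by move=> u bu; split=> //; rewrite mem_enum.
  - by move=> b x bb _ _ _; exists b.
by case: (G' v).
Qed.

Lemma cyc_hole G b h : consistent (cyc_sys y) G -> G b = Some h -> h \in hole_set y.
Proof. by move=> cG /(cons_stops cG)[n [_ [[//|[/hole_setP]]]]]. Qed.

Lemma cyc_inj G b b' h : consistent (cyc_sys y) G -> G b = Some h -> G b' = Some h -> b = b'.
Proof.
move=> cG Gb Gb'; apply: (@cyc_clock_inj y ci).
by case: (ltgtP (clock (cyc_sys y) b) (clock (cyc_sys y) b')) => // lt;
  [case: (cons_inj cG (fun f => f) Gb Gb' lt) | case: (cons_inj cG (fun f => f) Gb' Gb lt)].
Qed.

(** Every walk visits [i], so a ball that finds nothing else would stop there. *)
Lemma cyc_total G (i b : 'I_l.+1) : consistent (cyc_sys y) G -> dsite y i%:Z = Hole ->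
  (forall b, G b <> Some i) -> b \in ball_set y -> exists h, G b = Some h.
Proof.
move=> cG hi ni /ball_setP bb; have [n Hn] := cover b%:Z i.
have [|h [m [_ Gb _]]] := @cons_some _ _ (cyc_sys y) G b n cG bb; last by exists h.
by right; rewrite /= Hn; split=> // -[b' [_ [_ /ni]]].
Qed.

Definition filled_set (G : 'I_l.+1 -> option 'I_l.+1) := [set odflt ord0 (G b) | b in ball_set y]%SET.

(** With one hole left free no ball is lost, so the filled holes are exactly as many as the
    balls. *)
Lemma card_filled G (i : 'I_l.+1) : consistent (cyc_sys y) G -> dsite y i%:Z = Hole ->
  (forall b, G b <> Some i) -> #|filled_set G| = #|ball_set y| /\ filled_set G \subset hole_set y :\ i.
Proof.
move=> cG hi ni; split.
  rewrite card_in_imset // => b b' /(cyc_total cG hi ni)[h Gb] /(cyc_total cG hi ni)[h' Gb'].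
  by rewrite Gb Gb' /= => e; apply: (cyc_inj cG Gb); rewrite e.
apply/fintype.subsetP => _ /imsetP[b /(cyc_total cG hi ni)[h Gb] ->]; rewrite Gb /= in_setD1 (cyc_hole cG Gb) andbT.
by apply/eqP => e; apply: (ni b); rewrite Gb e.
Qed.

Lemma cyc_free_exists : excess (dsite y) 0 l.+1 = 1 -> exists i, cyc_free y i.
Proof.
rewrite excess_cyc => D1; have [G cG] := cyc_exists ci.
have /fintype.subsetPn[i ih ni] : ~~ (hole_set y \subset filled_set G).
  apply/negP => /fintype.subset_leq_card; have := leq_imset_card (fun b => odflt ord0 (G b)) (ball_set y).
  by rewrite -/(filled_set G); lia.
exists i, G; split=> //; first exact/hole_setP.
move=> b Gb; move/negP: ni; apply; apply/imsetP; exists b; last by rewrite Gb.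
by apply/ball_setP; exact: cons_ball cG Gb.
Qed.

(** The filled holes number one less than all holes, which leaves room for a single free one. *)
Lemma cyc_free_unique (i j : 'I_l.+1) : excess (dsite y) 0 l.+1 = 1 -> cyc_free y i -> cyc_free y j -> i = j.
Proof.
rewrite excess_cyc => D1 [G [cG hi ni]] [G' [cG' hj]]; rewrite (cyc_unique cG' cG) => nj.
have [c1 /fintype.subset_leq_card c2] := card_filled cG hi ni.
have [_ s2] := card_filled cG hj nj; have [_ s1] := card_filled cG hi ni.
apply/eqP; apply/negPn/negP => ij.
have : filled_set G \subset hole_set y :\ i :\ j.
  by apply/fintype.subsetP => x xf; rewrite in_setD1 (fintype.subsetP s1 _ xf) andbT; have := fintype.subsetP s2 _ xf; rewrite in_setD1 => /andP[].
move/fintype.subset_leq_card; have := cardsD1 i (hole_set y); have := cardsD1 j (hole_set y :\ i).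
have -> : i \in hole_set y by exact/hole_setP.
have -> : j \in hole_set y :\ i by rewrite in_setD1 eq_sym ij; exact/hole_setP.
by lia.
Qed.

(** While vertex 0 is free the cycle can be cut there: both sinks [0] and [l + 1] of the window
    stand for it. *)
Lemma cyc_window_compare G G' t : consistent (cyc_sys y) G -> dsite y 0 = Hole ->
  consistent (int_sys y (window l)) G' -> avail (cyc_sys y) G t ord0 ->
  forall v, window l v -> dsite y v = Ball -> dclock y v <= t -> G (residue v) = omap residue (G' v).
Proof.
move=> cG h0 cG' f0 v vW bv vt.
have small u : window l u -> (residue u : nat)%:Z = u.
  by move=> uW; rewrite residue_small //; move: uW; rewrite /window; lia.
apply: (@comparison R _ _ (cyc_sys y) (int_sys y (window l)) residue G G' t (sites 0 l.+1)) => //.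
- move=> u [/= uW bu]; rewrite small //; split=> //.
  by rewrite mem_sites; move: uW; rewrite /window; lia.
- move=> u /= /contrapT uW; rewrite small //; split=> //; split=> [[]|] //.
- by move=> u u' /= /contrapT uW /contrapT uW'; exact: window_residue_inj.
- move=> u n /= [uW bu] mn en.
  have [->|->] : dwalk y u n = 0 \/ dwalk y u n = l%:Z + 1.
  + by apply: dwalk_exit => // m /mn /contrapT.
  + by rewrite residue0; split=> // x /contrapT /residue_ne0.
  + by rewrite residue_max; split=> // x /contrapT /residue_ne0.
- move=> b x /= bb _ _ _; exists b%:Z; rewrite residue_ord; split=> //; split=> //.
  by apply: residue_onto => e; move: bb; rewrite e h0.
Qed.

Lemma window_range G' v x : consistent (int_sys y (window l)) G' -> G' v = Some x ->
  window l x \/ x = 0 \/ x = l%:Z + 1.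
Proof.
move=> cG' Gv; have [vW bv] := cons_ball cG' Gv; have [n [/= <- [_ mn]]] := cons_stops cG' Gv.
have [|nW] := pselect (window l (dwalk y v n)); [by left|right].
apply: dwalk_exit => // m mn'; apply: contrapT => nWm; apply: (mn m mn').
by left.
Qed.

Lemma cyc_free_block : excess (dsite y) 0 l.+1 = 1 -> cyc_free y ord0 -> closed_block l y.
Proof.
move=> D1 [G [cG h0 n0]].
have f0 t : avail (cyc_sys y) G t ord0 by right; split=> // -[b [_ [_ /n0]]].
have [G' cG'] := @window_exists R y 0 (l%:Z + 1) ci.
have cmp v : window l v -> dsite y v = Ball -> G (residue v) = omap residue (G' v).
  by move=> vW bv; apply: (cyc_window_compare cG h0 cG' (f0 (dclock y v))).
have nb v : G' v <> Some 0 /\ G' v <> Some (l%:Z + 1).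
  by split=> Gv; have [vW bv] := cons_ball cG' Gv; have := cmp v vW bv; rewrite Gv /= ?residue0 ?residue_max => /n0.
exists G'; split=> //; split=> // h hW hh.
(* A hole that no ball fills would be a second free hole on the cycle. *)
have [b Gb] : exists b, G b = Some (residue h).
  apply: contrapT => nf; apply: (residue_ne0 hW).
  apply: (cyc_free_unique D1); last by exists G.
  exists G; split=> //; last by move=> b Gb; apply: nf; exists b.
  by rewrite residue_small //; move: hW; rewrite /window; lia.
have bb := cons_ball cG Gb.
have bW : window l b%:Z by apply: residue_onto => e; move: bb; rewrite /= e h0.
exists b%:Z; have := cmp _ bW bb; rewrite residue_ord Gb.
case Gv: (G' b) => [x|] //= [e]; congr Some.
case: (window_range cG' Gv) => [xW|[x0|x0]].
- by rewrite (window_residue_inj hW xW e).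
- by have [+ _] := nb b; rewrite Gv x0.
- by have [_ +] := nb b; rewrite Gv x0.
Qed.

(** In a closed block the filled holes are all holes except vertex 0. Since no ball is lost on the
    cycle, counting them gives the excess 1. *)
Lemma block_cyc_free : dsite y 0 = Hole -> closed_block l y ->
  excess (dsite y) 0 l.+1 = 1 /\ cyc_free y ord0.
Proof.
move=> h0 [G' [cG' [nb fillB]]]; have [G cG] := cyc_exists ci.
(* A ball that fills vertex 0 finds it free at its own clock, so the comparison with the window
   covers this very ball. *)
have n0 b : G b <> Some ord0.
  move=> Gb; have bb := cons_ball cG Gb.
  have bW : window l b%:Z by apply: residue_onto => e; move: bb; rewrite /= e h0.
  have f0 : avail (cyc_sys y) G (dclock y b%:Z) ord0 by have [n [_ []]] := cons_stops cG Gb.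
  have := cyc_window_compare cG h0 cG' f0 bW bb (lexx _); rewrite residue_ord Gb.
  case Gv: (G' b) => [x|] //= [e].
  case: (window_range cG' Gv) => [/residue_ne0|[x0|x0]]; first by rewrite e.
  - by have [+ _] := nb b; rewrite Gv x0.
  - by have [_ +] := nb b; rewrite Gv x0.
have f0 t : avail (cyc_sys y) G t ord0 by right; split=> // -[b [_ [_ /n0]]].
split; last by exists G.
rewrite excess_cyc; have [<- s1] := @card_filled G ord0 cG h0 n0.
have -> : filled_set G = hole_set y :\ ord0.
  apply/eqP; rewrite finset.eqEsubset s1; apply/fintype.subsetP => i; rewrite in_setD1 => /andP[/eqP i0 /hole_setP hi].
  have [v Gv] := fillB _ (residue_onto i0) hi.
  have [vW bv] := cons_ball cG' Gv.
  apply/imsetP; exists (residue v).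
    by apply/ball_setP; rewrite residue_small //; move: (vW); rewrite /window /=; lia.
  by rewrite (cyc_window_compare cG h0 cG' (f0 (dclock y v))) // Gv /= residue_ord.
rewrite [#|hole_set y|](cardsD1 ord0).
by have -> : ord0 \in hole_set y; [exact/hole_setP|lia].
Qed.

End Cycle.

Definition relabel (R : realType) (f : int -> int) (y : data R) : data R :=
  Data (fun k => dsite y (f k)) (fun k => dclock y (f k)) (fun k => dstep y (f k)).

(** * Rotation of the cycle *)

Section Rotation.
Context {R : realType} (l : nat).
Implicit Types (y : data R).

(** Fixing the sites outside the cycle makes this a bijection of the integers, so relabelling by it
    preserves the law of the whole environment. *)
Definition rotz (i k : int) : int :=
  if 0 <= k < l.+1%:Z then ((i + k) %% l.+1%:Z)%Z else k.

Lemma rotzK i : cancel (rotz i) (rotz (- i)).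
Proof.
move=> k; rewrite /rotz; case: (boolP (0 <= k < l.+1%:Z)) => [H|/negbTE-> //].
have H1 : (0 <= (i + k) %% l.+1%:Z)%Z by apply: modz_ge0.
have H2 : ((i + k) %% l.+1%:Z < l.+1%:Z)%Z by apply: ltz_pmod.
by rewrite H1 H2 /= modzDmr addKr modz_small.
Qed.

Lemma rotzVK i : cancel (rotz (- i)) (rotz i).
Proof. by move=> k; rewrite -{1}[i]opprK rotzK. Qed.

Lemma cyc_free_rot y (i : 'I_l.+1) : injective (dclock y) ->
  cyc_free y i <-> cyc_free (relabel (rotz i%:Z) y) (ord0 : 'I_l.+1).
Proof.
move=> ci; set y' := relabel _ _.
have ci' : injective (dclock y') by move=> u v /= /ci /(can_inj (@rotzK _)).
have small (v : 'I_l.+1) : 0 <= v%:Z < l.+1%:Z by have := ltn_ord v; lia.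
pose rho (v : 'I_l.+1) : 'I_l.+1 := residue l (i%:Z + v%:Z).
have rhoE v : (rho v)%:Z = rotz i%:Z v%:Z by rewrite /rho residueE /rotz small.
have rho0 : rho ord0 = i by rewrite /rho addr0 residue_ord.
have rho_inj : injective rho.
  move=> u v /(congr1 (fun x : 'I_l.+1 => (x : nat)%:Z)); rewrite !rhoE => /(can_inj (@rotzK _)) /eqP.
  by rewrite eqz_nat => /eqP; exact: val_inj.
have [g _ rhoK] : bijective rho by exact: injF_bij.
have main G G' : consistent (cyc_sys l y) G -> consistent (cyc_sys l y') G' ->
    forall v, G (rho v) = omap rho (G' v).
  move=> cG cG' v; have [bv|nb] := pselect (isball (cyc_sys l y') v); last first.
    by rewrite (cG' v).1 // (cG _).1 //= rhoE.
  apply: (@comparison R _ _ (cyc_sys l y) (cyc_sys l y') rho G G' (clock (cyc_sys l y') v) (enum 'I_l.+1)) => //.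
  - move=> u /= bu; rewrite rhoE; split=> //; first by rewrite mem_enum.
    move=> n; apply/eqP; rewrite {1}/rho residue_eqP residueE modzDmr /dwalk /= addrA.
    have E : ((i%:Z + u%:Z) %% l.+1%:Z = rotz i%:Z u%:Z %% l.+1%:Z)%Z by rewrite /rotz small modz_mod.
    by rewrite -modzDml -E modzDml.
  - by move=> u _ /=; rewrite rhoE; split.
  - by move=> u u' _ _; exact: rho_inj.
  - by move=> b x bb _ _ _; exists (g b); rewrite rhoK; split=> //=; rewrite -rhoE rhoK.
split=> [[G [cG hi ni]]|[G' [cG' hi ni]]].
- have [G' cG'] := @cyc_exists R l _ ci'.
  exists G'; split=> //; first by have := rhoE ord0; rewrite rho0 /= => <-.
  by move=> b Gb; apply: (ni (rho b)); rewrite (main G G') // Gb /= rho0.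
- have [G cG] := @cyc_exists R l _ ci.
  exists G; split=> //; first by have := rhoE ord0; rewrite rho0 /= => ->.
  move=> b; rewrite -(rhoK b) (main G G') //; case e: (G' (g b)) => [x|] //= [].
  by rewrite -rho0 => /rho_inj x0; apply: (ni (g b)); rewrite e x0.
Qed.

Lemma residue_cover y :
  (forall b (k : nat), exists n, dwalk y b n = b + k%:Z) \/
  (forall b (k : nat), exists n, dwalk y b n = b - k%:Z) ->
  forall b (c : 'I_l.+1), exists n, residue l (dwalk y b n) = c.
Proof.
move=> H b c.
have P x : (0 <= x %% l.+1%:Z)%Z by exact: modz_ge0.
case: H => H.
- have [n Hn] := H b (absz ((c%:Z - b) %% l.+1%:Z)%Z); exists n.
  apply/eqP; rewrite Hn -[X in _ == X](residue_ord c) residue_eqP gez0_abs //.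
  by rewrite modzDmr addrC subrK.
- have [n Hn] := H b (absz ((b - c%:Z) %% l.+1%:Z)%Z); exists n.
  apply/eqP; rewrite Hn -[X in _ == X](residue_ord c) residue_eqP gez0_abs //.
  by rewrite -modzDmr modzNm modzDmr; apply/eqP; congr (_ %% _)%Z; lia.
Qed.

End Rotation.

(** * Events and independent letters *)

Section SigmaAlgebra.
Context {T : Type} (M : set_system T) (hM : sigma_algebra setT M).
Implicit Types (f g : T -> Prop).

Lemma mS_ext f g : (forall y, f y <-> g y) -> M [set y | f y] -> M [set y | g y].
Proof. by move=> fg; rewrite (_ : [set y | f y] = [set y | g y]) //; apply/seteqP; split=> y /= /fg. Qed.

Lemma mS_not f : M [set y | f y] -> M [set y | ~ f y].
Proof.
by case: hM => _ C _ /C; apply: mS_ext => y; split=> [[]|].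
Qed.

Lemma mS_exists (I : countType) (f : I -> T -> Prop) :
  (forall i, M [set y | f i y]) -> M [set y | exists i, f i y].
Proof.
move=> mf; case: hM => M0 _ U.
have : M (\bigcup_n (if unpickle n is Some i then [set y | f i y] else set0)).
  by apply: U => n; case: (unpickle n).
apply: mS_ext => y; split=> [[n _]|[i fi]]; first by case: (unpickle n) => // i fi; exists i.
by exists (pickle i) => //; rewrite pickleK.
Qed.

Lemma mS_forall (I : countType) (f : I -> T -> Prop) :
  (forall i, M [set y | f i y]) -> M [set y | forall i, f i y].
Proof.
move=> mf; have : M [set y | ~ exists i, ~ f i y].
  by apply: mS_not; apply: mS_exists => i; exact: mS_not.
apply: mS_ext => y; split=> [H i|H [i]]; last by apply; exact: H.
by apply: contrapT => nf; apply: H; exists i.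
Qed.

Lemma mS_and f g : M [set y | f y] -> M [set y | g y] -> M [set y | f y /\ g y].
Proof.
move=> mf mg; have : M [set y | forall b : bool, (if b then f else g) y].
  by apply: mS_forall => -[].
by apply: mS_ext => y; split=> [H|[? ?] []//]; split; [exact: (H true)|exact: (H false)].
Qed.

Lemma mS_or f g : M [set y | f y] -> M [set y | g y] -> M [set y | f y \/ g y].
Proof.
move=> mf mg; have : M [set y | exists b : bool, (if b then f else g) y].
  by apply: mS_exists => -[].
by apply: mS_ext => y; split=> [[[]]|[]]; [left|right|exists true|exists false].
Qed.

Lemma mS_const (Q : Prop) : M [set y | Q].
Proof.
case: hM => M0 C _; have [q|q] := pselect Q; last by move: M0; congr M; apply/seteqP; split.
by move: (C _ M0); congr M; apply/seteqP; split=> // y _; split.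
Qed.

Lemma mS_imp f g : M [set y | f y] -> M [set y | g y] -> M [set y | f y -> g y].
Proof.
move=> mf mg; have := mS_or (mS_not mf) mg; apply: mS_ext => y; split=> [[]//|H].
by have [/H|] := pselect (f y); [right|left].
Qed.

Lemma mS_iff f g : M [set y | f y] -> M [set y | g y] -> M [set y | f y <-> g y].
Proof. by move=> mf mg; apply: mS_and; exact: mS_imp. Qed.

End SigmaAlgebra.

Section Prob.
Context {d : measure_display} {Omega : measurableType d} {R : realType}.
Variable P : probability Omega R.
Implicit Types (A B S : set Omega).

Definition Pr A : R := fine (P A).

Lemma PrE A : measurable A -> P A = (Pr A)%:E.
Proof. by move=> mA; rewrite /Pr fineK // fin_num_measure. Qed.

Lemma Pr_ge0 A : 0 <= Pr A.
Proof. exact/fine_ge0/measure_ge0. Qed.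

Lemma Pr_le A B : measurable A -> measurable B -> A `<=` B -> Pr A <= Pr B.
Proof. by move=> mA mB AB; rewrite -lee_fin -!PrE // le_measure // inE. Qed.

Lemma PrT : Pr setT = 1. Proof. by rewrite /Pr probability_setT. Qed.
Lemma Pr0 : Pr set0 = 0. Proof. by rewrite /Pr measure0. Qed.

Lemma Pr_le1 A : measurable A -> Pr A <= 1.
Proof. by move=> mA; rewrite -PrT; apply: Pr_le. Qed.

Lemma PrC A : measurable A -> Pr (~` A) = 1 - Pr A.
Proof.
move=> mA; apply: EFin_inj; rewrite -PrE; last exact: measurableC.
by rewrite probability_setC // PrE // EFinB.
Qed.

Lemma PrU A B : measurable A -> measurable B -> Pr (A `|` B) <= Pr A + Pr B.
Proof.
move=> mA mB; rewrite -lee_fin EFinD -!PrE //; last exact: measurableU.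
exact: measureU2.
Qed.

Lemma PrUI A B : measurable A -> measurable B -> A `&` B = set0 ->
  Pr (A `|` B) = Pr A + Pr B.
Proof.
move=> mA mB AB; apply: EFin_inj; rewrite EFinD -!PrE //; last exact: measurableU.
exact: measureU.
Qed.

Lemma measurable_seq (I : eqType) (s : seq I) (A : I -> set Omega) :
  (forall i, measurable (A i)) -> measurable [set w | exists2 i, i \in s & A i w].
Proof.
move=> mA; elim: s => [|i s IH].
  by rewrite (_ : mkset _ = set0); [exact: measurable0|apply/seteqP; split=> w // -[]].
rewrite (_ : mkset _ = A i `|` [set w | exists2 i, i \in s & A i w]); first exact: measurableU.
apply/seteqP; split=> w [].
- by move=> j; rewrite inE => /orP[/eqP->|js] Aj; [left|right; exists j].
- by exists i; rewrite ?mem_head.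
- by move=> [j js Aj]; exists j => //; rewrite inE js orbT.
Qed.

Lemma Pr_seq (I : eqType) (s : seq I) (A : I -> set Omega) : uniq s ->
  (forall i, measurable (A i)) -> (forall i j w, A i w -> A j w -> i = j) ->
  Pr [set w | exists2 i, i \in s & A i w] = \sum_(i <- s) Pr (A i).
Proof.
move=> us mA dA; elim: s us => [_|i s IH /andP[ni us]].
  by rewrite big_nil (_ : mkset _ = set0) ?Pr0 //; apply/seteqP; split=> w // -[].
rewrite big_cons -IH // -PrUI //; last 2 first.
- exact: measurable_seq.
- by apply/seteqP; split=> w //= [Ai [j js Aj]]; move: ni; rewrite (dA _ _ _ Ai Aj) js.
congr Pr; apply/seteqP; split=> w /=.
- by move=> [j]; rewrite inE => /orP[/eqP->|js] Aj; [left|right; exists j].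
- by move=> [Ai|[j js Aj]]; [exists i; rewrite ?mem_head|exists j => //; rewrite inE js orbT].
Qed.

Lemma Pr_split (T : finType) (Y : Omega -> T) A : measurable A ->
  (forall t, measurable [set w | Y w = t]) -> Pr A = \sum_t Pr [set w | A w /\ Y w = t].
Proof.
move=> mA mY; rewrite -(@Pr_seq _ _ (fun t => [set w | A w /\ Y w = t])) ?index_enum_uniq //.
- congr Pr; apply/seteqP; split=> w /=; last by case=> t _ [].
  by move=> Aw; exists (Y w); rewrite ?mem_index_enum.
- by move=> t; exact: (measurableI _ _ mA (mY t)).
- by move=> t t' w /= [_ <-] [_ <-].
Qed.

(** A bound on the outer probability, so that exceptional sets can be estimated without a proof that
    they are measurable. *)
Definition small (e : R) S := exists A, [/\ measurable A, S `<=` A & Pr A <= e].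

Lemma small_le e e' S : e <= e' -> small e S -> small e' S.
Proof. by move=> ee [A [mA SA PA]]; exists A; split=> //; exact: le_trans ee. Qed.

Lemma small_sub e S S' : S `<=` S' -> small e S' -> small e S.
Proof. by move=> SS [A [mA SA PA]]; exists A; split=> //; exact: subset_trans SA. Qed.

Lemma smallU e e' S S' : small e S -> small e' S' -> small (e + e') (S `|` S').
Proof.
move=> [A [mA SA PA]] [B [mB SB PB]]; exists (A `|` B); split; first exact: measurableU.
- by apply: setUSS.
- by apply: le_trans (PrU mA mB) _; exact: lerD.
Qed.

Lemma small_seq (I : eqType) (s : seq I) (S : I -> set Omega) e :
  (forall i, i \in s -> small e (S i)) -> small (e *+ size s) [set w | exists2 i, i \in s & S i w].
Proof.
elim: s => [_|i s IH H].
  exists set0; split; [exact: measurable0|by move=> w []|by rewrite Pr0 mulr0n].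
have /IH{}IH : forall j, j \in s -> small e (S j) by move=> j js; apply: H; rewrite inE js orbT.
rewrite /= mulrS; apply: small_sub (smallU (H i (mem_head _ _)) IH) => w [j].
by rewrite inE => /orP[/eqP->|js] Sj; [left|right; exists j].
Qed.

Lemma small_geometric (S : nat -> set Omega) (c q : R) : 0 <= c -> 0 <= q < 1 ->
  (forall j, small (c * q ^+ j) (S j)) -> small (c / (1 - q)) (\bigcup_j S j).
Proof.
move=> c0 /andP[q0 q1] H; have {}H := fun j => cid (H j).
pose A j := projT1 (H j).
have AP j : [/\ measurable (A j), S j `<=` A j & Pr (A j) <= c * q ^+ j] := projT2 (H j).
have mA j : measurable (A j) by case: (AP j).
have mU : measurable (\bigcup_j A j) by exact: bigcup_measurable.
exists (\bigcup_j A j); split=> //.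
  by move=> w [j _ Sj]; exists j => //; have [_ + _] := AP j; apply.
have sub : (P (\bigcup_j A j) <= \big[+%E/0%E]_(0 <= k <oo) P (A k))%E.
  by apply: measure_sigma_subadditive.
rewrite -lee_fin -PrE //; apply: (le_trans sub).
apply: lime_le; first by apply: is_cvg_nneseries => n _ _; exact: measure_ge0.
apply: nearW => n; rewrite (eq_bigr (fun j => (Pr (A j))%:E)); last by move=> j _; rewrite PrE.
rewrite sumEFin lee_fin; apply: (@le_trans _ _ (\sum_(0 <= j < n) c * q ^+ j)).
  by apply: ler_sum => j _; case: (AP j).
have q1' : 0 < 1 - q by rewrite subr_gt0.
have -> : \sum_(0 <= j < n) c * q ^+ j = c * (1 - q ^+ n) / (1 - q).
  have := @geometric_seriesE R c q; rewrite lt_eqF // => /(_ isT) /(congr1 (fun f => f n)).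
  by rewrite /series /=.
rewrite ler_pM2r ?invr_gt0 // ler_piMr // gerBl exprn_ge0 //.
Qed.

Lemma small_negligible S : (forall e, 0 < e -> small e S) -> P.-negligible S.
Proof.
move=> H; have H' n : small n.+1%:R^-1 S by apply: H; rewrite invr_gt0 ltr0n.
have {}H' := fun n => cid (H' n); pose A j := projT1 (H' j).
have AP j : [/\ measurable (A j), S `<=` A j & Pr (A j) <= j.+1%:R^-1] := projT2 (H' j).
have mA j : measurable (A j) by case: (AP j).
have mI : measurable (\bigcap_j A j) by exact: bigcap_measurable.
exists (\bigcap_j A j); split=> //; last by move=> w Sw j _; have [_ + _] := AP j; apply.
rewrite PrE //; congr EFin; apply/eqP; rewrite eq_le Pr_ge0 andbT.
apply/ler_addgt0Pr => e e0; rewrite add0r.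
have [n ne] : exists n, n.+1%:R^-1 < e by exists (Num.trunc e^-1); rewrite invf_plt ?posrE ?ltr0n // truncnS_gt.
apply: le_trans (ltW ne); have [_ _ Pn] := AP n; apply: le_trans Pn.
by apply: Pr_le => // w; exact.
Qed.

Lemma negligible_small S : P.-negligible S -> small 0 S.
Proof. by move=> [A [mA PA SA]]; exists A; split=> //; rewrite /Pr PA. Qed.

Lemma Pr_eq_near A B S e : measurable A -> measurable B -> small e S ->
  (forall w, ~ S w -> A w <-> B w) -> `|Pr A - Pr B| <= e.
Proof.
move=> mA mB [C [mC SC PC]] AB.
have sub A' B' : measurable A' -> measurable B' -> (forall w, ~ S w -> A' w -> B' w) ->
    Pr A' <= Pr B' + e.
  move=> mA' mB' H; apply: (@le_trans _ _ (Pr (B' `|` C))); last by apply: le_trans (PrU mB' mC) _; rewrite lerD2l.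
  apply: Pr_le => //; first exact: measurableU.
  by move=> w Aw; have [Sw|nS] := pselect (S w); [right; exact: SC|left; exact: H].
have := sub A B mA mB (fun w nS => (AB w nS).1).
have := sub B A mB mA (fun w nS => (AB w nS).2).
by rewrite ler_norml => H1 H2; apply/andP; split; lra.
Qed.

Lemma Pr_eq_ae A B S : measurable A -> measurable B -> P.-negligible S ->
  (forall w, ~ S w -> A w <-> B w) -> Pr A = Pr B.
Proof.
move=> mA mB /negligible_small nS AB; apply/eqP; rewrite -subr_eq0 -normr_le0.
exact: Pr_eq_near nS AB.
Qed.

End Prob.

(** * Words of independent letters *)

Section IidExpectation.
Context {R : realType} {T : finType} (q : T -> R).
Implicit Types (Phi Psi : seq T -> R).

(** The mean of [Phi] over words of [n] independent letters with weights [q], unfolded letter by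
    letter into finite sums. *)
Fixpoint iid_expect n Phi : R :=
  if n is n'.+1 then \sum_t q t * iid_expect n' (fun s => Phi (t :: s)) else Phi [::].

Lemma eq_iid_expect n Phi Psi : (forall s, size s = n -> Phi s = Psi s) ->
  iid_expect n Phi = iid_expect n Psi.
Proof.
elim: n Phi Psi => [|n IH] Phi Psi H /=; first exact: H.
by apply: eq_bigr => t _; congr (_ * _); apply: IH => s ss; apply: H; rewrite /= ss.
Qed.

Lemma iid_expect_le n Phi Psi : (forall t, 0 <= q t) ->
  (forall s, size s = n -> Phi s <= Psi s) -> iid_expect n Phi <= iid_expect n Psi.
Proof.
move=> q0; elim: n Phi Psi => [|n IH] Phi Psi H /=; first exact: H.
by apply: ler_sum => t _; apply: ler_wpM2l => //; apply: IH => s ss; apply: H; rewrite /= ss.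
Qed.

Lemma iid_expectZ n a Phi : iid_expect n (fun s => a * Phi s) = a * iid_expect n Phi.
Proof.
elim: n Phi => [|n IH] Phi //=; rewrite mulr_sumr; apply: eq_bigr => t _.
by rewrite IH mulrCA.
Qed.

Lemma iid_expectD n Phi Psi :
  iid_expect n (fun s => Phi s + Psi s) = iid_expect n Phi + iid_expect n Psi.
Proof.
elim: n Phi Psi => [|n IH] Phi Psi //=; rewrite -big_split; apply: eq_bigr => t _ /=.
by rewrite IH mulrDr.
Qed.

Lemma iid_expect_cat m n Phi : iid_expect (m + n) Phi =
  iid_expect m (fun s => iid_expect n (fun s' => Phi (s ++ s'))).
Proof. by elim: m Phi => [|m IH] Phi //=; apply: eq_bigr => t _; rewrite IH. Qed.

Lemma iid_expect_prod n (f : T -> R) :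
  iid_expect n (fun s => \prod_(t <- s) f t) = (\sum_t q t * f t) ^+ n.
Proof.
elim: n => [|n IH] /=; first by rewrite big_nil.
rewrite exprS mulr_suml; apply: eq_bigr => t _.
under eq_iid_expect do rewrite big_cons.
by rewrite iid_expectZ IH mulrA.
Qed.

Lemma iid_expect_cst n a : \sum_t q t = 1 -> iid_expect n (fun=> a) = a.
Proof. by move=> q1; elim: n => [|n IH] //=; rewrite -mulr_suml q1 mul1r. Qed.

Context {d : measure_display} {Omega : measurableType d} (P : probability Omega R).
Variable Y : nat -> Omega -> T.
Notation word k n w := [seq Y i w | i <- iota k n].
Hypothesis mY : forall i t, measurable [set w | Y i w = t].
Hypothesis lawY : forall s : seq T, Pr P [set w | word 0 (size s) w = s] = \prod_(t <- s) q t.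

Lemma measurable_word (Phi : pred (seq T)) k n : measurable [set w | Phi (word k n w)].
Proof.
elim: n k Phi => [|n IH] k Phi /=.
  by apply: (mS_const (@sigma_algebra_measurable _ Omega)).
have hM := @sigma_algebra_measurable _ Omega.
have : measurable [set w | exists t, Y k w = t /\ Phi (t :: word k.+1 n w)].
  by apply: (mS_exists hM) => t; apply: (mS_and hM) => //; exact: (IH k.+1 (fun s => Phi (t :: s))).
by apply: (mS_ext (M := measurable)) => w; split=> [[t [<-]]|H] //; exists (Y k w).
Qed.

Lemma Pr_word (Phi : pred (seq T)) n :
  Pr P [set w | Phi (word 0 n w)] = iid_expect n (fun s => (Phi s)%:R).
Proof.
(* The prefix [c] holds the letters already revealed, so that the induction can fix one more letter
   at a time. *)
suff H c : Pr P [set w | word 0 (size c) w = c /\ Phi (c ++ word (size c) n w)] =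
    (\prod_(t <- c) q t) * iid_expect n (fun s => (Phi (c ++ s))%:R).
  have := H [::]; rewrite big_nil mul1r => <-; congr Pr.
  by apply/seteqP; split=> w //= [].
have hM := @sigma_algebra_measurable _ Omega.
have mE (s : seq T) : measurable [set w | word 0 (size s) w = s].
  have := measurable_word (fun s' => s' == s) 0 (size s).
  by apply: (mS_ext (M := measurable)) => w; split=> /eqP.
elim: n c => [|n IH] c /=.
  rewrite cats0; case: (Phi c).
    by rewrite mulr1 -lawY; congr Pr; apply/seteqP; split=> w //= [].
  by rewrite mulr0 (_ : mkset _ = set0) ?Pr0 //; apply/seteqP; split=> w //= [].
rewrite (@Pr_split _ _ _ P T (Y (size c))) //; last first.
  apply: (mS_and hM) => //; have := measurable_word (fun s => Phi (c ++ s)) (size c) n.+1.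
  by apply: (mS_ext (M := measurable)) => w.
rewrite mulr_sumr; apply: eq_bigr => t _.
have := IH (rcons c t); rewrite -cats1 big_cat big_seq1 -mulrA.
under eq_iid_expect do rewrite -catA.
move=> <-; congr Pr; apply/seteqP; split=> w /=; rewrite size_cat addn1 -addn1 iotaD map_cat /= add0n.
- by move=> [[e H] <-]; rewrite e -catA.
- move=> [/eqP + H]; rewrite eqseq_cat ?size_map ?size_iota // => /andP[/eqP e /eqP[e']].
  by rewrite e e'; move: H; rewrite -catA.
Qed.

End IidExpectation.

(** * The law of the environment *)

Definition site_code (s : site) : option bool :=
  match s with Ball => Some true | Hole => Some false | Neutral => None end.
Definition site_decode (c : option bool) : site :=
  match c with Some true => Ball | Some false => Hole | None => Neutral end.
Lemma site_codeK : cancel site_code site_decode. Proof. by case. Qed.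
HB.instance Definition _ := Equality.copy site (can_type site_codeK).
HB.instance Definition _ := Choice.copy site (can_type site_codeK).
HB.instance Definition _ := Countable.copy site (can_type site_codeK).
HB.instance Definition _ := Finite.copy site (can_type site_codeK).

Lemma big_site (V : nmodType) (f : site -> V) : \sum_s f s = f Ball + f Hole + f Neutral.
Proof.
rewrite (bigD1 Ball) //= (bigD1 Hole) //= (bigD1 Neutral) //= big1 ?addr0 ?addrA //.
by case.
Qed.

Lemma pi_lambda (T : Type) (G L : set_system T) :
  setI_closed G -> dynkin L -> G `<=` L -> <<s G >> `<=` L.
Proof.
by move=> GI dL GL; rewrite -setI_closed_g_dynkin_g_sigma_algebra //; exact: smallest_sub.
Qed.

Section Agree.
Context {d : measure_display} {Omega : measurableType d} {R : realType}.
Variables (P : probability Omega R) (T : Type) (X X' : Omega -> T) (B : set Omega).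
Hypothesis mB : measurable B.

(** One extension step for two purposes: with [B] the whole space it gives equality of laws, with
    [X = X'] independence from [B]. *)
Lemma pi_lambda_agree (G : set_system T) : setI_closed G ->
  (forall E, G E -> [/\ measurable (X @^-1` E), measurable (X' @^-1` E) &
     Pr P (X @^-1` E `&` B) = Pr P B * Pr P (X' @^-1` E)]) ->
  forall E, <<s G >> E -> [/\ measurable (X @^-1` E), measurable (X' @^-1` E) &
     Pr P (X @^-1` E `&` B) = Pr P B * Pr P (X' @^-1` E)].
Proof.
move=> GI HG; apply: (@pi_lambda T G [set E | [/\ measurable (X @^-1` E), measurable (X' @^-1` E) &
     Pr P (X @^-1` E `&` B) = Pr P B * Pr P (X' @^-1` E)]]) => //; split.
- by rewrite /= !preimage_setT setTI PrT mulr1; split.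
- move=> E [mE mE' PE]; split; [exact: measurableC|exact: measurableC|].
  change (Pr P (~` (X @^-1` E) `&` B) = Pr P B * Pr P (~` (X' @^-1` E))).
  rewrite PrC // mulrBr mulr1 -PE.
  have -> : Pr P B = Pr P (~` (X @^-1` E) `&` B) + Pr P (X @^-1` E `&` B).
    rewrite -PrUI.
    + by rewrite -setIUl setUC setUv setTI.
    + by apply: measurableI => //; exact: measurableC.
    + exact: measurableI.
    + by apply/seteqP; split=> w //= [[nE _] [E' _]].
  by rewrite addrK.
- move=> E tE HE.
  have mX n : measurable (X @^-1` E n) by case: (HE n).
  have mX' n : measurable (X' @^-1` E n) by case: (HE n).
  have mU : measurable (\bigcup_n (X @^-1` E n)) by apply: bigcup_measurable => n _.
  have mU' : measurable (\bigcup_n (X' @^-1` E n)) by apply: bigcup_measurable => n _.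
  split; [exact: mU|exact: mU'|].
  change (Pr P ((\bigcup_n (X @^-1` E n)) `&` B) = Pr P B * Pr P (\bigcup_n (X' @^-1` E n))).
  have tr (Z : Omega -> T) (C : set Omega) : trivIset setT (fun n => Z @^-1` E n `&` C).
    move=> i j _ _ [w [[Ei _] [Ej _]]]; apply: tE => //.
    by exists (Z w).
  have tX' : trivIset setT (fun n => X' @^-1` E n).
    by move=> i j _ _ [w [Ei Ej]]; apply: tE => //; exists (X' w).
  apply: EFin_inj; rewrite EFinM -!PrE //; last exact: measurableI.
  rewrite setI_bigcupl measure_semi_bigcup //; last 2 first.
  + by move=> n; exact: measurableI.
  + by apply: bigcup_measurable => n _; exact: measurableI.
  rewrite measure_semi_bigcup //.
  rewrite (PrE P mB) -nneseriesZl //; apply: eq_eseriesr => n _.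
  transitivity (Pr P (X @^-1` E n `&` B))%:E; first exact/PrE/measurableI.
  by have [_ _ ->] := HE n; rewrite EFinM; congr (_ * _)%E; symmetry; exact: PrE.
Qed.

End Agree.

(** * Events of the environment on a set of sites *)

Section DataSigma.
Context {R : realType}.
Implicit Types (J K : int -> Prop).

Definition coord_events J : set_system (data R) := [set E | exists b, J b /\
  [\/ exists s, E = [set y | dsite y b = s],
      exists2 A, measurable A & E = [set y | A (dclock y b)] |
      exists n, E = [set y | dstep y b n = true]]].

Definition data_sigma J := <<s coord_events J >>.

(** The shape of the events in [golf_indep]. Boxes are stable under intersection and generate all
    events of [data_sigma J]. *)
Definition boxes J : set_system (data R) := [set E | exists (J1 J2 : seq int) (J3 : seq (int * nat))
    (A1 : int -> set site) (A2 : int -> set R) (A3 : int * nat -> set bool),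
  [/\ uniq J1, uniq J2 & uniq J3] /\
  [/\ {in J1, forall b, J b}, {in J2, forall b, J b} & {in J3, forall bn, J bn.1}] /\
  (forall b, measurable (A2 b)) /\
  E = [set y | (forall b : int, b \in J1 -> A1 b (dsite y b)) /\
               (forall b : int, b \in J2 -> A2 b (dclock y b)) /\
               (forall bn : int * nat, bn \in J3 -> A3 bn (dstep y bn.1 bn.2))]].

Lemma boxes_setI J : setI_closed (boxes J).
Proof.
move=> E E' [J1 [J2 [J3 [A1 [A2 [A3 [[u1 u2 u3] [[s1 s2 s3] [mA ->]]]]]]]]].
move=> [K1 [K2 [K3 [B1 [B2 [B3 [[v1 v2 v3] [[t1 t2 t3] [mB ->]]]]]]]]].
(* The index lists of the two boxes may overlap, so at each index only the constraints of the lists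
   that contain it are imposed. *)
pose mix (I : eqType) V (L M : seq I) (A B : I -> set V) b : set V :=
  [set v | (b \in L -> A b v) /\ (b \in M -> B b v)].
exists (undup (J1 ++ K1)), (undup (J2 ++ K2)), (undup (J3 ++ K3)),
  (mix _ _ J1 K1 A1 B1), (mix _ _ J2 K2 A2 B2), (mix _ _ J3 K3 A3 B3).
split; first by rewrite !undup_uniq.
split; first by split=> b; rewrite mem_undup mem_cat => /orP[];
  [exact: s1|exact: t1|exact: s2|exact: t2|exact: s3|exact: t3].
split.
  move=> b; rewrite /mix; have hM := @sigma_algebra_measurable _ R.
  exact: (mS_and hM (mS_imp hM (mS_const hM _) (mA b)) (mS_imp hM (mS_const hM _) (mB b))).
apply/seteqP; split=> y /=.
- move=> [[H1 [H2 H3]] [I1 [I2 I3]]]; split; [|split] => b _; split;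
  [exact: H1|exact: I1|exact: H2|exact: I2|exact: H3|exact: I3].
- move=> [H1 [H2 H3]]; split; split; [|split| |split] => b bs.
  + by have := H1 b; rewrite mem_undup mem_cat bs => /(_ isT)[+ _]; apply.
  + by have := H2 b; rewrite mem_undup mem_cat bs => /(_ isT)[+ _]; apply.
  + by have := H3 b; rewrite mem_undup mem_cat bs => /(_ isT)[+ _]; apply.
  + by have := H1 b; rewrite mem_undup mem_cat bs orbT => /(_ isT)[_]; apply.
  + by have := H2 b; rewrite mem_undup mem_cat bs orbT => /(_ isT)[_]; apply.
  + by have := H3 b; rewrite mem_undup mem_cat bs orbT => /(_ isT)[_]; apply.
Qed.

Lemma data_sigma_boxes J : data_sigma J `<=` <<s boxes J >>.
Proof.
apply: smallest_sub; first exact: smallest_sigma_algebra.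
move=> E [b [Jb H]]; apply: sub_gen_smallest.
case: H => [[s ->]|[A mA ->]|[n ->]].
- exists [:: b], [::], [::], (fun=> [set s]), (fun=> setT), (fun=> setT); split=> //; split.
    by split=> // c; rewrite inE => /eqP->.
  split=> //; apply/seteqP; split=> y /=.
    by move=> e; split=> // c; rewrite inE => /eqP->.
  by case=> /(_ b (mem_head _ _)).
- exists [::], [:: b], [::], (fun=> setT), (fun=> A), (fun=> setT); split=> //; split.
    by split=> // c; rewrite inE => /eqP->.
  split=> //; apply/seteqP; split=> y /=.
    by move=> e; split=> //; split=> // c; rewrite inE => /eqP->.
  by case=> _ [/(_ b (mem_head _ _))].
- exists [::], [::], [:: (b, n)], (fun=> setT), (fun=> setT), (fun=> [set true]); split=> //; split.
    by split=> // c; rewrite inE => /eqP->.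
  split=> //; apply/seteqP; split=> y /=.
    by move=> e; split=> //; split=> // c; rewrite inE => /eqP->.
  by case=> _ [_ /(_ (b, n) (mem_head _ _))].
Qed.

Lemma data_sigma_sub J K : (forall b, J b -> K b) -> data_sigma J `<=` data_sigma K.
Proof.
move=> JK; apply: smallest_sub; first exact: smallest_sigma_algebra.
by move=> E [b [/JK Kb H]]; apply: sub_gen_smallest; exists b.
Qed.

Lemma data_sigma_algebra J : sigma_algebra setT (data_sigma J).
Proof. exact: smallest_sigma_algebra. Qed.

Lemma data_site J b s : J b -> data_sigma J [set y | dsite y b = s].
Proof. by move=> Jb; apply: sub_gen_smallest; exists b; split=> //; constructor 1; exists s. Qed.

Lemma data_clock J b A : J b -> measurable A -> data_sigma J [set y | A (dclock y b)].
Proof. by move=> Jb mA; apply: sub_gen_smallest; exists b; split=> //; constructor 2; exists A. Qed.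

Lemma data_step J b n v : J b -> data_sigma J [set y | dstep y b n = v].
Proof.
move=> Jb; have T : data_sigma J [set y | dstep y b n = true].
  by apply: sub_gen_smallest; exists b; split=> //; constructor 3; exists n.
case: v => //; apply: mS_ext (mS_not (@data_sigma_algebra J) T) => // y.
by case: (dstep y b n).
Qed.

End DataSigma.

Section Model.
Context {d : measure_display} {Omega : measurableType d} {R : realType}.
Variable P : probability Omega R.

Definition golf_data (eta : int -> Omega -> site) (U : int -> Omega -> R)
  (xi : int -> nat -> Omega -> bool) (w : Omega) : data R :=
  Data (fun b => eta b w) (fun b => U b w) (fun b n => xi b n w).

Section One.
Variables (eta : int -> Omega -> site) (U : int -> Omega -> R) (xi : int -> nat -> Omega -> bool).
Variables (rho_b rho_h p : R).
Hypotheses (hind : golf_indep P eta U xi) (hlaw : golf_laws P eta U xi rho_b rho_h p).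

Definition site_weight (s : site) : R :=
  match s with Ball => rho_b | Hole => rho_h | Neutral => 1 - rho_b - rho_h end.
Definition step_weight (s : bool) : R := if s then p else 1 - p.

Lemma m_site b (A : set site) : measurable [set w | A (eta b w)].
Proof.
have [ms _] := hlaw; have hM := @sigma_algebra_measurable _ Omega.
have : measurable [set w | exists s : site, A s /\ eta b w = s].
  by apply: (mS_exists hM) => s; apply: (mS_and hM) => //; exact: (mS_const hM).
by apply: (mS_ext (M := measurable)) => w; split=> [[s [As ->]]|Aw] //; exists (eta b w).
Qed.

Lemma m_clock b A : measurable A -> measurable [set w | A (U b w)].
Proof. by have [_ [mU _]] := hlaw; exact: mU. Qed.

Lemma m_step b n (A : set bool) : measurable [set w | A (xi b n w)].
Proof.
have [_ [_ [mx _]]] := hlaw; have hM := @sigma_algebra_measurable _ Omega.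
have : measurable [set w | (A true /\ xi b n w = true) \/ (A false /\ ~ (xi b n w = true))].
  apply: (mS_or hM).
    by apply: (mS_and hM); [exact: (mS_const hM)|exact: mx].
  by apply: (mS_and hM); [exact: (mS_const hM)|apply: (mS_not hM); exact: mx].
apply: (mS_ext (M := measurable)) => w; case: (xi b n w); split.
- by case=> [[]|[]].
- by left.
- by case=> [[]|[]].
- by right.
Qed.

Lemma Pr_site b (A : set site) : Pr P [set w | A (eta b w)] = \sum_(s | `[< A s >]) site_weight s.
Proof.
rewrite (@Pr_split _ _ _ P _ (eta b) _ (m_site b A) (fun t => m_site b [set t])) [RHS]big_mkcond /=.
have [_ [_ [_ [eB [eH [eN _]]]]]] := hlaw.
apply: eq_bigr => s _; case: asboolP => [As|nA].
  rewrite (_ : mkset _ = [set w | eta b w = s]); last by apply/seteqP; split=> w /= [] // -> ; split.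
  by case: s As => _; rewrite /Pr ?eB ?eH ?eN.
by rewrite (_ : mkset _ = set0) ?Pr0 //; apply/seteqP; split=> w //= [/[swap] ->].
Qed.

Lemma Pr_step b n (A : set bool) : Pr P [set w | A (xi b n w)] = \sum_(s | `[< A s >]) step_weight s.
Proof.
have [_ [_ [_ [_ [_ [_ [_ eX]]]]]]] := hlaw.
have mT : measurable [set w | xi b n w = true] := m_step b n [set true].
have PT : Pr P [set w | xi b n w = true] = p by rewrite /Pr eX.
have PF : Pr P [set w | xi b n w = false] = 1 - p.
  rewrite -PT -PrC //; congr Pr; apply/seteqP; split=> w /=; first by move=> ->.
  by case: (xi b n w).
rewrite (@Pr_split _ _ _ P _ (xi b n) _ (m_step b n A) (fun t => m_step b n [set t])) [RHS]big_mkcond /=.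
apply: eq_bigr => s _; case: asboolP => [As|nA].
  rewrite (_ : mkset _ = [set w | xi b n w = s]); last by apply/seteqP; split=> w /= [] // -> ; split.
  by case: s As => _; rewrite ?PT ?PF.
by rewrite (_ : mkset _ = set0) ?Pr0 //; apply/seteqP; split=> w //= [/[swap] ->].
Qed.

Lemma Pr_clock b A : measurable A ->
  Pr P [set w | A (U b w)] = fine ((@lebesgue_measure R) (A `&` `[0, 1]%classic)).
Proof. by have [_ [_ [_ [_ [_ [_ [eU _]]]]]]] := hlaw; move=> mA; rewrite /Pr eU. Qed.

Lemma m_box J E : boxes J E -> measurable (golf_data eta U xi @^-1` E).
Proof.
move=> [J1 [J2 [J3 [A1 [A2 [A3 [_ [_ [mA ->]]]]]]]]].
have hM := @sigma_algebra_measurable _ Omega.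
apply: (mS_and hM); [|apply: (mS_and hM)]; apply: (mS_forall hM) => b;
  apply: (mS_imp hM) => //; try exact: (mS_const hM).
- exact: m_site.
- exact: m_clock.
- exact: m_step.
Qed.

Lemma m_data_all E : data_sigma (fun=> True) E -> measurable (golf_data eta U xi @^-1` E).
Proof.
move=> /data_sigma_boxes sE.
(* Only the measurability part is wanted, hence the empty conditioning event. *)
have mB : measurable (set0 : set Omega) := measurable0.
have [] := @pi_lambda_agree _ _ _ P _ (golf_data eta U xi) (golf_data eta U xi) set0 mB
  (boxes (fun=> True)) (@boxes_setI _ _) _ E sE => // E' /m_box mE'.
by rewrite setI0 Pr0 mul0r; split.
Qed.

Lemma m_data J E : data_sigma J E -> measurable (golf_data eta U xi @^-1` E).
Proof. by move=> sE; apply: m_data_all; apply: data_sigma_sub sE. Qed.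

Lemma Pr_box (J1 J2 : seq int) (J3 : seq (int * nat)) A1 A2 A3 :
  uniq J1 -> uniq J2 -> uniq J3 -> (forall b, measurable (A2 b)) ->
  Pr P (golf_data eta U xi @^-1`
     [set y | (forall b : int, b \in J1 -> A1 b (dsite y b)) /\
               (forall b : int, b \in J2 -> A2 b (dclock y b)) /\
               (forall bn : int * nat, bn \in J3 -> A3 bn (dstep y bn.1 bn.2))]) =
  (\prod_(b <- J1) \sum_(s | `[< A1 b s >]) site_weight s) *
  (\prod_(b <- J2) fine ((@lebesgue_measure R) (A2 b `&` `[0, 1]%classic))) *
  (\prod_(bn <- J3) \sum_(s | `[< A3 bn s >]) step_weight s).
Proof.
move=> u1 u2 u3 mA; rewrite /Pr (hind A1 A3 u1 u2 u3 mA); congr (_ * _ * _).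
- by apply: eq_bigr => b _; rewrite -(@Pr_site b).
- by apply: eq_bigr => b _; rewrite -(@Pr_clock b).
- by apply: eq_bigr => b _; rewrite -(@Pr_step b.1 b.2).
Qed.

Lemma indep_boxes J K E E' : (forall b, J b -> K b -> False) -> boxes J E -> boxes K E' ->
  Pr P (golf_data eta U xi @^-1` E `&` golf_data eta U xi @^-1` E') =
  Pr P (golf_data eta U xi @^-1` E') * Pr P (golf_data eta U xi @^-1` E).
Proof.
move=> dJK [J1 [J2 [J3 [A1 [A2 [A3 [[u1 u2 u3] [[s1 s2 s3] [mA ->]]]]]]]]].
move=> [K1 [K2 [K3 [B1 [B2 [B3 [[v1 v2 v3] [[t1 t2 t3] [mB ->]]]]]]]]].
rewrite !Pr_box //.
pose mix (I : eqType) V (L : seq I) (A B : I -> set V) b : set V := if b \in L then A b else B b.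
have nJK (I : eqType) (f : I -> int) (L M : seq I) : {in L, forall b, J (f b)} ->
    {in M, forall b, K (f b)} -> forall b, b \in M -> (b \in L) = false.
  by move=> H1 H2 b bM; apply/negP => /H1 Jb; exact: dJK Jb (H2 _ bM).
have n1 := nJK _ id _ _ s1 t1; have n2 := nJK _ id _ _ s2 t2; have n3 := nJK _ fst _ _ s3 t3.
have uq (I : eqType) (L M : seq I) : uniq L -> uniq M ->
    (forall b, b \in M -> (b \in L) = false) -> uniq (L ++ M).
  move=> uL uM H; rewrite cat_uniq uL uM andbT /=; apply/hasPn => b bM; by rewrite H.
transitivity (Pr P (golf_data eta U xi @^-1`
     [set y | (forall b : int, b \in J1 ++ K1 -> mix _ _ J1 A1 B1 b (dsite y b)) /\
               (forall b : int, b \in J2 ++ K2 -> mix _ _ J2 A2 B2 b (dclock y b)) /\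
               (forall bn : int * nat, bn \in J3 ++ K3 -> mix _ _ J3 A3 B3 bn (dstep y bn.1 bn.2))])).
  congr Pr; apply/seteqP; split=> w /=.
  - move=> [[H1 [H2 H3]] [I1 [I2 I3]]]; split; [|split] => b; rewrite mem_cat /mix => /orP[bL|bM];
    rewrite ?bL ?(n1 _ bM) ?(n2 _ bM) ?(n3 _ bM);
    [exact: H1|exact: I1|exact: H2|exact: I2|exact: H3|exact: I3].
  - move=> [H1 [H2 H3]]; split; split; [|split| |split] => b bs.
    + by have := H1 b; rewrite mem_cat /mix bs; apply.
    + by have := H2 b; rewrite mem_cat /mix bs; apply.
    + by have := H3 b; rewrite mem_cat /mix bs; apply.
    + by have := H1 b; rewrite mem_cat /mix bs orbT (n1 _ bs); apply.
    + by have := H2 b; rewrite mem_cat /mix bs orbT (n2 _ bs); apply.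
    + by have := H3 b; rewrite mem_cat /mix bs orbT (n3 _ bs); apply.
rewrite Pr_box; [|exact: uq|exact: uq|exact: uq|by move=> b; rewrite /mix; case: ifP].
rewrite !big_cat /=.
have e1 (I : eqType) (V : Type) (L M : seq I) (A B : I -> set V) (g : I -> set V -> R) :
   \prod_(b <- L) g b (mix _ _ L A B b) = \prod_(b <- L) g b (A b).
  by apply: eq_big_seq => b bL; rewrite /mix bL.
have e2 (I : eqType) (V : Type) (L M : seq I) (A B : I -> set V) (g : I -> set V -> R) :
   (forall b, b \in M -> (b \in L) = false) ->
   \prod_(b <- M) g b (mix _ _ L A B b) = \prod_(b <- M) g b (B b).
  by move=> H; apply: eq_big_seq => b bL; rewrite /mix H.
rewrite (e1 _ _ J1 K1 A1 B1 (fun b A => \sum_(s | `[< A s >]) site_weight s)).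
rewrite (e1 _ _ J2 K2 A2 B2 (fun b A => fine ((@lebesgue_measure R) (A `&` `[0, 1]%classic)))).
rewrite (e1 _ _ J3 K3 A3 B3 (fun b A => \sum_(s | `[< A s >]) step_weight s)).
rewrite (e2 _ _ J1 K1 A1 B1 (fun b A => \sum_(s | `[< A s >]) site_weight s)) //.
rewrite (e2 _ _ J2 K2 A2 B2 (fun b A => fine ((@lebesgue_measure R) (A `&` `[0, 1]%classic)))) //.
rewrite (e2 _ _ J3 K3 A3 B3 (fun b A => \sum_(s | `[< A s >]) step_weight s)) //.
by ring.
Qed.

(** Two extensions from boxes: [E] varies while [E'] is fixed, and for each box in the place of [E]
    the event [E'] varies in turn. *)
Lemma data_indep J K E E' : (forall b, J b -> K b -> False) -> data_sigma J E -> data_sigma K E' ->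
  Pr P (golf_data eta U xi @^-1` E `&` golf_data eta U xi @^-1` E') =
  Pr P (golf_data eta U xi @^-1` E) * Pr P (golf_data eta U xi @^-1` E').
Proof.
move=> dJK sE sE'; have mE' := m_data sE'; rewrite mulrC.
have [] := @pi_lambda_agree _ _ _ P _ (golf_data eta U xi) (golf_data eta U xi) _ mE'
  (boxes J) (@boxes_setI _ _) _ E (data_sigma_boxes sE) => // B bB.
have mB := m_box bB; split=> //.
have [] := @pi_lambda_agree _ _ _ P _ (golf_data eta U xi) (golf_data eta U xi) _ mB
  (boxes K) (@boxes_setI _ _) _ E' (data_sigma_boxes sE').
  by move=> B' bB'; split; [exact: m_box bB'|exact: m_box bB'|]; rewrite setIC (indep_boxes dJK) // mulrC.
by move=> _ _; rewrite setIC => ->; rewrite mulrC.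
Qed.

End One.

Lemma same_law eta U xi eta' U' xi' (rho_b rho_h p : R) :
  golf_indep P eta U xi -> golf_laws P eta U xi rho_b rho_h p ->
  golf_indep P eta' U' xi' -> golf_laws P eta' U' xi' rho_b rho_h p ->
  forall J E, data_sigma J E ->
  Pr P (golf_data eta U xi @^-1` E) = Pr P (golf_data eta' U' xi' @^-1` E).
Proof.
move=> hi hl hi' hl' J E sE.
have [] := @pi_lambda_agree _ _ _ P _ (golf_data eta U xi) (golf_data eta' U' xi') setT measurableT
  (boxes J) (@boxes_setI _ _) _ E (data_sigma_boxes sE); last by move=> _ _; rewrite setIT PrT mul1r.
move=> B bB; split; [exact: (m_box hl bB)|exact: (m_box hl' bB)|].
rewrite setIT PrT mul1r; move: bB => [J1 [J2 [J3 [A1 [A2 [A3 [[u1 u2 u3] [_ [mA ->]]]]]]]]].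
by rewrite (Pr_box hi hl) // (Pr_box hi' hl').
Qed.

Lemma relabel_indep eta U xi (f g : int -> int) : cancel f g -> cancel g f ->
  golf_indep P eta U xi ->
  golf_indep P (fun b => eta (f b)) (fun b => U (f b)) (fun b => xi (f b)).
Proof.
move=> fg gf H J1 J2 J3 A1 A2 A3 u1 u2 u3 mA.
have fi : injective f := can_inj fg.
pose f3 (bn : int * nat) := (f bn.1, bn.2); pose g3 (bn : int * nat) := (g bn.1, bn.2).
have fg3 : cancel f3 g3 by case=> b n; rewrite /f3 /g3 /= fg.
have := H (map f J1) (map f J2) (map f3 J3) (A1 \o g) (A2 \o g) (A3 \o g3).
rewrite !map_inj_uniq //; last exact: can_inj fg3.
move=> /(_ u1 u2 u3 (fun b => mA (g b))).
rewrite !big_map /=.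
under eq_bigr do rewrite fg.
under [X in _ * X * _]eq_bigr do rewrite fg.
under [X in _ * _ * X]eq_bigr do rewrite fg3.
move=> <-; congr (fine (P _)); apply/seteqP; split=> w /= [H1 [H2 H3]].
- split; [|split] => _ /mapP[b bJ ->]; rewrite ?fg ?fg3; [exact: H1|exact: H2|exact: H3].
- split; [|split] => b bJ.
  + by have := H1 (f b); rewrite fg; apply; exact: map_f.
  + by have := H2 (f b); rewrite fg; apply; exact: map_f.
  + by have := H3 (f3 b); rewrite fg3; apply; exact: map_f.
Qed.

Lemma relabel_laws eta U xi (f : int -> int) (rho_b rho_h p : R) :
  golf_laws P eta U xi rho_b rho_h p ->
  golf_laws P (fun b => eta (f b)) (fun b => U (f b)) (fun b => xi (f b)) rho_b rho_h p.
Proof.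
move=> [h1 [h2 [h3 [h4 [h5 [h6 [h7 h8]]]]]]].
split; first by move=> b; exact: h1.
split; first by move=> b; exact: h2.
split; first by move=> b; exact: h3.
split; first by move=> b; exact: h4.
split; first by move=> b; exact: h5.
split; first by move=> b; exact: h6.
by split=> [b A mA|b n]; [exact: h7|exact: h8].
Qed.

End Model.

Import numFieldNormedType.Exports.

(** * Hitting probabilities and exponential bounds *)

Section RealBounds.
Context {R : realType}.

Lemma geometric_small (q e : R) : 0 <= q < 1 -> 0 < e -> exists n, q ^+ n < e.
Proof.
move=> /andP[q0 q1] e0; have q1' : `|q| < 1 by rewrite ger0_norm.
have /cvgrPdist_lt/(_ e e0)[n _ Hn] := cvg_expr q1'.
by exists n; have := Hn n (leqnn n); rewrite /= sub0r normrN ger0_norm ?exprn_ge0.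
Qed.

Lemma geometric_le (q : R) m n : 0 <= q < 1 -> (m <= n)%N -> q ^+ n <= q ^+ m.
Proof. by move=> /andP[q0 /ltW q1] mn; apply: ler_wiXn2l. Qed.

(* Bernoulli's inequality for [1 + a], combined with [(1 - a) * (1 + a) <= 1]. *)
Lemma expr_onem_le (a : R) n : 0 <= a <= 1 -> (1 - a) ^+ n * (1 + n%:R * a) <= 1.
Proof.
move=> /andP[a0 a1]; elim: n => [|n IH]; first by rewrite expr0 mul0r addr0 mul1r.
rewrite exprSr; apply: le_trans IH; rewrite -mulrA; apply: ler_wpM2l.
  by rewrite exprn_ge0 // subr_ge0.
have n0 : 0 <= n%:R :> R by rewrite ler0n.
rewrite -natr1; nra.
Qed.

End RealBounds.

(** Decides whether the walk with steps [s] ever visits level [k]. The remaining distance is updated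
    rather than the position, and the predecessor is taken only at [k > 0] since distance 0 has
    already answered. *)
Fixpoint reach (s : seq bool) (k : nat) : bool :=
  (k == 0%N) || (if s is v :: s' then reach s' (if v then k.-1 else k.+1) else false).

Definition up (v : bool) : int := if v then 1 else -1.

Lemma reachP (z : nat -> bool) j N k :
  reach [seq z i | i <- iota j N] k <->
  exists2 m, (m <= N)%N & \sum_(i < m) up (z (j + i)%N) = k%:Z.
Proof.
elim: N j k => [|N IH] j k /=.
  rewrite orbF; split=> [/eqP->|[[|//] _]]; first by exists 0%N; rewrite ?big_ord0.
  by rewrite big_ord0 => -[<-].
case: k => [|k] /=; first by split=> // _; exists 0%N; rewrite ?big_ord0.
have sumS m : \sum_(i < m.+1) up (z (j + i)%N) = up (z j) + \sum_(i < m) up (z (j.+1 + i)%N).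
  rewrite big_ord_recl /= addn0; congr (_ + _); apply: eq_bigr => i _.
  by rewrite /bump leq0n add1n addnS addSn.
rewrite IH; split=> [[m mN e]|[[|m] mN]].
- exists m.+1 => //; rewrite sumS e /up; case: (z j); lia.
- by rewrite big_ord0; lia.
- by rewrite sumS /up => e; exists m => //; move: e; case: (z j); lia.
Qed.

Section Reach.
Context {R : realType} (p : R).
Hypothesis p01 : 0 <= p <= 1.

Definition reach_prob N k : R := iid_expect (step_weight p) N (fun s => (reach s k)%:R).

Lemma step_weight_ge0 v : 0 <= step_weight p v.
Proof. by case/andP: p01 => p0 p1; case: v => //=; rewrite subr_ge0. Qed.

Lemma step_weight_sum : \sum_v step_weight p v = 1.
Proof. by rewrite big_bool /= addrC subrK. Qed.

Lemma reach0 s : reach s 0. Proof. by case: s. Qed.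

Lemma reach_prob0 N : reach_prob N 0 = 1.
Proof.
rewrite /reach_prob; under eq_iid_expect do rewrite reach0.
by rewrite iid_expect_cst // step_weight_sum.
Qed.

Lemma reach_probS N k : reach_prob N.+1 k.+1 = p * reach_prob N k + (1 - p) * reach_prob N k.+2.
Proof. by rewrite /reach_prob /= big_bool. Qed.

Lemma reach_prob_ge0 N k : 0 <= reach_prob N k.
Proof.
rewrite -{1}(iid_expect_cst N 0 step_weight_sum).
apply: iid_expect_le => [v|s _]; [exact: step_weight_ge0|by rewrite ler0n].
Qed.

Lemma reach_prob_le1 N k : reach_prob N k <= 1.
Proof.
rewrite -[leRHS](iid_expect_cst N 1 step_weight_sum).
apply: iid_expect_le => [v|s _]; [exact: step_weight_ge0|by rewrite lern1 leq_b1].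
Qed.

(* [k |-> (p / (1 - p)) ^ k] is harmonic for the walk. *)
Lemma reach_prob_drift N k : p < 1 / 2 -> reach_prob N k <= (p / (1 - p)) ^+ k.
Proof.
move=> ph; have /andP[p0 p1] := p01; have q0 : 0 < 1 - p by lra.
set r := p / (1 - p); have r0 : 0 <= r by rewrite divr_ge0 // ltW.
have rE : r * (1 - p) = p by rewrite divfK // gt_eqF.
elim: N k => [|N IH] [|k]; rewrite ?reach_prob0 ?expr0 //.
  by rewrite /reach_prob /= exprn_ge0.
rewrite reach_probS; apply: (@le_trans _ _ (p * r ^+ k + (1 - p) * r ^+ k.+2)).
  by apply: lerD; apply: ler_wpM2l => //; exact: ltW.
have -> : p * r ^+ k = r ^+ k.+1 * (1 - p) by rewrite -{1}rE exprS; ring.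
have -> : (1 - p) * r ^+ k.+2 = r ^+ k.+1 * p by rewrite -{2}rE !exprS; ring.
by rewrite -mulrDr subrK mulr1.
Qed.

Lemma reach_prob_homo k : {homo (fun N => reach_prob N k) : m n / (m <= n)%N >-> m <= n}.
Proof.
apply: homo_leq => [//|x y z|n]; first exact: le_trans.
elim: n k => [|n IH] [|k]; rewrite ?reach_prob0 //.
  by rewrite {1}/reach_prob /= reach_prob_ge0.
have /andP[p0 p1] := p01; have q0 : 0 <= 1 - p by rewrite subr_ge0.
by rewrite !(reach_probS _ k); apply: lerD; apply: ler_wpM2l => //; exact: IH.
Qed.

(* The differences of the limiting hitting probabilities grow geometrically with ratio
   [p / (1 - p) >= 1] while their sum stays bounded, so they vanish. *)
Lemma reach_prob_recurrent k (e : R) : 1 / 2 <= p -> 0 < e -> exists N, 1 - e < reach_prob N k.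
Proof.
move=> ph e0; have /andP[p0 p1] := p01.
have cv j : cvgn (fun N => reach_prob N j).
  apply: nondecreasing_is_cvgn; first exact: reach_prob_homo.
  by exists 1 => _ [N _ <-]; exact: reach_prob_le1.
pose h j := limn (fun N => reach_prob N j).
have hE j : (fun N => reach_prob N j) @ \oo --> h j by exact: cv.
have h_ge0 j : 0 <= h j by apply: limr_ge; [exact: cv|apply: nearW => N; exact: reach_prob_ge0].
have h_le1 j : h j <= 1 by apply: limr_le; [exact: cv|apply: nearW => N; exact: reach_prob_le1].
have h0 : h 0%N = 1.
  apply: (@cvg_lim _ _); first exact: Rhausdorff.
  by under eq_fun do rewrite reach_prob0; exact: cvg_cst.
have hS j : h j.+1 = p * h j + (1 - p) * h j.+2.
  apply: (@cvg_lim _ _); first exact: Rhausdorff.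
  rewrite -cvg_shiftS; under eq_fun do rewrite reach_probS.
  by apply: cvgD; apply: cvgMr; exact: hE.
pose D j := h j - h j.+1.
have DS j : p * D j = (1 - p) * D j.+1 by rewrite /D hS; ring.
have D00 : 0 <= D 0%N by rewrite /D h0 subr_ge0.
have Dmon j : 0 <= D j /\ (p < 1 -> D 0%N <= D j).
  elim: j => [//|j [IH0 IH]].
  have [p1'|p1'] := ltP p 1; last first.
    have p1E : p = 1 by apply/le_anti/andP.
    split=> //; have := DS j.+1; have := DS j; rewrite p1E subrr !mul0r !mul1r => Dj ->.
    by [].
  have DD : D j <= D j.+1.
    rewrite -(ler_pM2l (_ : 0 < 1 - p)) ?subr_gt0 // -DS; apply: ler_wpM2r => //; lra.
  by split=> [|_]; apply: le_trans DD => //; exact: IH.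
have D0 : D 0%N = 0.
  have [p1'|p1'] := ltP p 1; last first.
    have p1E : p = 1 by apply/le_anti/andP.
    by have := DS 0%N; rewrite p1E subrr mul0r mul1r.
  have S n : n%:R * D 0%N <= 1 - h n.
    elim: n => [|n IHn]; first by rewrite mul0r h0 subrr.
    have [_ /(_ p1')] := Dmon n; rewrite -natr1 mulrDl mul1r /D => H.
    by move: IHn H; rewrite /D; lra.
  apply/eqP; rewrite eq_le D00 andbT leNgt; apply/negP => Dp.
  pose n := (Num.trunc (D 0%N)^-1).+1.
  have : 1 < n%:R * D 0%N by rewrite -ltr_pdivrMr // div1r truncnS_gt.
  by have := S n; have := h_ge0 n; lra.
have hk : h k = 1.
  have H j : h j = 1 /\ D j = 0.
    elim: j => [//|j [hj Dj]].
    have hj1 : h j.+1 = 1 by move: Dj; rewrite /D hj; lra.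
    split=> //; have [p1'|p1'] := ltP p 1.
      have := DS j; rewrite Dj mulr0 => /esym/eqP; rewrite mulf_eq0 subr_eq0 gt_eqF //= => /eqP.
      by [].
    have p1E : p = 1 by apply/le_anti/andP.
    by have := DS j.+1; rewrite p1E subrr mul0r mul1r.
  by case: (H k).
have /cvgrPdist_lt/(_ e e0)[N _ HN] := hE k.
exists N; have := HN N (leqnn N); rewrite /= hk ltr_norml => /andP[_]; lra.
Qed.

End Reach.

(** * Exponential bounds for the excess *)

Section Chernoff.
Context {R : realType} (rho_b rho_h theta : R).
Hypotheses (hb : 0 < rho_b) (hbh : rho_b < rho_h) (hsum : rho_b + rho_h <= 1).
Hypotheses (t01 : 0 < theta < 1) (tE : rho_b = rho_h * theta ^+ 2).
Notation q := (site_weight rho_b rho_h).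

(** The mean of [theta ^ excess1]: with [rho_b = rho_h * theta ^ 2] a ball and a hole both
    contribute [rho_h * theta], and completing the square leaves this form. *)
Definition decay : R := 1 - rho_h * (1 - theta) ^+ 2.

Let hh : 0 < rho_h. Proof. exact: lt_trans hbh. Qed.

Lemma site_weight_ge0 s : 0 <= q s.
Proof. by case: s => /=; [exact: ltW|exact: ltW|rewrite -addrA -opprD subr_ge0]. Qed.

Lemma site_weight_sum : \sum_s q s = 1.
Proof. by rewrite big_site /=; ring. Qed.

Lemma decay01 : 0 <= decay < 1.
Proof.
have /andP[t0 t1] := t01; rewrite /decay; apply/andP; split; last first.
  by rewrite ltrBlDr ltrDl mulr_gt0 // exprn_gt0 // subr_gt0.
have : rho_h * (1 - theta) ^+ 2 <= rho_h * 1.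
  by apply: ler_wpM2l; [exact: ltW|rewrite exprn_ile1 //; lra].
have := hsum; have := hb; lra.
Qed.

Definition word_excess (s : seq site) : int := \sum_(t <- s) excess1 t.

Lemma theta_excess s : \prod_(t <- s) (theta ^ excess1 t) = theta ^ word_excess s.
Proof.
have /andP[t0 t1] := t01; rewrite /word_excess; elim: s => [|t s IH]; first by rewrite !big_nil.
by rewrite !big_cons IH expfzDr // gt_eqF.
Qed.

Lemma decayE : \sum_s q s * theta ^ excess1 s = decay.
Proof.
have /andP[t0 t1] := t01; have tn : theta != 0 by rewrite gt_eqF.
rewrite big_site /= !expr1z expr0z /decay tE.
rewrite (_ : theta ^ (-1) = theta^-1) //; field.
by [].
Qed.

Lemma exprz_theta_ge1 (z : int) : z <= 0 -> 1 <= theta ^ z.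
Proof.
have /andP[t0 t1] := t01; move=> z0; have -> : z = - (absz z)%:Z by lia.
rewrite -invr_expz -exprnP invf_ge1; first by rewrite exprn_ile1 // ltW.
exact: exprn_gt0.
Qed.

(** Markov's inequality for [theta ^ word_excess]; low excess makes this power large because
    [theta < 1]. *)
Lemma word_excess_chernoff n (k : int) :
  iid_expect q n (fun s => (word_excess s <= k)%R%:R) <= theta ^ (- k) * decay ^+ n.
Proof.
have /andP[t0 t1] := t01; have tn : theta != 0 by rewrite gt_eqF.
rewrite -decayE -iid_expect_prod -iid_expectZ; apply: iid_expect_le => [|s _].
  exact: site_weight_ge0.
rewrite theta_excess -expfzDr //; case: (leP (word_excess s) k) => [H|_]; last by rewrite mulr0n; apply: exprz_ge0; exact: ltW.
by apply: exprz_theta_ge1; lia.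
Qed.

Lemma iid_all_holes n : iid_expect q n (fun s => (all hole_site s)%:R) = rho_h ^+ n.
Proof.
have E : \sum_s q s * (hole_site s)%:R = rho_h by rewrite big_site /=; ring.
rewrite -[in RHS]E -iid_expect_prod; apply: eq_iid_expect => s _.
elim: s => [|t s IH]; first by rewrite big_nil.
by rewrite big_cons -IH /=; case: (hole_site t); rewrite ?mul1r ?mul0r.
Qed.

Lemma iid_cluster_right n m (k : int) :
  iid_expect q (n + m) (fun s => (all hole_site (take n s) && (word_excess (drop n s) <= k)%R)%:R)
  <= rho_h ^+ n * (theta ^ (- k) * decay ^+ m).
Proof.
rewrite iid_expect_cat -iid_all_holes [leRHS]mulrC -iid_expectZ.
apply: iid_expect_le => [|s sn]; first exact: site_weight_ge0.
rewrite (@eq_iid_expect _ _ _ _ _ (fun s' => (all hole_site s)%:R * (word_excess s' <= k)%R%:R)).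
  by rewrite iid_expectZ mulrC; apply: ler_wpM2r; [rewrite ler0n|exact: word_excess_chernoff].
by move=> s' _; rewrite -sn take_size_cat // drop_size_cat //; case: (all _ _); rewrite ?mul1r ?mul0r.
Qed.

Lemma iid_cluster_left n m (k : int) :
  iid_expect q (m + n) (fun s => (all hole_site (drop m s) && (word_excess (take m s) <= k)%R)%:R)
  <= rho_h ^+ n * (theta ^ (- k) * decay ^+ m).
Proof.
rewrite iid_expect_cat; apply: (@le_trans _ _ (rho_h ^+ n * iid_expect q m (fun s => (word_excess s <= k)%R%:R))).
  rewrite -iid_expectZ; apply: iid_expect_le => [|s sm]; first exact: site_weight_ge0.
  rewrite (@eq_iid_expect _ _ _ _ _ (fun s' => (word_excess s <= k)%R%:R * (all hole_site s')%:R)).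
    by rewrite iid_expectZ iid_all_holes mulrC.
  by move=> s' _; rewrite -sm take_size_cat // drop_size_cat //; case: (all _ _); rewrite ?mulr1 ?mulr0.
by apply: ler_wpM2l; [rewrite exprn_ge0 // ltW|exact: word_excess_chernoff].
Qed.

Fixpoint no_cluster n M (s : seq site) : bool :=
  if M is M'.+1 then ~~ all hole_site (take n s) && no_cluster n M' (drop n s) else true.

Lemma iid_no_cluster n M :
  iid_expect q (M * n) (fun s => (no_cluster n M s)%:R) = (1 - rho_h ^+ n) ^+ M.
Proof.
elim: M => [|M IH]; first by rewrite mul0n /= expr0.
rewrite mulSn iid_expect_cat exprS -IH.
rewrite (@eq_iid_expect _ _ _ _ _ (fun s => (no_cluster n M [::])%:R * 0 +
   iid_expect q (M * n) (fun s => (no_cluster n M s)%:R) * (1 - (all hole_site s)%:R))); last first.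
  move=> s sn; rewrite mulr0 add0r mulrC -iid_expectZ; apply: eq_iid_expect => s' _ /=.
  rewrite -sn take_size_cat // drop_size_cat //.
  by case: (all _ _); rewrite /= ?subrr ?subr0 ?mul0r ?mul1r.
rewrite (@eq_iid_expect _ _ _ _ _ (fun s => iid_expect q (M * n) (fun s => (no_cluster n M s)%:R) *
   (1 + (-1) * (all hole_site s)%:R))); last by move=> s _; rewrite mulr0 add0r mulN1r.
rewrite iid_expectZ iid_expectD iid_expect_cst ?site_weight_sum // iid_expectZ iid_all_holes.
by rewrite mulN1r mulrC.
Qed.

End Chernoff.

(** * Almost sure properties *)

Section AlmostSure.
Context {d : measure_display} {Omega : measurableType d} {R : realType}.
Variable P : probability Omega R.
Variables (eta : int -> Omega -> site) (U : int -> Omega -> R) (xi : int -> nat -> Omega -> bool).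
Variables (rho_b rho_h p : R).
Hypotheses (hb : 0 < rho_b) (hbh : rho_b < rho_h) (hsum : rho_b + rho_h <= 1).
Hypotheses (hp0 : 0 <= p) (hp1 : p <= 1).
Hypotheses (hind : golf_indep P eta U xi) (hlaw : golf_laws P eta U xi rho_b rho_h p).
Notation dat := (golf_data eta U xi).
Notation env w := (fun b : int => eta b w).
Notation q := (site_weight rho_b rho_h).

Lemma sum_pred1 (T : finType) (f : T -> R) (A : set T) c : A = [set c] ->
  \sum_(t | `[< A t >]) f t = f c.
Proof. by move=> ->; apply: big_pred1 => t; apply/asboolP/eqP. Qed.

Lemma eta_word_law x (s : seq site) :
  Pr P [set w | [seq eta (x + i%:Z) w | i <- iota 0 (size s)] = s] = \prod_(t <- s) q t.
Proof.
have := @Pr_box _ _ _ P eta U xi rho_b rho_h p hind hlaw (sites x (size s)) [::] [::]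
  (fun b => [set nth Neutral s (absz (b - x)%R)]) (fun=> setT) (fun=> setT)
  (uniq_sites _ _) isT isT (fun=> measurableT).
rewrite !big_nil !mulr1 => H.
transitivity (\prod_(b <- sites x (size s)) q (nth Neutral s (absz (b - x)%R))).
  rewrite -[LHS]/(_) -(eq_bigr _ (fun b _ => sum_pred1 q (erefl [set nth Neutral s (absz (b - x)%R)]))) -H.
  congr Pr; apply/seteqP; split=> w /=.
  - move=> e; split=> // b; rewrite mem_sites => bs.
    rewrite -e (nth_map 0%N) ?size_iota ?nth_iota ?add0n; [|lia..].
    by congr (eta _ w); lia.
  - move=> [H1 _]; apply: (@eq_from_nth _ Neutral); rewrite size_map size_iota // => i iN.
    rewrite (nth_map 0%N) ?size_iota // nth_iota // add0n (H1 (x + i%:Z)); last by rewrite mem_sites; lia.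
    by congr nth; lia.
rewrite /sites big_map (big_nth Neutral) /index_iota subn0; apply: eq_bigr => i _.
by congr (q (nth _ _ _)); lia.
Qed.

Lemma env_sites x n w : [seq eta (x + i%:Z) w | i <- iota 0 n] = map (env w) (sites x n).
Proof. by rewrite /sites -map_comp. Qed.

Lemma m_eta i b : measurable [set w | eta b w = i].
Proof. exact: (m_site hlaw b [set i]). Qed.

Lemma measurable_sites (Phi : pred (seq site)) x n : measurable [set w | Phi (map (env w) (sites x n))].
Proof.
rewrite (_ : mkset _ = [set w | Phi [seq eta (x + i%:Z) w | i <- iota 0 n]]).
  by apply: measurable_word => i t; exact: m_eta.
by apply/seteqP; split=> w /=; rewrite env_sites.
Qed.

Lemma Pr_sites (Phi : pred (seq site)) x n :
  Pr P [set w | Phi (map (env w) (sites x n))] = iid_expect q n (fun s => (Phi s)%:R).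
Proof.
rewrite (_ : mkset _ = [set w | Phi [seq eta (x + i%:Z) w | i <- iota 0 n]]).
  by apply: Pr_word => [i t|s]; [exact: m_eta|exact: eta_word_law].
by apply/seteqP; split=> w /=; rewrite env_sites.
Qed.

Lemma excess_word (e : int -> site) x n : word_excess (map e (sites x n)) = excess e x n.
Proof. by rewrite /word_excess big_map. Qed.

Lemma measurable_excess (Q : pred int) x n : measurable [set w | Q (excess (env w) x n)].
Proof.
rewrite (_ : mkset _ = [set w | (Q \o word_excess) (map (env w) (sites x n))]).
  exact: measurable_sites.
by apply/seteqP; split=> w /=; rewrite excess_word.
Qed.

Lemma excess_holes (e : int -> site) x n : (forall z, x <= z < x + n%:Z -> e z = Hole) ->
  excess e x n = n%:Z.
Proof.
move=> H; rewrite /excess (eq_big_seq (fun=> 1 : int)); last first.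
  by move=> z; rewrite mem_sites => /H ->.
by rewrite big_const_seq count_predT size_map size_iota iter_addr_0 -mulr_natr mul1r natz.
Qed.

Lemma size_sites x n : size (sites x n) = n.
Proof. by rewrite size_map size_iota. Qed.

Lemma no_clusterPn (e : int -> site) n M x : ~~ no_cluster n M (map e (sites x (M * n))) ->
  exists2 k, (k < M)%N & forall z, x + (k * n)%N%:Z <= z < x + (k * n)%N%:Z + n%:Z -> e z = Hole.
Proof.
elim: M x => [|M IH] x //=.
rewrite mulSn sites_cat map_cat take_size_cat ?size_map ?size_iota //.
rewrite drop_size_cat ?size_map ?size_iota // => /nandP[/negPn H|/IH[k kM Hk]].
  exists 0%N => // z; rewrite mul0n addr0 => Hz.
  have zs : z \in sites x n by rewrite mem_sites.
  by have /allP/(_ (e z) (map_f e zs)) := H; rewrite /hole_site; case: (e z).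
by exists k.+1 => // z Hz; apply: Hk; move: Hz; rewrite mulSn; lia.
Qed.

Lemma block_center (x : int) n M k r : (r < n)%N -> (k < M)%N ->
  x <= x + (k * n)%N%:Z + r%:Z < x + (M * n)%N%:Z.
Proof.
move=> rn kM; have : (k.+1 * n <= M * n)%N by rewrite leq_mul2r kM orbT.
by rewrite mulSn; move: (k * n)%N (M * n)%N => u v; lia.
Qed.

Section Theta.
Variable theta : R.
Hypotheses (t01 : 0 < theta < 1) (tE : rho_b = rho_h * theta ^+ 2).
Notation lam := (decay rho_h theta).

Lemma small_excess x n (k : int) :
  small P (theta ^ (- k) * lam ^+ n) [set w | excess (env w) x n <= k].
Proof.
exists [set w | excess (env w) x n <= k]; split=> //; first exact: (measurable_excess (fun z => z <= k)).
rewrite (_ : mkset _ = [set w | (fun s => (word_excess s <= k)%R) (map (env w) (sites x n))]).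
  rewrite (@Pr_sites (fun s => (word_excess s <= k)%R)); by apply: (word_excess_chernoff (rho_b := rho_b)).
by apply/seteqP; split=> w /=; rewrite excess_word.
Qed.

(** Some interval around the centre has excess at most 0. The centre counts 1, so one side of the
    interval has excess at most -1. That side leaves the run of holes, and beyond it must also make
    up for [r] holes. *)
Lemma unsafe_cluster (e : int -> site) c r :
  (forall z, c <= z < c + r.*2.+1%:Z -> e z = Hole) -> ~ safe e (c + r%:Z) ->
  (exists i, excess e (c - i%:Z) i <= - r.+1%:Z) \/
  (exists i, excess e (c + r.*2.+1%:Z) i <= - r.+1%:Z).
Proof.
move=> Hc ns; set h := c + r%:Z.
have [j [k ejk]] : exists j k : nat, excess e (h - j%:Z) (j + k + 1) <= 0.
  apply: contrapT => H; apply: ns => j k; rewrite -/h leNgt; apply/negP => le0; apply: H.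
  by exists j, k; rewrite -ltzD1 add0r.
have eh : excess e h 1 = 1.
  by apply: (@excess_holes e h 1) => z Hz; apply: Hc; rewrite /h in Hz; lia.
have : excess e (h - j%:Z) j + 1 + excess e (h + 1) k <= 0.
  move: ejk; rewrite -[X in excess _ _ X](_ : (j + (1 + k))%N = _); last lia.
  by rewrite !excess_cat subrK eh addrA.
have [A|A] := leP (excess e (h - j%:Z) j) (-1).
- move=> _; left; exists (j - r)%N.
  have jr : (r < j)%N.
    rewrite ltnNge; apply/negP => jr.
    suff : excess e (h - j%:Z) j = j%:Z by lia.
    by apply: excess_holes => z Hz; apply: Hc; rewrite /h in Hz; lia.
  have : excess e (h - j%:Z) j = excess e (c - (j - r)%N%:Z) (j - r) + excess e c r.
    rewrite -[X in excess _ _ X = _](_ : (j - r + r)%N = _); last lia.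
    by rewrite excess_cat; congr (excess _ _ _ + excess _ _ _); rewrite /h; lia.
  rewrite (@excess_holes e c r); first lia.
  by move=> z Hz; apply: Hc; lia.
- move=> B; right; exists (k - r)%N.
  have {}B : excess e (h + 1) k <= -1 by lia.
  have kr : (r < k)%N.
    rewrite ltnNge; apply/negP => kr.
    suff : excess e (h + 1) k = k%:Z by lia.
    by apply: excess_holes => z Hz; apply: Hc; rewrite /h in Hz; lia.
  have : excess e (h + 1) k = excess e (h + 1) r + excess e (c + r.*2.+1%:Z) (k - r).
    rewrite -[X in excess _ _ X = _](_ : (r + (k - r))%N = _); last lia.
    by rewrite excess_cat; congr (_ + excess _ _ _); rewrite /h; lia.
  rewrite (@excess_holes e (h + 1) r); first lia.
  by move=> z Hz; apply: Hc; rewrite /h in Hz; lia.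
Qed.

(** The run and the sites beyond it are independent, and the length of the bad stretch is summed
    geometrically. The factor [rho_h ^+ r.*2.+1] is kept to balance the number of runs that will be
    tried. *)
Lemma small_unsafe_cluster c r :
  small P (2 * (rho_h ^+ r.*2.+1 * theta ^+ r.+1 / (1 - lam)))
    [set w | (forall z, c <= z < c + r.*2.+1%:Z -> eta z w = Hole) /\ ~ safe (env w) (c + r%:Z)].
Proof.
have /andP[t0 t1] := t01; have hh : 0 < rho_h := lt_trans hb hbh.
have l01 : 0 <= lam < 1 by exact: (@decay01 _ rho_b rho_h).
set n := r.*2.+1; pose L i := [set w | all hole_site (drop i (map (env w) (sites (c - i%:Z) (i + n)))) &&
  (word_excess (take i (map (env w) (sites (c - i%:Z) (i + n)))) <= - r.+1%:Z)%R].
pose Rt i := [set w | all hole_site (take n (map (env w) (sites c (n + i)))) &&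
  (word_excess (drop n (map (env w) (sites c (n + i)))) <= - r.+1%:Z)%R].
have c0 : 0 <= rho_h ^+ n * theta ^+ r.+1 by rewrite mulr_ge0 // exprn_ge0 // ltW.
have sL : small P (rho_h ^+ n * theta ^+ r.+1 / (1 - lam)) (\bigcup_i L i).
  apply: small_geometric => // i; exists (L i); split=> //.
    exact: (measurable_sites (fun s => all hole_site (drop i s) && (word_excess (take i s) <= - r.+1%:Z)%R)).
  rewrite /L (@Pr_sites (fun s => all hole_site (drop i s) && (word_excess (take i s) <= - r.+1%:Z)%R)).
  apply: le_trans (@iid_cluster_left _ rho_b rho_h theta hb hbh hsum t01 tE n i (- r.+1%:Z)) _.
  by rewrite opprK mulrA.
have sR : small P (rho_h ^+ n * theta ^+ r.+1 / (1 - lam)) (\bigcup_i Rt i).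
  apply: small_geometric => // i; exists (Rt i); split=> //.
    exact: (measurable_sites (fun s => all hole_site (take n s) && (word_excess (drop n s) <= - r.+1%:Z)%R)).
  rewrite /Rt (@Pr_sites (fun s => all hole_site (take n s) && (word_excess (drop n s) <= - r.+1%:Z)%R)).
  apply: le_trans (@iid_cluster_right _ rho_b rho_h theta hb hbh hsum t01 tE n i (- r.+1%:Z)) _.
  by rewrite opprK mulrA.
rewrite mulr_natl mulr2n; apply: small_sub (smallU sL sR) => w [Hc ns].
have allc : all hole_site (map (env w) (sites c n)).
  by apply/allP => s /mapP[z]; rewrite mem_sites => /Hc e ->; rewrite e.
case: (unsafe_cluster Hc ns) => -[i Hi]; [left|right]; exists i => //; rewrite /L /Rt /mkset.
- rewrite sites_cat map_cat drop_size_cat ?take_size_cat ?size_map ?size_iota //.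
  by rewrite subrK allc excess_word.
- rewrite sites_cat map_cat drop_size_cat ?take_size_cat ?size_map ?size_iota //.
  by rewrite allc excess_word.
Qed.

(* About [A / rho_h ^+ (2 r + 1)] blocks are enough to meet a run of [2 r + 1] holes, and still too
   few for any of these runs to have an unsafe centre. *)
Lemma small_no_safe (e : R) : 0 < e -> exists N, forall x,
  small P e [set w | forall h, x <= h < x + N%:Z -> ~ safe (env w) h].
Proof.
move=> e0; have /andP[t0 t1] := t01; have hh : 0 < rho_h := lt_trans hb hbh.
have hh1 : rho_h <= 1 by have := hb; have := hsum; lra.
have /andP[l0 l1] : 0 <= lam < 1 by exact: (@decay01 _ rho_b rho_h).
have l1' : 0 < 1 - lam by rewrite subr_gt0.
(* [M] is chosen with [A <= M * a <= A + 1], where [a] is the probability of a full run. By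
   Bernoulli no run is full with probability at most [1 / A = e / 2]. An unsafe centre has
   probability at most [2 * (A + 1) * del / (1 - lam)], which is again [e / 2]. *)
pose A : R := 2 / e; have A0 : 0 < A by rewrite divr_gt0.
pose del := e * (1 - lam) / (4 * (A + 1)).
have del0 : 0 < del by rewrite divr_gt0 ?mulr_gt0 // addr_gt0.
have [r Hr] : exists r, theta ^+ r < del by apply: geometric_small => //; rewrite (ltW t0).
set n := r.*2.+1; pose a := rho_h ^+ n.
have a0 : 0 < a by rewrite exprn_gt0.
have a1 : a <= 1 by rewrite exprn_ile1 // ltW.
pose M := (Num.trunc (A / a)).+1.
have MA : A <= M%:R * a by rewrite -ler_pdivrMr // ltW // truncnS_gt.
have MA1 : M%:R * a <= A + 1.
  rewrite /M -natr1 mulrDl mul1r; apply: lerD => //.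
  by rewrite -ler_pdivlMr //; rewrite truncn_le divr_ge0 // ltW.
exists (M * n)%N => x.
have s1 : small P (e / 2) [set w | no_cluster n M (map (env w) (sites x (M * n)))].
  exists [set w | no_cluster n M (map (env w) (sites x (M * n)))]; split=> //.
    exact: measurable_sites.
  rewrite Pr_sites (@iid_no_cluster _ rho_b rho_h) -/a.
  have := @expr_onem_le R a M; rewrite a1 ltW // => /(_ isT) H.
  have X0 : 0 <= (1 - a) ^+ M by rewrite exprn_ge0 // subr_ge0.
  have : (1 - a) ^+ M * A <= 1.
    by apply: le_trans H; apply: ler_wpM2l => //; apply: le_trans MA _; rewrite lerDr.
  by rewrite /A mulrA -ler_pdivlMr ?invr_gt0 // invrK mul1r ler_pdivlMr.
have s2 : small P (e / 2) [set w | exists2 k, k \in iota 0 M &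
    (forall z, x + (k * n)%N%:Z <= z < x + (k * n)%N%:Z + n%:Z -> eta z w = Hole) /\
    ~ safe (env w) (x + (k * n)%N%:Z + r%:Z)].
  have := @small_seq _ _ _ P _ (iota 0 M) _ _ (fun k _ => small_unsafe_cluster (x + (k * n)%N%:Z) r).
  apply: small_le; rewrite size_iota -/n -/a -[leLHS]mulr_natl.
  have tr : theta ^+ r.+1 <= del.
    by rewrite exprS; apply: le_trans (ltW Hr); rewrite ler_piMl ?exprn_ge0 // ltW.
  have -> : M%:R * (2 * (a * theta ^+ r.+1 / (1 - lam))) =
     2 * ((M%:R * a) * theta ^+ r.+1) / (1 - lam) by field; rewrite gt_eqF.
  rewrite ler_pdivrMr //; apply: (@le_trans _ _ (2 * ((A + 1) * del))).
    apply: ler_wpM2l => //; apply: ler_pM => //; first by rewrite mulr_ge0 // ltW.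
    by rewrite exprn_ge0 // ltW.
  rewrite /del (_ : 2 * _ = e / 2 * (1 - lam)) //; field.
  by rewrite gt_eqF // addr_gt0.
have -> : e = e / 2 + e / 2 by field.
apply: small_sub (smallU s1 s2) => w /= H.
case: (boolP (no_cluster n M (map (env w) (sites x (M * n))))) => [nc|/no_clusterPn[k kM Hk]]; [by left|right].
have kI : k \in iota 0 M by rewrite mem_iota.
exists k; first exact: kI.
split=> //; apply: H.
by apply: block_center => //; rewrite ltnS -addnn leq_addr.
Qed.

End Theta.

Lemma theta_exists : exists2 theta : R, 0 < theta < 1 & rho_b = rho_h * theta ^+ 2.
Proof.
have hh : 0 < rho_h := lt_trans hb hbh.
have f0 : 0 < rho_b / rho_h by rewrite divr_gt0.
exists (Num.sqrt (rho_b / rho_h)).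
  rewrite sqrtr_gt0 f0 /= -sqrtr1 ltr_sqrt // ltr_pdivrMr // mul1r //.
by rewrite sqr_sqrtr ?ltW // mulrC divfK // gt_eqF.
Qed.

Lemma small_no_safe_block (e : R) : 0 < e -> exists N, forall x,
  small P e [set w | forall h, x <= h < x + N%:Z -> ~ safe (env w) h].
Proof. by have [theta t01 tE] := theta_exists; exact: small_no_safe t01 tE e. Qed.

Lemma negl_exists (I : countType) (S : I -> set Omega) :
  (forall i, P.-negligible (S i)) -> P.-negligible [set w | exists i, S i w].
Proof.
move=> H; apply: (@negligibleS _ _ _ _ (\bigcup_n (if unpickle n is Some i then S i else set0))).
  by move=> w [i Si]; exists (pickle i) => //; rewrite pickleK.
by apply: negligible_bigcup => n; case: (unpickle n) => [i|]; [exact: H|exact: negligible_set0].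
Qed.

Lemma safe_unbounded : P.-negligible [set w |
  ~ ((forall n, exists2 h, h < n & safe (env w) h) /\ (forall n, exists2 h, n < h & safe (env w) h))].
Proof.
apply: (@negligibleS _ _ _ _ ([set w | exists n, forall h, h < n -> ~ safe (env w) h] `|`
   [set w | exists n, forall h, n < h -> ~ safe (env w) h])).
  move=> w /not_andP[/existsNP[n H]|/existsNP[n H]]; [left|right]; exists n => h hn sh; apply: H; by exists h.
apply: negligibleU; apply: negl_exists => n; apply: small_negligible => e e0;
    have [N HN] := small_no_safe_block e0.
- by apply: small_sub (HN (n - N%:Z)) => w /= H h Hh; apply: H; lia.
- by apply: small_sub (HN (n + 1)) => w /= H h Hh; apply: H; lia.
Qed.

End AlmostSure.

(** * Almost sure properties of clocks and walks *)

Section Clocks.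
Context {d : measure_display} {Omega : measurableType d} {R : realType}.
Variable P : probability Omega R.
Variables (eta : int -> Omega -> site) (U : int -> Omega -> R) (xi : int -> nat -> Omega -> bool).
Variables (rho_b rho_h p : R).
Hypotheses (hb : 0 < rho_b) (hbh : rho_b < rho_h) (hsum : rho_b + rho_h <= 1).
Hypotheses (hp0 : 0 <= p) (hp1 : p <= 1).
Hypotheses (hind : golf_indep P eta U xi) (hlaw : golf_laws P eta U xi rho_b rho_h p).
Notation dat := (golf_data eta U xi).
Notation env w := (fun b : int => eta b w).
Notation q := (site_weight rho_b rho_h).


Lemma clock_itv b (A : set R) (l : R) : measurable A -> (@lebesgue_measure R) (A `&` `[0, 1]%classic) = l%:E ->
  Pr P [set w | A (U b w)] = l.
Proof. by move=> mA e; rewrite (Pr_clock hlaw) // e. Qed.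

Lemma lebesgue_sub_itv (i : interval R) (a c : R) : [set` i] `<=` `[0, 1]%classic ->
  (@lebesgue_measure R) [set` i] = (c - a)%:E ->
  (@lebesgue_measure R) ([set` i] `&` `[0, 1]%classic) = (c - a)%:E.
Proof. by move=> s <-; congr (lebesgue_measure _); exact/setIidPl. Qed.

Lemma lebesgue_co (a c : R) : 0 <= a -> a < c -> c <= 1 ->
  (@lebesgue_measure R) (`[a, c[%classic `&` `[0, 1]%classic) = (c - a)%:E.
Proof.
move=> a0 ac c1; apply: lebesgue_sub_itv.
  by move=> z /=; rewrite !in_itv /= => /andP[az zc]; rewrite (le_trans a0 az) ltW // (lt_le_trans zc).
by rewrite lebesgue_measure_itv /= lte_fin ac EFinB.
Qed.

Lemma lebesgue_oo (a c : R) : 0 <= a -> a < c -> c <= 1 ->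
  (@lebesgue_measure R) (`]a, c[%classic `&` `[0, 1]%classic) = (c - a)%:E.
Proof.
move=> a0 ac c1; apply: lebesgue_sub_itv.
  move=> z /=; rewrite !in_itv /= => /andP[az zc].
  by rewrite (le_trans a0 (ltW az)) ltW // (lt_le_trans zc).
by rewrite lebesgue_measure_itv /= lte_fin ac EFinB.
Qed.

Lemma clock01_ae : P.-negligible [set w | ~ forall b, 0 <= U b w < 1].
Proof.
apply: (@negligibleS _ _ _ _ [set w | exists b, ~ (0 <= U b w < 1)]).
  by move=> w /existsNP[b H]; exists b.
apply: (@negl_exists _ _ _ P) => b.
have mA : measurable (~` (`[0, 1[%classic : set R)) by apply: measurableC; exact: measurable_itv.
exists [set w | (~` (`[0, 1[%classic : set R)) (U b w)]; split.
- exact: (m_clock hlaw).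
- rewrite PrE; last exact: (m_clock hlaw).
  rewrite (@clock_itv b _ 0) //; rewrite (_ : _ `&` _ = [set 1]); first exact: lebesgue_measure_set1.
  apply/seteqP; split=> z /=; rewrite !in_itv /=; last first.
    by move=> ->; rewrite ltxx andbF ler01 lexx; split.
  by move=> [nz /andP[z0 z1]]; apply/eqP; rewrite eq_le z1 leNgt; apply/negP => z1'; apply: nz; rewrite z0.
- by move=> w /= H; rewrite in_itv.
Qed.

(** The diagonal is covered by [m] squares of side [1 / m], of total mass [1 / m]. *)
Lemma clock_inj_ae : P.-negligible [set w | ~ injective (fun b => U b w)].
Proof.
have C01 := clock01_ae.
apply: (@negligibleS _ _ _ _ [set w | exists bb : int * int, bb.1 != bb.2 /\ U bb.1 w = U bb.2 w]).
  move=> w /existsNP[b] /existsNP[b'] /not_implyP[e /eqP n]; by exists (b, b').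
apply: (@negl_exists _ _ _ P) => -[b b'] /=.
have [->|bb'] := eqVneq b b'.
  by apply: (@negligibleS _ _ _ _ set0); [move=> w []|exact: negligible_set0].
apply: small_negligible => e e0.
pose m := (Num.trunc e^-1).+1.
have m0 : 0 < m%:R :> R by rewrite ltr0n.
have me : m%:R^-1 < e by rewrite invf_plt ?posrE // truncnS_gt.
pose J k : set R := `[k%:R / m%:R, k.+1%:R / m%:R[%classic.
have mJ k : measurable (J k) by exact: measurable_itv.
have s1 : small P (m%:R^-1) [set w | exists2 k, k \in iota 0 m & J k (U b w) /\ J k (U b' w)].
  have -> : m%:R^-1 = (m%:R^-1 ^+ 2) *+ size (iota 0 m) :> R.
    by rewrite size_iota -[RHS]mulr_natl expr2 mulVKf // gt_eqF.
  apply: small_seq => k; rewrite mem_iota add0n => km.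
  exists [set w | J k (U b w) /\ J k (U b' w)]; split=> //.
    exact: (mS_and (@sigma_algebra_measurable _ Omega) (m_clock hlaw b (mJ k)) (m_clock hlaw b' (mJ k))).
  have := @Pr_box _ _ _ P eta U xi rho_b rho_h p hind hlaw [::] [:: b; b'] [::]
    (fun=> setT) (fun=> J k) (fun=> setT) isT _ isT (fun=> mJ k).
  rewrite /= inE bb' => /(_ isT); rewrite !big_cons !big_nil mul1r !mulr1 lebesgue_co; last first.
  - by rewrite ler_pdivrMr // mul1r ler_nat; lia.
  - by rewrite ltr_pM2r ?invr_gt0 // ltr_nat.
  - by rewrite divr_ge0 // ler0n.
  have -> : k.+1%:R / m%:R - k%:R / m%:R = m%:R^-1 :> R by rewrite -mulrBl -natr1 addrAC subrr add0r mul1r.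
  rewrite /= -expr2 => <-; rewrite le_eqVlt; apply/orP; left; apply/eqP; congr Pr; apply/seteqP; split=> w /=.
  - by move=> [H1 H2]; split=> //; split=> // c; rewrite !inE => /orP[/eqP->|/eqP->].
  - by move=> [_ [H _]]; split; apply: H; rewrite !inE eqxx ?orbT.
apply: small_le (ltW me) _; rewrite -[X in small _ X](addr0).
apply: small_sub (smallU s1 (negligible_small C01)) => w /= [_ e1].
have [H|nH] := pselect (forall b, 0 <= U b w < 1); [left|by right].
have /andP[u0 u1] := H b.
have Um0 : 0 <= U b w * m%:R by rewrite mulr_ge0 // ltW.
have /andP[t1 t2] := truncn_itv Um0.
have tm : Num.trunc (U b w * m%:R) \in iota 0 m.
  rewrite mem_iota add0n -(ltr_nat R); apply: le_lt_trans t1 _.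
  by rewrite -[ltRHS]mul1r ltr_pM2r.
exists (Num.trunc (U b w * m%:R)); first exact: tm.
have HJ : J (Num.trunc (U b w * m%:R)) (U b w).
  by rewrite /J /= in_itv /= ler_pdivrMr // t1 /= ltr_pdivlMr.
by split=> //; rewrite -e1.
Qed.

Lemma xi_word_law b (s : seq bool) :
  Pr P [set w | [seq xi b i w | i <- iota 0 (size s)] = s] = \prod_(t <- s) step_weight p t.
Proof.
have u3 : uniq [seq (b, i) | i <- iota 0 (size s)].
  by rewrite map_inj_uniq ?iota_uniq // => i j [].
have := @Pr_box _ _ _ P eta U xi rho_b rho_h p hind hlaw [::] [::] [seq (b, i) | i <- iota 0 (size s)]
  (fun=> setT) (fun=> setT) (fun bn => [set nth true s bn.2]) isT isT u3 (fun=> measurableT).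
rewrite !big_nil !mul1r big_map => H.
transitivity (\prod_(i <- iota 0 (size s)) step_weight p (nth true s i)).
  rewrite -(eq_bigr _ (fun i _ => sum_pred1 (step_weight p) (erefl [set nth true s i]))) -H.
  congr Pr; apply/seteqP; split=> w /=.
  - move=> e; split=> //; split=> // bn /mapP[i im ->] /=; move: im; rewrite mem_iota add0n => /andP[_ iN].
    by rewrite -e (nth_map 0%N) ?size_iota // nth_iota.
  - move=> [_ [_ H1]]; apply: (@eq_from_nth _ true); rewrite size_map size_iota // => i iN.
    rewrite (nth_map 0%N) ?size_iota // nth_iota // add0n.
    by apply: (H1 (b, i)); apply: map_f; rewrite mem_iota.
by rewrite (big_nth true) /index_iota subn0.
Qed.

Lemma m_xi b i t : measurable [set w | xi b i w = t].
Proof. exact: (m_step hlaw b i [set t]). Qed.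

Lemma Pr_reach b N k : Pr P [set w | reach [seq xi b i w | i <- iota 0 N] k] = reach_prob p N k.
Proof.
by apply: (Pr_word (Y := fun i w => xi b i w) _ _ (fun s => reach s k)); [exact: m_xi|exact: xi_word_law].
Qed.

Lemma measurable_reach b N k : measurable [set w | reach [seq xi b i w | i <- iota 0 N] k].
Proof. exact: (measurable_word (Y := fun i w => xi b i w) (m_xi b) (fun s => reach s k)). Qed.

Lemma reach_dwalk b N k w : reach [seq xi b i w | i <- iota 0 N] k <->
  exists2 m, (m <= N)%N & dwalk (dat w) b m = b + k%:Z.
Proof.
rewrite reachP; split=> -[m mN H]; exists m => //.
  by rewrite /dwalk; congr (_ + _); rewrite -H.
by move: H => /addrI <-.
Qed.

Let p01 : 0 <= p <= 1. Proof. by rewrite hp0. Qed.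

Lemma hit_up_ae : 1 / 2 <= p ->
  P.-negligible [set w | ~ forall b (k : nat), exists n, dwalk (dat w) b n = b + k%:Z].
Proof.
move=> ph; apply: (@negligibleS _ _ _ _
  [set w | exists bk : int * nat, forall n, dwalk (dat w) bk.1 n <> bk.1 + bk.2%:Z]).
  move=> w /existsNP[b /existsNP[k H]]; exists (b, k) => n e; apply: H; by exists n.
apply: (@negl_exists _ _ _ P) => -[b k] /=; apply: small_negligible => e e0.
have [N HN] := reach_prob_recurrent p01 k ph e0.
exists (~` [set w | reach [seq xi b i w | i <- iota 0 N] k]); split.
- by apply: measurableC; exact: measurable_reach.
- by move=> w /= H /reach_dwalk[m _ /H].
- by rewrite PrC; [rewrite Pr_reach; lra|exact: measurable_reach].
Qed.

(** The bound of [reach_prob_drift] is uniform in the number of steps, so it survives the increasing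
    union. *)
Lemma small_hit b k : p < 1 / 2 ->
  small P ((p / (1 - p)) ^+ k) [set w | exists n, dwalk (dat w) b n = b + k%:Z].
Proof.
move=> ph; pose A N := [set w | reach [seq xi b i w | i <- iota 0 N] k].
have mA N : measurable (A N) by exact: measurable_reach.
have mU : measurable (\bigcup_N A N) by exact: bigcup_measurable.
exists (\bigcup_N A N); split=> //.
  by move=> w [n Hn]; exists n => //; apply/reach_dwalk; exists n.
have ndA : nondecreasing_seq A.
  move=> m n mn; apply/subsetPset => w /reach_dwalk[i im Hi]; apply/reach_dwalk; exists i => //.
  exact: leq_trans im mn.
have cv := @nondecreasing_cvg_mu _ _ _ P A mA mU ndA.
rewrite -lee_fin -PrE //.
rewrite -(cvg_lim _ cv) //; apply: lime_le; first by apply/cvg_ex; exists (P (\bigcup_N A N)).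
apply: nearW => N /=; rewrite (PrE P (mA N)) lee_fin Pr_reach.
exact: reach_prob_drift.
Qed.

Lemma ball_clock_prob b (q1 q2 : R) : 0 <= q1 -> q1 < q2 -> q2 <= 1 ->
  Pr P [set w | eta b w = Ball /\ q1 < U b w < q2] = rho_b * (q2 - q1).
Proof.
move=> q10 q12 q21; have mI : measurable (`]q1, q2[%classic : set R) by exact: measurable_itv.
have := @Pr_box _ _ _ P eta U xi rho_b rho_h p hind hlaw [:: b] [:: b] [::]
    (fun=> [set Ball]) (fun=> `]q1, q2[%classic) (fun=> setT) isT isT isT (fun=> mI).
rewrite !big_cons !big_nil !mulr1 lebesgue_oo // (sum_pred1 q erefl) /= => <-.
congr Pr; apply/seteqP; split=> w /=.
- move=> [e H]; split; first by move=> c; rewrite inE => /eqP->.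
  by split=> // c; rewrite inE => /eqP->; rewrite in_itv.
- by move=> [H1 [H2 _]]; have := H2 b (mem_head _ _); rewrite in_itv; have := H1 b (mem_head _ _).
Qed.

Lemma no_ball_clock_prob n m (q1 q2 : R) : 0 <= q1 -> q1 < q2 -> q2 <= 1 ->
  Pr P (dat @^-1` [set y | forall b, n - m%:Z <= b < n -> ~ (dsite y b = Ball /\ q1 < dclock y b < q2)]) =
  (1 - rho_b * (q2 - q1)) ^+ m /\
  data_sigma (fun b => n - m%:Z <= b < n)
    [set y : data R | forall b, n - m%:Z <= b < n -> ~ (dsite y b = Ball /\ q1 < dclock y b < q2)].
Proof.
move=> q10 q12 q21.
pose A b : set (data R) := [set y | dsite y b = Ball /\ q1 < dclock y b < q2].
have sA (J : int -> Prop) b : J b -> data_sigma J (A b).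
  move=> Jb; apply: (mS_and (@data_sigma_algebra _ J)); first exact: data_site.
  apply: (mS_ext (M := data_sigma J)) (@data_clock _ J b (`]q1, q2[%classic) Jb (measurable_itv _)) => y.
  by rewrite /= in_itv.
have sE : data_sigma (fun b => n - m%:Z <= b < n) [set y : data R | forall b, n - m%:Z <= b < n -> ~ A b y].
  have hM := @data_sigma_algebra R (fun b => n - m%:Z <= b < n).
  apply: (mS_forall hM) => b; have [Hb|nb] := boolP (n - m%:Z <= b < n).
    by apply: (mS_imp hM); [exact: (mS_const hM)|apply: (mS_not hM); exact: sA].
  by apply: (mS_ext (M := data_sigma _)) (mS_const hM True) => y; split.
split=> //; elim: m sE => [|m IH] sE.
  rewrite expr0 (_ : _ @^-1` _ = setT) ?PrT //; apply/seteqP; split=> w // _ b; lia.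
set J0 := (fun b => n - m%:Z <= b < n).
have sE0 : data_sigma J0 [set y : data R | forall b, n - m%:Z <= b < n -> ~ A b y].
  have hM := @data_sigma_algebra R J0.
  apply: (mS_forall hM) => b; have [Hb|nb] := boolP (n - m%:Z <= b < n).
    by apply: (mS_imp hM); [exact: (mS_const hM)|apply: (mS_not hM); exact: sA].
  by apply: (mS_ext (M := data_sigma _)) (mS_const hM True) => y; split.
have sN : data_sigma (fun b => b = n - m.+1%:Z) [set y : data R | ~ A (n - m.+1%:Z) y].
  by apply: (mS_not (@data_sigma_algebra _ _)); exact: sA.
have mAn : measurable [set w | A (n - m.+1%:Z) (dat w)] by exact: (m_data hlaw (sA (fun=> True) _ I)).
rewrite exprSr -(IH sE0) -(@ball_clock_prob (n - m.+1%:Z) q1 q2) // -PrC //.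
have dis b : J0 b -> b = n - m.+1%:Z -> False by rewrite /J0; lia.
rewrite -(data_indep hind hlaw dis sE0 sN); congr Pr; apply/seteqP; split=> w /=.
- by move=> H; split=> [b Hb|]; apply: H; lia.
- move=> [H1 H2] b Hb; have [->//|ne] := eqVneq b (n - m.+1%:Z).
  by apply: H1; lia.
Qed.

(** Rational time intervals keep the union countable; any real interval contains one of them. *)
Lemma ball_clock_ae : P.-negligible [set w | ~ forall n (q1 q2 : rat),
  0 <= ratr q1 :> R -> q1 < q2 -> ratr q2 <= 1 :> R ->
  exists b, [/\ b < n, eta b w = Ball & ratr q1 < U b w < ratr q2]].
Proof.
apply: (@negligibleS _ _ _ _ [set w | exists t : int * (rat * rat),
  [/\ 0 <= ratr t.2.1 :> R, t.2.1 < t.2.2, ratr t.2.2 <= 1 :> R &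
  forall b, b < t.1 -> ~ (eta b w = Ball /\ ratr t.2.1 < U b w < ratr t.2.2)]]).
  move=> w /existsNP[n /existsNP[q1 /existsNP[q2]]] /not_implyP[h1 /not_implyP[h2 /not_implyP[h3 H]]].
  by exists (n, (q1, q2)); split=> // b bn [bb bu]; apply: H; exists b.
apply: (@negl_exists _ _ _ P) => -[n [q1 q2]] /=; apply: small_negligible => e e0.
have [[q10 q12 q21]|nq] := pselect [/\ 0 <= ratr q1 :> R, q1 < q2 & ratr q2 <= 1 :> R]; last first.
  apply: small_le (ltW e0) _; apply: negligible_small.
  by apply: (@negligibleS _ _ _ _ set0); [move=> w [h1 h2 h3 _]; apply: nq|exact: negligible_set0].
have q12' : ratr q1 < ratr q2 :> R by rewrite ltr_rat.
have a0 : 0 < rho_b * (ratr q2 - ratr q1) by rewrite mulr_gt0 // subr_gt0.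
have a1 : rho_b * (ratr q2 - ratr q1) <= 1.
  apply: mulr_ile1; [exact: ltW|by rewrite subr_ge0 ltW| |].
    by have := hsum; have := hbh; have := hb; lra.
  by rewrite lerBlDr (le_trans q21) // lerDl.
have [m Hm] := @geometric_small R (1 - rho_b * (ratr q2 - ratr q1)) e ltac:(by rewrite subr_ge0 a1 /= ltrBlDr ltrDl) e0.
have [HP sE] := no_ball_clock_prob n m q10 q12' q21.
exists (dat @^-1` [set y | forall b, n - m%:Z <= b < n -> ~ (dsite y b = Ball /\ ratr q1 < dclock y b < ratr q2)]).
split; [exact: (m_data hlaw sE)| |by rewrite HP ltW].
by move=> w [_ _ _ H] b /andP[_ Hb]; exact: H.
Qed.

End Clocks.

(** * Exhaustion of a half-line is impossible *)

Section RogueDet.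
Context {R : realType} (y : data R) (G : int -> option int).
Notation S := (int_sys y (fun=> True)).
Notation av := (avail S G).
Hypothesis cG : consistent S G.

(** Infinitely many balls left of [x] have clocks between [u] and [u']. Each would reach the free
    hole [g], so it lands at or before [g], and beyond [x] since nothing up to [x] is available any
    more. But only [g - x] places remain, each for one ball. *)
Lemma rogue_left_recurrent : injective (dclock y) ->
  (forall b (k : nat), exists n, dwalk y b n = b + k%:Z) ->
  (forall n (q1 q2 : rat), 0 <= ratr q1 :> R -> q1 < q2 -> ratr q2 <= 1 :> R ->
     exists b, [/\ b < n, dsite y b = Ball & ratr q1 < dclock y b < ratr q2]) ->
  ~ rogue_left y G.
Proof.
move=> ci hit balls [u [u' [x [g [[u0 uu u1] [xg fg nf]]]]]].
(* The midpoint separates the two rationals, which makes [q1 < q2]. *)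
have mid : u < (u + u') / 2 /\ (u + u') / 2 < u' by split; lra.
have [q1 ] := rat_in_itvoo mid.1; rewrite in_itv /= => /andP[uq1 q1m].
have [q2 ] := rat_in_itvoo mid.2; rewrite in_itv /= => /andP[mq2 q2u].
have q12 : q1 < q2 by rewrite -(ltr_rat R) (lt_trans q1m).
have q10 : 0 <= ratr q1 :> R by exact: ltW (le_lt_trans u0 uq1).
have q21 : ratr q2 <= 1 :> R by exact: ltW (lt_le_trans q2u u1).
have many K : exists s : seq int, [/\ uniq s, size s = K &
    forall b, b \in s -> [/\ b <= x, dsite y b = Ball & ratr q1 < dclock y b < ratr q2]].
  suff H : exists (s : seq int) (n : int), [/\ uniq s, size s = K, n <= x &
      forall b, b \in s -> [/\ n <= b, b <= x, dsite y b = Ball & ratr q1 < dclock y b < ratr q2]].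
    by have [s [n [us ss _ Hs]]] := H; exists s; split=> // b /Hs[].
  elim: K => [|K [s [n [us ss nx Hs]]]]; first by exists [::], x; split.
  have [b [bn bb bu]] := balls n q1 q2 q10 q12 q21.
  exists (b :: s), b; split=> //=; first 1 last.
  - by rewrite ss.
  - exact: ltW (lt_le_trans bn nx).
  - move=> c; rewrite inE => /orP[/eqP->|/Hs[nc cx cb cu]]; split=> //.
    + exact: ltW (lt_le_trans bn nx).
    + exact: ltW (lt_le_trans bn nc).
  - by rewrite us andbT; apply/negP => /Hs[nb _ _ _]; move: (lt_le_trans bn nb); rewrite ltxx.
have [s [us ss Hs]] := many (absz (g - x)%R).+1.
have land b : b \in s -> exists2 h, G b = Some h & h \in sites (x + 1) (absz (g - x)%R).
  move=> /Hs[bx bb /andP[b1 b2]].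
  have bu : u < dclock y b := lt_trans uq1 b1.
  have bu' : dclock y b <= u' := ltW (lt_trans b2 q2u).
  have fgb : av (dclock y b) g := avail_le bu' fg.
  have [n Hn] := hit b (absz (g - b)%R).
  have ng : dwalk y b n = g by rewrite Hn gez0_abs; [rewrite addrC subrK|rewrite subr_ge0 (le_trans bx) // ltW].
  have [|h [m [_ Gb st]]] := @cons_some _ _ S G b n cG (conj Logic.I bb).
    by rewrite /= ng.
  exists h => //; rewrite mem_sites.
  have hg := no_cross_right cG Gb fgb (le_trans bx (ltW xg)).
  have hx : x < h.
    rewrite ltNge; apply/negP => /nf; apply.
    have [_ [fh _]] := st; exact: avail_le (ltW bu) fh.
  by clear -hg hx xg; lia.
pose f b := odflt 0 (G b).
have uf : uniq (map f s).
  rewrite map_inj_in_uniq // => b b' bs bs'.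
  have [h Gh _] := land b bs; have [h' Gh' _] := land b' bs'.
  rewrite /f Gh Gh' /= => e; subst h'.
  have nT x' : ~ issink S x' by move=> nT; exact: nT.
  apply: ci; case: (ltgtP (dclock y b) (dclock y b')) => // lt.
  - by case: (cons_inj cG (@nT _) Gh Gh' lt).
  - by case: (cons_inj cG (@nT _) Gh' Gh lt).
have sub : {subset map f s <= sites (x + 1) (absz (g - x)%R)}.
  by move=> _ /mapP[b /land[h Gh hs] ->]; rewrite /f Gh.
by have := uniq_leq_size uf sub; rewrite size_map ss size_sites ltnn.
Qed.

(* The holes of [y0 .. x] are filled from inside [y0 .. g], up to balls that cross [y0]; more than
   [k] such balls include one that started at least [k + 1] sites left of [y0]. *)
Lemma rogue_left_count u u' x g (n k : nat) : u < u' -> x < g -> av u' g ->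
  (forall z, z <= x -> ~ av u z) ->
  excess (dsite y) (x + 1 - n%:Z) n <= k%:Z + (g - x) \/
  exists j m, dwalk y (x + 1 - n%:Z - (k + j).+1%:Z) m = x + 1 - n%:Z.
Proof.
move=> uu xg fg nf; set y0 := x + 1 - n%:Z.
have [[j [m jm]]|nc] := pselect (exists j m, dwalk y (y0 - (k + j).+1%:Z) m = y0); [by right; exists j, m|left].
rewrite excess_count -!size_filter.
set holes := [seq z <- _ | _]; set balls := [seq z <- _ | _].
have ex z : z \in holes -> exists b, [/\ dsite y b = Ball, dclock y b < u & G b = Some z].
  rewrite mem_filter mem_sites => /andP[hz zy].
  have hz' : dsite y z = Hole by move: hz; case: (dsite y z).
  have zx : z <= x by clear -zy; rewrite /y0 in zy; lia.
  by have [b [_ bb bu Gb]] := @filledP _ y (fun=> True) G u z Logic.I hz' (nf z zx); exists b.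
pose beta z := if pselect (z \in holes) is left h then projT1 (cid (ex z h)) else 0.
have bP z : z \in holes -> [/\ dsite y (beta z) = Ball, dclock y (beta z) < u & G (beta z) = Some z].
  by move=> zh; rewrite /beta; case: pselect => // h; exact: projT2 (cid (ex z h)).
have ub : uniq (map beta holes).
  rewrite map_inj_in_uniq ?filter_uniq ?uniq_sites // => z z' /bP[_ _ e1] /bP[_ _ e2] e.
  by move: e1; rewrite e e2 => -[].
have sub : {subset map beta holes <= balls ++ sites (x + 1) (absz (g - x)%R) ++ sites (y0 - k%:Z) k}.
  move=> _ /mapP[z zh ->]; have [bb bu Gb] := bP z zh.
  have zy : z <= x /\ y0 <= z.
    by move: zh; rewrite mem_filter mem_sites => /andP[_]; clear; rewrite /y0; lia.
  have bg : beta z < g.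
    rewrite ltNge; apply/negP => gb.
    have := no_cross_left cG Gb (avail_le (ltW (lt_trans bu uu)) fg) gb.
    by clear -zy xg; lia.
  rewrite !mem_cat !mem_sites mem_filter mem_sites bb /=.
  have [by0|by0] := leP y0 (beta z).
    by clear -by0 bg; rewrite /y0 in by0 *; lia.
  have [m [pm _]] := cons_stops cG Gb.
  have [m' _ Hm'] : exists2 m', (m' <= m)%N & dwalk y (beta z) m' = y0.
    by apply: dwalk_up; [exact: ltW|move: pm => /= ->; case: zy].
  have bk : y0 - k%:Z <= beta z.
    rewrite leNgt; apply/negP => lt; apply: nc.
    exists (absz (y0 - k%:Z - 1 - beta z)%R), m'.
    rewrite (_ : y0 - _ = beta z) //; clear -lt; lia.
  by clear -bk by0; lia.
have := uniq_leq_size ub sub; rewrite size_map !size_cat !size_sites.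
by move: (size holes) (size balls) => p1 p2; clear -xg; lia.
Qed.

End RogueDet.

Section Rogue.
Context {d : measure_display} {Omega : measurableType d} {R : realType}.
Variable P : probability Omega R.
Variables (eta : int -> Omega -> site) (U : int -> Omega -> R) (xi : int -> nat -> Omega -> bool).
Variables (rho_b rho_h p : R).
Hypotheses (hb : 0 < rho_b) (hbh : rho_b < rho_h) (hsum : rho_b + rho_h <= 1).
Hypotheses (hp0 : 0 <= p) (hp1 : p <= 1).
Hypotheses (hind : golf_indep P eta U xi) (hlaw : golf_laws P eta U xi rho_b rho_h p).
Notation dat := (golf_data eta U xi).
Notation env w := (fun b : int => eta b w).
Notation q := (site_weight rho_b rho_h).



Variable F : Omega -> int -> option int.


(** Walks that reach every site on their right are covered by [rogue_left_recurrent]. For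
    [p < 1 / 2], [k] is taken first, so that walks from more than [k] sites away rarely cross a
    given site; then [n], so that the excess of [n] sites exceeds [k + (g - x)] with high
    probability. *)
Lemma rogue_left_ae : P.-negligible [set w |
  consistent (int_sys (dat w) (fun=> True)) (F w) /\ rogue_left (dat w) (F w)].
Proof.
have [ph|ph] := leP (1 / 2) p.
  apply: (@negligibleS _ _ _ _ ([set w | ~ injective (fun b => U b w)] `|`
    ([set w | ~ forall b (k : nat), exists n, dwalk (dat w) b n = b + k%:Z] `|`
    [set w | ~ forall n (q1 q2 : rat),
      0 <= ratr q1 :> R -> q1 < q2 -> ratr q2 <= 1 :> R ->
      exists b, [/\ b < n, eta b w = Ball & ratr q1 < U b w < ratr q2]]))).
    move=> w [cF rw]; apply: contrapT => /not_orP[/contrapT c1 /not_orP[/contrapT c2 /contrapT c3]].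
    exact: rogue_left_recurrent cF c1 c2 c3 rw.
  apply: negligibleU; first by apply: (@clock_inj_ae _ _ _ P eta U xi rho_b rho_h p).
  apply: negligibleU; first by apply: (@hit_up_ae _ _ _ P eta U xi rho_b rho_h p).
  by apply: (@ball_clock_ae _ _ _ P eta U xi rho_b rho_h p).
(* The real times [u] and [u'] and the map [F] are eliminated here; what is left is a countable
   union over [(x, g)] of conditions on the environment. *)
apply: (@negligibleS _ _ _ _ [set w | exists xg : int * int, xg.1 < xg.2 /\
   forall k n : nat, excess (env w) (xg.1 + 1 - n%:Z) n <= k%:Z + (xg.2 - xg.1) \/
     exists j m, dwalk (dat w) (xg.1 + 1 - n%:Z - (k + j).+1%:Z) m = xg.1 + 1 - n%:Z]).
  move=> w [cF [u [u' [x [g [[u0 uu u1] [xg fg nf]]]]]]].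
  by exists (x, g); split=> //= k n; exact: (rogue_left_count cF n k uu xg fg nf).
apply: (@negl_exists _ _ _ P) => -[x g] /=; apply: small_negligible => e e0.
have q0 : 0 < 1 - p by lra.
set r := p / (1 - p).
have r0 : 0 <= r by rewrite divr_ge0 // ltW.
have r1 : r < 1 by rewrite ltr_pdivrMr // mul1r; lra.
have r1' : 0 < 1 - r by rewrite subr_gt0.
have e2 : 0 < e / 2 by rewrite divr_gt0.
have [k Hk] : exists k, r ^+ k < e / 2 * (1 - r).
  by apply: geometric_small; rewrite ?r0 ?mulr_gt0.
have [theta t01 tE] := theta_exists hb hbh.
have /andP[t0 t1] := t01.
have l01 : 0 <= decay rho_h theta < 1 by exact: (@decay01 _ rho_b rho_h).
have tz0 : 0 < theta ^ (- (k%:Z + (g - x))) by exact: exprz_gt0.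
have [n Hn] : exists n, decay rho_h theta ^+ n < e / 2 / theta ^ (- (k%:Z + (g - x))).
  by apply: geometric_small; rewrite ?divr_gt0.
have s1 : small P (e / 2) [set w | excess (env w) (x + 1 - n%:Z) n <= k%:Z + (g - x)].
  have := @small_excess _ _ _ P eta U xi rho_b rho_h p hb hbh hsum hp0 hp1 hind hlaw theta t01 tE (x + 1 - n%:Z) n (k%:Z + (g - x)).
  apply: small_le.
  by rewrite mulrC -ler_pdivlMr // ltW.
have s2 : small P (e / 2) (\bigcup_j [set w | exists m,
    dwalk (dat w) (x + 1 - n%:Z - (k + j).+1%:Z) m = x + 1 - n%:Z]).
  apply: (@small_le _ _ _ _ (r ^+ k.+1 / (1 - r))).
    rewrite ler_pdivrMr //; apply: le_trans (ltW Hk).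
    by apply: geometric_le; rewrite ?r0.
  apply: small_geometric; rewrite ?exprn_ge0 ?r0 // => j.
  rewrite -exprD -addSn [X in [set w | exists m, _ = X]](_ : _ = x + 1 - n%:Z - (k + j).+1%:Z + (k + j).+1%:Z); last by rewrite subrK.
  by apply: (@small_hit _ _ _ P eta U xi rho_b rho_h p).
rewrite (_ : e = e / 2 + e / 2); last by field.
apply: small_sub (smallU s1 s2) => w /= [_ /(_ k n)[H|[j [m H]]]]; [by left|right].
by exists j => //; exists m.
Qed.

End Rogue.

(** * Mirror symmetry *)

Section Reflection.
Context {R : realType}.

(** Steps are negated along with positions, so the mirrored walks go up with probability [1 - p],
    and results about the left half-line for all [p] yield those about the right one. *)
Definition reflect_data (y : data R) : data R :=
  Data (fun k => dsite y (- k)) (fun k => dclock y (- k)) (fun b n => ~~ dstep y (- b) n).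

Definition reflect_map (G : int -> option int) (b : int) := omap -%R (G (- b)).

Lemma dwalk_reflect y b n : dwalk (reflect_data y) b n = - dwalk y (- b) n.
Proof.
rewrite /dwalk opprD opprK; congr (_ + _); rewrite -sumrN; apply: eq_bigr => i _ /=.
by case: (dstep y (- b) i) => /=; rewrite ?opprK.
Qed.

Notation sysT y := (int_sys y (fun=> True)).

Lemma reflect_mapE G b h : reflect_map G b = Some h <-> G (- b) = Some (- h).
Proof.
rewrite /reflect_map; case: (G (- b)) => [x|] /=; split=> // -[e]; congr Some; lia.
Qed.

Lemma avail_reflect y G t h :
  avail (sysT (reflect_data y)) (reflect_map G) t h <-> avail (sysT y) G t (- h).
Proof.
split=> -[nT|[hh hn]]; [by case: nT| |by case: nT|]; right; split=> // -[b [bb [bt Gb]]].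
- apply: hn; exists (- b); rewrite /= opprK; split=> //; split=> //.
  by apply/reflect_mapE; rewrite opprK.
- by apply: hn; exists (- b); split=> //; split=> //; exact/reflect_mapE.
Qed.

Lemma consistent_reflect y G : consistent (sysT y) G ->
  consistent (sysT (reflect_data y)) (reflect_map G).
Proof.
move=> cG b; split=> [nb|bb h]; first by rewrite /reflect_map (cG (- b)).1.
rewrite reflect_mapE ((cG (- b)).2 bb (- h)); split=> -[n [pn [fn mn]]]; exists n.
- split; first by rewrite /= dwalk_reflect; move: pn => /= ->; rewrite opprK.
  split; first exact/avail_reflect.
  by move=> m /mn; apply: contra_not => /avail_reflect; rewrite /= dwalk_reflect opprK.
- split; first by move: pn => /=; rewrite dwalk_reflect => <-; rewrite opprK.
  split; first exact/avail_reflect.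
  by move=> m /mn; apply: contra_not => H; apply/avail_reflect; rewrite /= dwalk_reflect opprK.
Qed.

Lemma rogue_reflect y G : rogue_right y G -> rogue_left (reflect_data y) (reflect_map G).
Proof.
move=> [u [u' [x [g [hu [gx fg nf]]]]]]; exists u, u', (- x), (- g); split=> //; split.
- by rewrite ltrN2.
- by apply/avail_reflect; rewrite opprK.
- by move=> z zx /avail_reflect; apply: nf; rewrite lerNr.
Qed.

End Reflection.

Section ReflectModel.
Context {d : measure_display} {Omega : measurableType d} {R : realType}.
Variable P : probability Omega R.
Variables (eta : int -> Omega -> site) (U : int -> Omega -> R) (xi : int -> nat -> Omega -> bool).
Variables (rho_b rho_h p : R).
Hypotheses (hind : golf_indep P eta U xi) (hlaw : golf_laws P eta U xi rho_b rho_h p).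

Definition reta b := eta (- b).
Definition rU b := U (- b).
Definition rxi b n w := ~~ xi (- b) n w.

Lemma reflect_indep : golf_indep P reta rU rxi.
Proof.
have H := @relabel_indep _ _ _ P eta U xi -%R -%R opprK opprK hind.
move=> J1 J2 J3 A1 A2 A3 u1 u2 u3 mA.
have := H J1 J2 J3 A1 A2 (fun bn => [set v | A3 bn (~~ v)]) u1 u2 u3 mA.
by move=> ->.
Qed.

Lemma reflect_laws : golf_laws P reta rU rxi rho_b rho_h (1 - p).
Proof.
have [h1 [h2 [h3 [h4 [h5 [h6 [h7 h8]]]]]]] := relabel_laws -%R hlaw.
split; first exact: h1.
split; first exact: h2.
have E b n : [set w | rxi b n w = true] = ~` [set w | xi (- b) n w = true].
  by apply/seteqP; split=> w /=; rewrite /rxi; case: (xi _ _ _).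
split; first by move=> b n; rewrite E; apply: measurableC; exact: h3.
split; first exact: h4.
split; first exact: h5.
split; first exact: h6.
split; first exact: h7.
by move=> b n; rewrite E probability_setC; [rewrite h8 EFinB|exact: h3].
Qed.

Lemma reflect_golf_data w : golf_data reta rU rxi w = reflect_data (golf_data eta U xi w).
Proof. by []. Qed.

End ReflectModel.

(** * Gap probabilities *)

Section WindowMeasurable.
Context {R : realType} (n : nat).
Notation M := (data_sigma (window n) : set_system (data R)).
Let hM : sigma_algebra setT M. Proof. exact: data_sigma_algebra. Qed.

(* A window contains finitely many balls, so consistent maps can be enumerated by finite sequences. *)
Definition decode (c : seq (option int)) (b : int) : option int :=
  if b is Posz k then nth None c k else None.

Lemma decode_window (y : data R) G : consistent (int_sys y (window n)) G -> exists c, decode c = G.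
Proof.
move=> cG; exists (mkseq (fun k => G k%:Z) n.+1); apply: funext => -[k|k] /=; last first.
  by rewrite (cG _).1 // => -[]; rewrite /window; lia.
have [kn|nk] := ltnP k n.+1; first by rewrite nth_mkseq.
by rewrite nth_default ?size_mkseq // (cG _).1 // => -[]; rewrite /window; lia.
Qed.

(** Balls and holes of a window carry the guard that their site lies in it; the data of a site are
    events of the window only under that guard. *)
Lemma mS_guard (W : Prop) (Q : data R -> Prop) : (W -> M [set y | Q y]) -> M [set y | W /\ Q y].
Proof.
move=> H; have [w|nw] := pselect W; first by apply: (mS_and hM) (mS_const hM _) (H w).
by apply: (mS_ext (M := M)) (mS_const hM False) => y; split=> // -[].
Qed.

Lemma mS_clock_lt b b' : window n b -> window n b' -> M [set y | dclock y b' < dclock y b].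
Proof.
move=> wb wb'; have : M [set y | exists q : rat, dclock y b' < ratr q /\ ratr q < dclock y b].
  apply: (mS_exists hM) => q; apply: (mS_and hM).
  - apply: (mS_ext (M := M)) (@data_clock _ (window n) b' (`]-oo, ratr q[%classic) wb' (measurable_itv _)) => y.
    by rewrite /= in_itv.
  - apply: (mS_ext (M := M)) (@data_clock _ (window n) b (`]ratr q, +oo[%classic) wb (measurable_itv _)) => y.
    by rewrite /= in_itv /= andbT.
apply: (mS_ext (M := M)) => y; split=> [[q [q1 q2]]|lt]; first exact: lt_trans q1 q2.
by have [q] := rat_in_itvoo lt; rewrite in_itv /= => /andP[q1 q2]; exists q.
Qed.

Lemma mS_dwalk b k (h : int) : window n b -> M [set y | dwalk y b k = h].
Proof.
move=> wb; elim: k h => [|k IH] h.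
  by apply: (mS_ext (M := M)) (mS_const hM (b = h)) => y; rewrite dwalk0.
apply: (mS_ext (M := M) (f := fun y => (dstep y b k = true /\ dwalk y b k = h - 1) \/
   (dstep y b k = false /\ dwalk y b k = h + 1))).
  move=> y; rewrite {3}/dwalk big_ord_recr /= addrA -/(dwalk y b k).
  by case: (dstep y b k); split=> [[[]|[]]|] //; try (by move=> _ ->; rewrite ?subrK ?addrK);
    move=> e; [left|right]; split=> //; rewrite -e ?addrK ?subrK.
by apply: (mS_or hM); apply: (mS_and hM); [exact: data_step|exact: IH|exact: data_step|exact: IH].
Qed.

Variable c : seq (option int).
Notation S y := (int_sys y (window n)).

Lemma mS_avail b h : window n b -> M [set y | avail (S y) (decode c) (dclock y b) h].
Proof.
move=> wb; apply: (mS_or hM) (mS_const hM _) _; apply: (mS_and hM).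
  by apply: mS_guard => wh; exact: data_site.
apply: (mS_not hM); apply: (mS_exists hM) => b'.
apply: (mS_ext (M := M) (f := fun y => window n b' /\ (dsite y b' = Ball /\ dclock y b' < dclock y b /\ decode c b' = Some h))).
  by move=> y; split=> [[w [s r]]|[[w s] r]].
apply: mS_guard => wb'; apply: (mS_and hM); first exact: data_site.
by apply: (mS_and hM); [exact: mS_clock_lt|exact: (mS_const hM)].
Qed.

Lemma mS_stops b h k : window n b -> M [set y | stops (S y) (decode c) b h k].
Proof.
move=> wb; apply: (mS_and hM); first exact: mS_dwalk.
apply: (mS_and hM); first exact: mS_avail.
apply: (mS_forall hM) => m; apply: (mS_imp hM); first exact: (mS_const hM).
apply: (mS_ext (M := M) (f := fun y => forall x, dwalk y b m = x -> ~ avail (S y) (decode c) (dclock y b) x)).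
  by move=> y; split=> [H|H x <-] //; exact: H.
apply: (mS_forall hM) => x; apply: (mS_imp hM); first exact: mS_dwalk.
by apply: (mS_not hM); exact: mS_avail.
Qed.

Lemma mS_consistent : M [set y | consistent (S y) (decode c)].
Proof.
apply: (mS_forall hM) => b.
have ballE : M [set y | isball (S y) b] by apply: mS_guard => wb; exact: data_site.
apply: (mS_and hM).
  by apply: (mS_imp hM); [exact: (mS_not hM)|exact: (mS_const hM)].
have [wb|nwb] := pselect (window n b); last first.
  by apply: (mS_ext (M := M)) (mS_const hM True) => y; split=> // _ [].
apply: (mS_imp hM) => //; apply: (mS_forall hM) => h; apply: (mS_iff hM); first exact: (mS_const hM).
by apply: (mS_exists hM) => k; exact: mS_stops.
Qed.

End WindowMeasurable.

Section WindowEvents.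
Context {R : realType} (n : nat).
Notation M := (data_sigma (window n) : set_system (data R)).
Let hM : sigma_algebra setT M. Proof. exact: data_sigma_algebra. Qed.

Lemma mS_window_event (Q : (int -> option int) -> data R -> Prop) :
  (forall c, M [set y | Q (decode c) y]) ->
  M [set y | exists G, consistent (int_sys y (window n)) G /\ Q G y].
Proof.
move=> mQ.
apply: (mS_ext (M := M) (f := fun y => exists c, consistent (int_sys y (window n)) (decode c) /\ Q (decode c) y)).
  move=> y; split=> [[c H]|[G [cG QG]]]; first by exists (decode c).
  by have [c e] := decode_window cG; exists c; rewrite e.
by apply: (mS_exists hM) => c; apply: (mS_and hM) => //; exact: mS_consistent.
Qed.

Lemma mS_no_exit_right : M [set y | no_exit_right n y].
Proof. by apply: (@mS_window_event (fun G y => forall b, G b <> Some (n%:Z + 1))) => c; exact: (mS_const hM). Qed.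

Lemma mS_no_exit_left : M [set y | no_exit_left n y].
Proof. by apply: (@mS_window_event (fun G y => forall b, G b <> Some 0)) => c; exact: (mS_const hM). Qed.

Lemma mS_closed_block : M [set y | closed_block n y].
Proof.
apply: (@mS_window_event (fun G y => (forall b, G b <> Some 0 /\ G b <> Some (n%:Z + 1)) /\
  (forall h, window n h -> dsite y h = Hole -> exists b, G b = Some h))) => c.
apply: (mS_and hM); first exact: (mS_const hM).
apply: (mS_forall hM) => h; have [wh|nwh] := pselect (window n h); last first.
  by apply: (mS_ext (M := M)) (mS_const hM True) => y; split.
apply: (mS_imp hM); first exact: (mS_const hM).
by apply: (mS_imp hM); [exact: data_site|exact: (mS_const hM)].
Qed.

End WindowEvents.

Lemma data_sigma_relabel (R : realType) (J K : int -> Prop) (f : int -> int) (E : set (data R)) :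
  (forall b, J b -> K (f b)) -> data_sigma J E -> data_sigma K (relabel f @^-1` E).
Proof.
move=> JK; pose L : set_system (data R) := [set E | data_sigma K (relabel f @^-1` E)].
apply: (@smallest_sub _ (sigma_algebra setT) _ L).
- have [s0 sC sU] := @data_sigma_algebra R K; split.
  + exact: s0.
  + by move=> A /sC.
  + by move=> A HA; exact: (sU (fun n => relabel f @^-1` A n)).
- move=> _ [b [Jb [[s ->]|[A mA ->]|[k ->]]]].
  + exact: data_site (JK _ Jb).
  + exact: data_clock (JK _ Jb) mA.
  + exact: data_step (JK _ Jb).
Qed.

Lemma closed_block0 (R : realType) (y : data R) : closed_block 0 y.
Proof.
exists (fun=> None); split; last by split=> // h; rewrite /window; lia.
by move=> b; split=> // -[]; rewrite /window; lia.
Qed.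

(** * Product formula for windows *)

Section Windows.
Context {d : measure_display} {Omega : measurableType d} {R : realType}.
Variable P : probability Omega R.
Variables (eta : int -> Omega -> site) (U : int -> Omega -> R) (xi : int -> nat -> Omega -> bool).
Variables (rho_b rho_h p : R).
Hypotheses (hb : 0 < rho_b) (hbh : rho_b < rho_h) (hsum : rho_b + rho_h <= 1).
Hypotheses (hp0 : 0 <= p) (hp1 : p <= 1).
Hypotheses (hind : golf_indep P eta U xi) (hlaw : golf_laws P eta U xi rho_b rho_h p).
Notation dat := (golf_data eta U xi).
Notation env w := (fun b : int => eta b w).
Notation q := (site_weight rho_b rho_h).



Lemma Pr_relabel (f g : int -> int) J E : cancel f g -> cancel g f -> data_sigma J E ->
  Pr P (dat @^-1` (relabel f @^-1` E)) = Pr P (dat @^-1` E).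
Proof.
move=> fg gf sE; symmetry.
exact: (same_law hind hlaw (relabel_indep fg gf hind) (relabel_laws f hlaw) sE).
Qed.

Lemma Pr_translate s J E : data_sigma J E ->
  Pr P (dat @^-1` (translate s @^-1` E)) = Pr P (dat @^-1` E).
Proof. by apply: (@Pr_relabel (fun k => s + k) (fun k => - s + k)) => k; rewrite ?addKr ?addNKr. Qed.

Definition no_exit_right_prob N : R := Pr P (dat @^-1` [set y | no_exit_right N y]).
Definition no_exit_left_prob N : R := Pr P (dat @^-1` [set y | no_exit_left N y]).
Definition closed_block_prob n : R := Pr P (dat @^-1` [set y | closed_block n y]).

Lemma Pr_hole b : Pr P (dat @^-1` [set y | dsite y b = Hole]) = rho_h.
Proof. by have [_ [_ [_ [_ [eH _]]]]] := hlaw; rewrite /Pr (eH b). Qed.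

Definition windows_event h0 n N : set (data R) := [set y |
  [/\ no_exit_right N (translate (h0 - (N%:Z + 1)) y), dsite y h0 = Hole,
      closed_block n (translate h0 y), dsite y (h0 + (n%:Z + 1)) = Hole &
      no_exit_left N (translate (h0 + (n%:Z + 1)) y)]].

(** The five conditions use disjoint sets of sites, and the leftmost is split off from the rest four
    times. *)
Lemma windows_eventP h0 n N : data_sigma (fun=> True) (windows_event h0 n N) /\
  Pr P (dat @^-1` windows_event h0 n N) =
  no_exit_right_prob N * (rho_h * (closed_block_prob n * (rho_h * no_exit_left_prob N))).
Proof.
set h1 := h0 + (n%:Z + 1); set sL := h0 - (N%:Z + 1).
pose EL : set (data R) := translate sL @^-1` [set y | no_exit_right N y].
pose E0 : set (data R) := [set y | dsite y h0 = Hole].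
pose EB : set (data R) := translate h0 @^-1` [set y | closed_block n y].
pose E1 : set (data R) := [set y | dsite y h1 = Hole].
pose ER : set (data R) := translate h1 @^-1` [set y | no_exit_left N y].
have wL b : window N b -> sL + b < h0 by rewrite /window /sL; lia.
have wB b : window n b -> h0 < h0 + b < h1 by rewrite /window /h1; lia.
have wR b : window N b -> h1 < h1 + b by rewrite /window /h1; lia.
have mL : data_sigma (fun b => b < h0) EL :=
  @data_sigma_relabel R (window N) (fun b => b < h0) (fun k => sL + k) _ wL (@mS_no_exit_right R N).
have m0 : data_sigma (fun b => b = h0) E0 by exact: data_site.
have mB : data_sigma (fun b => h0 < b < h1) EB :=
  @data_sigma_relabel R (window n) (fun b => h0 < b < h1) (fun k => h0 + k) _ wB (@mS_closed_block R n).
have m1 : data_sigma (fun b => b = h1) E1 by exact: data_site.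
have mR : data_sigma (fun b => h1 < b) ER :=
  @data_sigma_relabel R (window N) (fun b => h1 < b) (fun k => h1 + k) _ wR (@mS_no_exit_left R N).
have sI (J : int -> Prop) (E E' : set (data R)) : data_sigma J E -> data_sigma J E' -> data_sigma J (E `&` E').
  by move=> mE mE'; exact: (@mS_and _ _ (@data_sigma_algebra R J) E E' mE mE').
have h01 : h0 < h1 by rewrite /h1; lia.
have m1R : data_sigma (fun b => h1 <= b) (E1 `&` ER).
  by apply: sI; [apply: data_sigma_sub m1 => b ->|apply: data_sigma_sub mR => b /ltW].
have mB1R : data_sigma (fun b => h0 < b) (EB `&` (E1 `&` ER)).
  apply: sI; first by apply: data_sigma_sub mB => b /andP[].
  by apply: data_sigma_sub m1R => b; exact: lt_le_trans.
have m0B1R : data_sigma (fun b => h0 <= b) (E0 `&` (EB `&` (E1 `&` ER))).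
  by apply: sI; [apply: data_sigma_sub m0 => b ->|apply: data_sigma_sub mB1R => b /ltW].
have eE : windows_event h0 n N = EL `&` (E0 `&` (EB `&` (E1 `&` ER))).
  by apply/seteqP; split=> y /= => [[? ? ? ? ?]|[? [? [? [? ?]]]]].
have mW : data_sigma (fun=> True) (windows_event h0 n N).
  by rewrite eE; apply: sI; [apply: data_sigma_sub mL|apply: data_sigma_sub m0B1R].
split=> //; rewrite eE !preimage_setI.
have d1 b : b < h0 -> h0 <= b -> False by lia.
have d2 b : b = h0 -> h0 < b -> False by lia.
have d3 b : h0 < b < h1 -> h1 <= b -> False by lia.
have d4 b : b = h1 -> h1 < b -> False by lia.
rewrite (data_indep hind hlaw d1 mL m0B1R) (data_indep hind hlaw d2 m0 mB1R).
rewrite (data_indep hind hlaw d3 mB m1R) (data_indep hind hlaw d4 m1 mR).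
rewrite !Pr_hole /EL /EB /ER.
rewrite (Pr_translate _ (@mS_no_exit_right R N)) (Pr_translate _ (@mS_closed_block R n)).
by rewrite (Pr_translate _ (@mS_no_exit_left R N)).
Qed.

Lemma closed_block_prob0 : closed_block_prob 0 = 1.
Proof.
rewrite /closed_block_prob (_ : _ @^-1` _ = setT) ?PrT //.
by apply/seteqP; split=> w // _; exact: closed_block0.
Qed.

Lemma closed_block_prob01 n : 0 <= closed_block_prob n <= 1.
Proof. by rewrite Pr_ge0 Pr_le1 //; exact: (m_data hlaw (@mS_closed_block R n)). Qed.

End Windows.

(** An alternative that holds almost surely for every [p], and either half of it makes all walks
    cover every cycle. This is how [p] leaves the formula. *)
Definition walks_hit (R : realType) (y : data R) :=
  (forall b (k : nat), exists n, dwalk y b n = b + k%:Z) \/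
  (forall b (k : nat), exists n, dwalk y b n = b - k%:Z).

Lemma dwalk_relabel (R : realType) (y : data R) f b n :
  dwalk (relabel f y) b n = b - f b + dwalk y (f b) n.
Proof. by rewrite /dwalk addrA subrK. Qed.

Lemma walks_hit_relabel (R : realType) (y : data R) f : walks_hit y -> walks_hit (relabel f y).
Proof.
by case=> H; [left|right] => b k; have [n Hn] := H (f b) k; exists n; rewrite dwalk_relabel Hn; lia.
Qed.

Lemma excess_sum (e : int -> site) n : excess e 0 n = \sum_(i < n) excess1 (e i%:Z).
Proof.
rewrite /excess /sites big_map -[n in iota _ n]subn0 -/(index_iota 0 n) big_mkord.
by apply: eq_bigr => i _; rewrite add0r.
Qed.

Lemma excess_rot (R : realType) l (i : int) (y : data R) :
  excess (dsite (relabel (rotz l i) y)) 0 l.+1 = excess (dsite y) 0 l.+1.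
Proof.
rewrite !excess_sum /=.
have small (v : 'I_l.+1) : 0 <= v%:Z < l.+1%:Z by have := ltn_ord v; lia.
pose rho (v : 'I_l.+1) : 'I_l.+1 := residue l (i + v%:Z).
have rhoE v : (rho v)%:Z = rotz l i v%:Z by rewrite /rho residueE /rotz small.
have rho_inj : injective rho.
  move=> u v /(congr1 (fun x : 'I_l.+1 => (x : nat)%:Z)); rewrite !rhoE => /(can_inj (@rotzK _ _)) /eqP.
  by rewrite eqz_nat => /eqP; exact: val_inj.
by rewrite [RHS](reindex_inj rho_inj); apply: eq_bigr => v _; rewrite rhoE.
Qed.

Lemma rotated_block (R : realType) l (i : 'I_l.+1) (y : data R) :
  injective (dclock y) -> walks_hit y ->
  dsite (relabel (rotz l i%:Z) y) 0 = Hole /\ closed_block l (relabel (rotz l i%:Z) y) <->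
  excess (dsite y) 0 l.+1 = 1 /\ cyc_free y i.
Proof.
move=> ci wh; set y' := relabel _ _.
have ci' : injective (dclock y') by move=> u v /= /ci /(can_inj (@rotzK _ _)).
have cov : forall b (c : 'I_l.+1), exists n, residue l (dwalk y' b n) = c.
  by apply: residue_cover; exact: walks_hit_relabel.
rewrite (cyc_free_rot i ci) -(excess_rot l i%:Z y) -/y'; split=> [[h0 cb]|[D1 cf]].
  exact: block_cyc_free ci' cov h0 cb.
split; last exact: cyc_free_block ci' cov D1 cf.
by case: cf => G [].
Qed.

(** * Averaging over rotations *)

Section CyclicLemma.
Context {d : measure_display} {Omega : measurableType d} {R : realType}.
Variable P : probability Omega R.
Variables (eta : int -> Omega -> site) (U : int -> Omega -> R) (xi : int -> nat -> Omega -> bool).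
Variables (rho_b rho_h p : R).
Hypotheses (hb : 0 < rho_b) (hbh : rho_b < rho_h) (hsum : rho_b + rho_h <= 1).
Hypotheses (hp0 : 0 <= p) (hp1 : p <= 1).
Hypotheses (hind : golf_indep P eta U xi) (hlaw : golf_laws P eta U xi rho_b rho_h p).
Notation dat := (golf_data eta U xi).
Notation env w := (fun b : int => eta b w).
Notation q := (site_weight rho_b rho_h).



Lemma walks_hit_ae : P.-negligible [set w | ~ walks_hit (dat w)].
Proof.
have [ph|ph] := leP (1 / 2) p.
  apply: (@negligibleS _ _ _ _ [set w | ~ forall b (k : nat), exists n, dwalk (dat w) b n = b + k%:Z]).
    by move=> w; apply: contra_not => H; left.
  by apply: (@hit_up_ae _ _ _ P eta U xi rho_b rho_h p).
apply: (@negligibleS _ _ _ _ [set w | ~ forall b (k : nat), exists n,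
   dwalk (golf_data (reta eta) (rU U) (rxi xi) w) b n = b + k%:Z]).
  move=> w; apply: contra_not => H; right => b k; have [n] := H (- b) k; exists n.
  by move: p0; rewrite reflect_golf_data dwalk_reflect opprK => /eqP; rewrite eqr_oppLR => /eqP ->; rewrite opprD opprK.
have a0 : 0 <= 1 - p by rewrite subr_ge0.
have a1 : 1 - p <= 1 by rewrite gerBl.
have a2 : 1 / 2 <= 1 - p by lra.
have ri : golf_indep P (reta eta) (rU U) (rxi xi) by exact: reflect_indep.
have rl : golf_laws P (reta eta) (rU U) (rxi xi) rho_b rho_h (1 - p) by exact: reflect_laws.
by apply: (@hit_up_ae _ _ _ P _ _ _ rho_b rho_h (1 - p)).
Qed.

Definition excess_one_prob n : R := iid_expect q n (fun s => (word_excess s == 1)%:R).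

Lemma Pr_excess1 n : Pr P [set w | excess (env w) 0 n == 1] = excess_one_prob n.
Proof.
rewrite /excess_one_prob -(Pr_sites hb hbh hsum hp0 hp1 hind hlaw (fun s => word_excess s == 1) 0 n).
by congr Pr; apply/seteqP; split=> w /=; rewrite excess_word.
Qed.

(* On the cycle of length [l + 1] with one more hole than balls exactly one hole stays free, and by
   rotation invariance it is equally likely to be at each place. *)
Lemma closed_block_probE l : l.+1%:R * (rho_h * closed_block_prob P eta U xi l) = excess_one_prob l.+1.
Proof.
pose B0 : set (data R) := [set y | dsite y 0 = Hole] `&` [set y | closed_block l y].
have sB0 : data_sigma (fun b => 0 <= b < l.+1%:Z) B0.
  apply: (@mS_and _ _ (@data_sigma_algebra R _) (fun y => dsite y 0 = Hole) (closed_block l)).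
    exact: data_site.
  by apply: data_sigma_sub (@mS_closed_block R l) => b; rewrite /window; lia.
have PB0 : Pr P (dat @^-1` B0) = rho_h * closed_block_prob P eta U xi l.
  have m0 : data_sigma (fun b => b = 0) [set y : data R | dsite y 0 = Hole] by exact: data_site.
  have dis b : b = 0 -> window l b -> False by rewrite /window; lia.
  rewrite /B0 preimage_setI (data_indep hind hlaw dis m0 (@mS_closed_block R l)).
  by rewrite (Pr_hole hlaw).
have [N1 [mN1 PN1 sN1]] := @clock_inj_ae _ _ _ P eta U xi rho_b rho_h p hb hbh hsum hp0 hp1 hind hlaw.
have [N2 [mN2 PN2 sN2]] := walks_hit_ae.
pose N := N1 `|` N2; have mN : measurable N by exact: measurableU.
have nN : P.-negligible N by apply: negligibleU; [exists N1; split|exists N2; split].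
have goodN w : ~ N w -> injective (dclock (dat w)) /\ walks_hit (dat w).
  move=> nw; split; apply: contrapT => H; apply: nw.
    by left; exact: sN1.
  by right; exact: sN2.
(* [Z i] says that the rotation by [i] brings a hole with a closed block behind it to the origin.
   Off the null set [N] these events partition the event of excess one. *)
pose Z (i : 'I_l.+1) := dat @^-1` (relabel (rotz l i%:Z) @^-1` B0).
have mZ i : measurable (Z i).
  apply: (m_data hlaw (J := fun=> True)).
  exact: (@data_sigma_relabel R _ (fun=> True) (rotz l i%:Z) _ (fun _ _ => Logic.I) sB0).
have PZ i : Pr P (Z i) = Pr P (dat @^-1` B0).
  by apply: (Pr_relabel hind hlaw (g := rotz l (- i%:Z)) _ _ sB0); [exact: rotzK|exact: rotzVK].
have mZN i : measurable (Z i `\` N) by exact: measurableD.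
have PZN i : Pr P (Z i `\` N) = Pr P (Z i).
  by apply: (Pr_eq_ae (mZN i) (mZ i) nN) => w nw; split=> [[]|].
have ZE w i : ~ N w -> Z i w <-> excess (env w) 0 l.+1 = 1 /\ cyc_free (dat w) i.
  by move=> /goodN[ci wh]; exact: (rotated_block i ci wh).
transitivity (Pr P [set w | exists2 i, i \in enum 'I_l.+1 & (Z i `\` N) w]).
  rewrite (Pr_seq P (enum_uniq _)) //; last first.
    move=> i j w [/ZE Zi nw] [/ZE Zj _].
    have [D1 fi] := Zi nw; have [_ fj] := Zj nw; have [ci wh] := goodN w nw.
    exact: (cyc_free_unique ci (residue_cover wh) D1 fi fj).
  rewrite (eq_bigr (fun=> rho_h * closed_block_prob P eta U xi l)); last first.
    by move=> i _; rewrite PZN PZ PB0.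
  by rewrite big_const_seq count_predT size_enum_ord iter_addr_0 mulr_natl.
rewrite -Pr_excess1; apply: (Pr_eq_ae _ _ nN).
- exact: measurable_seq.
- exact: (measurable_excess hlaw (fun z => z == 1)).
- move=> w nw; split=> [[i _ [/ZE Zi _]]|/eqP D1]; first by apply/eqP; case: (Zi nw).
  have [ci wh] := goodN w nw.
  have [i fi] := cyc_free_exists ci D1.
  by exists i; [rewrite mem_enum|split=> //; apply/ZE].
Qed.

End CyclicLemma.

(** * Words with one more hole than balls *)

Section ExcessOne.
Context {R : realType} (rho_b rho_h : R).
Hypotheses (hb : 0 < rho_b) (hbh : rho_b < rho_h) (hsum : rho_b + rho_h <= 1).
Notation q := (site_weight rho_b rho_h).
Notation rho_n := (1 - rho_b - rho_h).
Notation u := (excess_one_prob rho_b rho_h).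

Lemma iid_expect_sum n (I : finType) (Q : pred I) (F : I -> seq site -> R) :
  iid_expect q n (fun s => \sum_(i | Q i) F i s) = \sum_(i | Q i) iid_expect q n (F i).
Proof.
elim: n F => [|n IH] F //=; rewrite exchange_big; apply: eq_bigr => t _ /=.
by rewrite IH mulr_sumr.
Qed.

Definition trinomial n b h := ('C(n, b) * 'C(n - b, h))%N.

Lemma trinomial_gt n b h : (n < b + h)%N -> trinomial n b h = 0%N.
Proof.
move=> nbh; rewrite /trinomial; have [nb|bn] := ltnP n b; first by rewrite bin_small.
by rewrite ['C(n - b, h)]bin_small ?muln0 //; lia.
Qed.

(** Pascal's rule, according to whether the first letter is a ball, a hole or neutral. *)
Lemma trinomialS n b h : trinomial n.+1 b h =
  ((if b is b'.+1 then trinomial n b' h else 0) +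
   (if h is h'.+1 then trinomial n b h' else 0) + trinomial n b h)%N.
Proof.
rewrite /trinomial; case: b => [|b].
  rewrite !bin0 !mul1n !subn0 add0n; case: h => [|h]; first by rewrite !bin0.
  by rewrite binS mul1n addnC.
rewrite subSS binS mulnDl addnC -addnA; congr (_ + _)%N.
have [nb|bn] := leqP n b; first by rewrite bin_small ?ltnS // !mul0n; case: h.
have -> : (n - b = (n - b.+1).+1)%N by lia.
case: h => [|h]; first by rewrite !bin0 add0n.
by rewrite binS mulnDr addnC.
Qed.

Definition nballs (s : seq site) := count ball_site s.
Definition nholes (s : seq site) := count hole_site s.

Lemma iid_counts n b h :
  iid_expect q n (fun s => ((nballs s == b) && (nholes s == h))%:R) =
  (trinomial n b h)%:R * rho_b ^+ b * rho_h ^+ h * rho_n ^+ (n - b - h).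
Proof.
elim: n b h => [|n IH] b h /=.
  rewrite /trinomial; case: b => [|b]; first by case: h => [|h]; rewrite ?mul0r ?expr0 ?mulr1.
  by rewrite !mul0r.
rewrite big_site /= trinomialS !natrD.
have -> : iid_expect q n (fun s => ((nballs (Ball :: s) == b) && (nholes (Ball :: s) == h))%:R) =
   if b is b'.+1 then iid_expect q n (fun s => ((nballs s == b') && (nholes s == h))%:R) else 0.
  case: b => [|b]; last by apply: eq_iid_expect => s _; rewrite /nballs /nholes /= add1n eqSS.
  rewrite -[RHS](iid_expect_cst n 0 (site_weight_sum rho_b rho_h)).
  by apply: eq_iid_expect => s _; rewrite /nballs.
have -> : iid_expect q n (fun s => ((nballs (Hole :: s) == b) && (nholes (Hole :: s) == h))%:R) =
   if h is h'.+1 then iid_expect q n (fun s => ((nballs s == b) && (nholes s == h'))%:R) else 0.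
  case: h => [|h]; last by apply: eq_iid_expect => s _; rewrite /nballs /nholes /= add1n eqSS.
  rewrite -[RHS](iid_expect_cst n 0 (site_weight_sum rho_b rho_h)).
  by apply: eq_iid_expect => s _; rewrite /nholes andbF.
rewrite [iid_expect q n (fun s => ((nballs (Neutral :: s) == b) && _)%:R)](_ : _ =
   iid_expect q n (fun s => ((nballs s == b) && (nholes s == h))%:R)) // IH.
rewrite !mulrDl; congr (_ + _ + _).
- case: b => [|b]; first by rewrite mulr0 !mul0r.
  by rewrite IH subSS exprS; ring.
- case: h => [|h]; first by rewrite mulr0 !mul0r.
  by rewrite IH exprS (_ : (n.+1 - b - h.+1 = n - b - h)%N); [ring|lia].
- have [bh|bh] := leqP (b + h) n; last by rewrite trinomial_gt // mulr0n !mul0r !mulr0 !addr0.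
  by rewrite (_ : (n.+1 - b - h = (n - b - h).+1)%N); [rewrite exprS; ring|lia].
Qed.

Lemma word_excess_count s : word_excess s = (nholes s)%:Z - (nballs s)%:Z.
Proof.
rewrite /word_excess /nholes /nballs; elim: s => [|t s IH]; first by rewrite big_nil.
by rewrite big_cons IH /=; case: t => /=; lia.
Qed.

Lemma count_balls_holes s : (nballs s + nholes s <= size s)%N.
Proof. by rewrite /nballs /nholes; elim: s => [//|t s]; case: t => /=; lia. Qed.

(** Summed over the number [b0] of balls, the weights are the trinomials of [l + 1] with parts [b0],
    [b0 + 1] and the rest. Taking out [(l + 1) / (b0 + 1)] leaves the trinomial of [l]. *)
Lemma excess_one_probE l : u l.+1 =
  \sum_(b0 < l.+1 | (2 * b0 <= l)%N)
     ((l.+1)%:R / (b0.+1)%:R * ((l`!)%:R / ((b0`!)%:R * (b0`!)%:R * ((l - 2 * b0)`!)%:R)) *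
      rho_b ^+ b0 * rho_h ^+ b0.+1 * rho_n ^+ (l - 2 * b0)).
Proof.
rewrite /excess_one_prob.
rewrite (@eq_iid_expect _ _ _ _ _ (fun s => \sum_(b0 < l.+1 | (2 * b0 <= l)%N)
   ((nballs s == b0) && (nholes s == b0.+1))%:R)); last first.
  move=> s ss; have bhs : (nballs s + nholes s <= l.+1)%N by rewrite -ss; exact: count_balls_holes.
  rewrite word_excess_count; move: (nballs s) (nholes s) bhs => nb nh bhs.
  case: (boolP (nh%:Z - nb%:Z == 1)) => [/eqP e|ne].
    have bl : (nb < l.+1)%N by clear -e bhs; lia.
    rewrite (bigD1 (Ordinal bl)) /=; last by clear -e bhs; lia.
    rewrite eqxx (_ : nh == _); last by apply/eqP; clear -e; lia.
    rewrite big1 ?addr0 // => i /andP[_ ni].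
    case: eqP => //= e'; case/eqP: ni; apply: val_inj; exact: esym.
  rewrite big1 // => i _; case: eqP => //= e1; case: eqP => //= e2.
  by case/eqP: ne; rewrite e1 e2; clear; lia.
rewrite iid_expect_sum; apply: eq_bigr => b bl.
rewrite iid_counts (_ : (l.+1 - b - b.+1 = l - 2 * b)%N); last by lia.
congr (_ * _ * _ * _).
have f0 k : (k`!)%:R != 0 :> R by rewrite pnatr_eq0 -lt0n fact_gt0.
have b1 : (b.+1)%:R != 0 :> R by rewrite pnatr_eq0.
have E : (trinomial l.+1 b b.+1 * (b`! * b.+1`! * (l - 2 * b)`!) = l.+1`!)%N.
  have e1 := bin_fact (_ : b <= l.+1)%N; have e2 := bin_fact (_ : b.+1 <= l.+1 - b)%N.
  rewrite -e1; last by lia.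
  rewrite -e2; last by lia.
  rewrite (_ : (l.+1 - b - b.+1 = l - 2 * b)%N); last by lia.
  by rewrite /trinomial; ring.
have ER : (trinomial l.+1 b b.+1)%:R * (b`!%:R * (b.+1%:R * b`!%:R) * (l - 2 * b)`!%:R) = l.+1%:R * l`!%:R :> R.
  by rewrite -!natrM -factS E factS.
apply: (mulIf (x := b`!%:R * (b.+1%:R * b`!%:R) * (l - 2 * b)`!%:R)); first by rewrite !mulf_neq0.
rewrite ER; move: (f0 b) (f0 (l - 2 * b)%N) b1; clear.
move: (b`!%:R : R) (b.+1%:R : R) ((l - 2 * b)`!%:R : R) (l.+1%:R : R) (l`!%:R : R) => A B C D D' hA hC hB.
by field; rewrite hA hB hC.
Qed.

Section Potential.
Variable theta : R.
Hypotheses (t01 : 0 < theta < 1) (tE : rho_b = rho_h * theta ^+ 2).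

(* Harmonic for the excess walk except at [x = 1]. *)
Definition potential (x : int) : R := if x is Posz k.+2 then 1 - (theta ^+ 2) ^+ k.+1 else 0.

Lemma potential_step x : rho_b * potential (-1 + x) + rho_h * potential (1 + x) + rho_n * potential (0 + x) =
  potential x + (rho_h - rho_b) * (x == 1)%:R.
Proof.
have p0 (z : int) : z <= 1 -> potential z = 0 by case: z => [[|[|z]]|z].
case: x => [[|[|[|k]]]|k].
- by rewrite !p0 // (_ : (_ == _)%:R = 0 :> R) //; ring.
- rewrite (p0 (-1 + 1%:Z)) // (p0 (0 + 1%:Z)) // ?(p0 1%:Z) // (_ : (_ == _)%:R = 1 :> R) //=.
  by rewrite tE; ring.
- rewrite (p0 (-1 + 2%:Z)) // (_ : 1 + 2%:Z = 3%:Z) // (_ : 0 + 2%:Z = 2%:Z) // (_ : (_ == _)%:R = 0 :> R) //=.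
  by rewrite tE; ring.
- rewrite (_ : -1 + k.+3%:Z = k.+2%:Z); last lia.
  rewrite (_ : 1 + k.+3%:Z = k.+4%:Z); last lia.
  rewrite add0r (_ : (_ == _)%:R = 0 :> R) //= tE !exprS; ring.
- have n1 : -1 + Negz k <= 1 by clear; lia.
  have n2 : 1 + Negz k <= 1 by clear; lia.
  have n3 : 0 + Negz k <= 1 by clear; lia.
  have n4 : Negz k <= 1 by [].
  rewrite (p0 _ n1) (p0 _ n2) (p0 _ n3) (p0 _ n4) (_ : (Negz k == 1)%:R = 0 :> R) //.
  by ring.
Qed.

(** By [potential_step] the mean potential grows by [rho_h - rho_b] times the probability of being
    at 1, and it starts from 0. *)
Lemma potential_sum N : (rho_h - rho_b) * \sum_(n < N) u n = iid_expect q N (potential \o word_excess).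
Proof.
elim: N => [|N IH]; first by rewrite big_ord0 mulr0 /= /word_excess big_nil.
rewrite big_ord_recr /= mulrDr IH /excess_one_prob -iid_expectZ -iid_expectD.
rewrite big_site /= -!iid_expectZ -!iid_expectD; apply: eq_iid_expect => s _.
by rewrite -potential_step /= /word_excess !big_cons.
Qed.

Lemma potential_bound x : 0 <= potential x <= 1 /\ 1 - potential x <= theta^-1 * theta ^ x.
Proof.
have /andP[t0 t1] := t01; have tn : theta != 0 by rewrite gt_eqF.
have p0 (z : int) : z <= 1 -> potential z = 0 by case: z => [[|[|z]]|z].
have tz z : theta^-1 * theta ^ z = theta ^ (z - 1) by rewrite addrC expfzDr.
have [x1|x1] := leP x 1.
  rewrite p0 // lexx ler01 subr0 tz; split=> //.
  have xz : x - 1 <= 0 by lia.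
  by apply: (@exprz_theta_ge1 _ rho_b rho_h theta).
have [k ->] : exists k : nat, x = k.+2%:Z by exists (absz x - 2)%N; lia.
rewrite tz (_ : k.+2%:Z - 1 = k.+1%:Z); last lia.
have a0 : 0 <= (theta ^+ 2) ^+ k.+1 by rewrite exprn_ge0 // exprn_ge0 // ltW.
have a1 : (theta ^+ 2) ^+ k.+1 <= theta ^+ k.+1.
  rewrite -exprM; apply: ler_wiXn2l; [exact: ltW|exact: ltW|lia].
have a2 : theta ^+ k.+1 <= 1 by rewrite exprn_ile1 // ltW.
rewrite /= subr_ge0 (le_trans a1 a2) gerBl a0; split=> //.
by rewrite opprB addrC subrK.
Qed.

(** The excess drifts to infinity, where the potential tends to 1 exponentially fast; hence the
    expected number of visits to 1 is [1 / (rho_h - rho_b)]. *)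
Lemma potential_limit N : 1 - theta^-1 * decay rho_h theta ^+ N <= (rho_h - rho_b) * \sum_(n < N) u n <= 1.
Proof.
have q0 := site_weight_ge0 hb hbh hsum; have q1 := site_weight_sum rho_b rho_h.
rewrite potential_sum; apply/andP; split; last first.
  rewrite -[leRHS](iid_expect_cst N 1 q1); apply: iid_expect_le => // s _.
  by have [/andP[]] := potential_bound (word_excess s).
rewrite -(decayE t01 tE) -iid_expect_prod -iid_expectZ lerBlDr -iid_expectD.
rewrite -[leLHS](iid_expect_cst N 1 q1); apply: iid_expect_le => // s _.
have [_] := potential_bound (word_excess s); rewrite (theta_excess t01) /=; lra.
Qed.

End Potential.

Lemma excess_one_sum (e : R) : 0 < e -> exists M, forall N, (M <= N)%N ->
  1 - e <= (rho_h - rho_b) * \sum_(n < N) u n <= 1.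
Proof.
move=> e0; have [theta t01 tE] := theta_exists hb hbh; have /andP[t0 t1] := t01.
have l01 : 0 <= decay rho_h theta < 1 by exact: (@decay01 _ rho_b rho_h).
have [M HM] := @geometric_small R _ (theta * e) l01 (mulr_gt0 t0 e0).
exists M => N MN; have /andP[H1 H2] := potential_limit t01 tE N.
rewrite H2 andbT; apply: le_trans H1; rewrite lerD2l lerN2.
by rewrite mulrC ler_pdivrMr // mulrC; apply: le_trans (ltW HM); exact: geometric_le.
Qed.

Lemma excess_one_prob0 : u 0 = 0.
Proof. by rewrite /excess_one_prob /= /word_excess big_nil. Qed.

End ExcessOne.

(** * Law of the gap and its normalisation *)

Section Final.
Context {d : measure_display} {Omega : measurableType d} {R : realType}.
Variable P : probability Omega R.
Variables (eta : int -> Omega -> site) (U : int -> Omega -> R) (xi : int -> nat -> Omega -> bool).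
Variables (rho_b rho_h p : R).
Hypotheses (hb : 0 < rho_b) (hbh : rho_b < rho_h) (hsum : rho_b + rho_h <= 1).
Hypotheses (hp0 : 0 <= p) (hp1 : p <= 1).
Hypotheses (hind : golf_indep P eta U xi) (hlaw : golf_laws P eta U xi rho_b rho_h p).
Notation dat := (golf_data eta U xi).
Notation env w := (fun b : int => eta b w).
Notation q := (site_weight rho_b rho_h).



Variable F : Omega -> int -> option int.
Hypothesis hF : golf_process P eta U xi F.
Notation sysT w := (int_sys (dat w) (fun=> True)).
Notation av w := (avail (sysT w) (F w)).
Notation u := (excess_one_prob rho_b rho_h).
Notation beta := (closed_block_prob P eta U xi).

Lemma free_at_avail w t h : free_at eta U F w t h <-> av w t h.
Proof.
split=> [[hh nb]|[nT|[[_ hh] nb]]]; [right| by case: nT|].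
- by split=> // -[b [[_ bb] [bt Fb]]]; apply: nb; exists b.
- by split=> // -[b [bb [bt Fb]]]; apply: nb; exists b.
Qed.

Lemma golf_consistentP w : golf_consistent eta U xi F w -> consistent (sysT w) (F w).
Proof.
move=> H b; have [H1 H2] := H b; split=> [nb|[_ bb] h]; first by apply: H1 => bb; apply: nb.
rewrite (H2 bb h); split=> -[n [wn [fn mn]]]; exists n; split=> //; split=> //.
- exact/free_at_avail.
- by move=> m /mn; apply: contra_not => /free_at_avail.
- exact/free_at_avail.
- by move=> m /mn; apply: contra_not => /free_at_avail.
Qed.

Definition regular w := [/\ consistent (sysT w) (F w), forall b, 0 <= U b w < 1, injective (fun b => U b w) &
  forall t h, safe (env w) h -> av w t h].

Lemma rogue_right_ae : P.-negligible [set w |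
  consistent (sysT w) (F w) /\ rogue_right (dat w) (F w)].
Proof.
have a0 : 0 <= 1 - p by rewrite subr_ge0.
have a1 : 1 - p <= 1 by rewrite gerBl.
have ri : golf_indep P (reta eta) (rU U) (rxi xi) by exact: reflect_indep.
have rl : golf_laws P (reta eta) (rU U) (rxi xi) rho_b rho_h (1 - p) by exact: reflect_laws.
have := @rogue_left_ae _ _ _ P _ _ _ rho_b rho_h (1 - p) hb hbh hsum a0 a1 ri rl (fun w => reflect_map (F w)).
apply: negligibleS => w [cF rr]; rewrite /mkset reflect_golf_data; split.
  exact: consistent_reflect.
exact: rogue_reflect.
Qed.

Lemma regular_ae : P.-negligible [set w | ~ regular w].
Proof.
have [_ aeF] := hF.
have n1 : P.-negligible [set w | ~ golf_consistent eta U xi F w] := aeF.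
have n2 := clock01_ae hlaw.
have n3 := @clock_inj_ae _ _ _ P eta U xi rho_b rho_h p hb hbh hsum hp0 hp1 hind hlaw.
have n4 : P.-negligible [set w | ~ ((forall n, exists2 h, h < n & safe (env w) h) /\
    (forall n, exists2 h, n < h & safe (env w) h))].
  by apply: (@safe_unbounded _ _ _ P eta U xi rho_b rho_h p).
have n5 := @rogue_left_ae _ _ _ P eta U xi rho_b rho_h p hb hbh hsum hp0 hp1 hind hlaw F.
have n6 := rogue_right_ae.
apply: negligibleS (negligibleU n1 (negligibleU n2 (negligibleU n3 (negligibleU n4 (negligibleU n5 n6))))).
move=> w nr; apply: contrapT => /not_orP[/contrapT c1] /not_orP[/contrapT c2] /not_orP[/contrapT c3].
move=> /not_orP[/contrapT [c4 c5]] /not_orP[c6 c7]; apply: nr.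
have cF := golf_consistentP c1.
split=> // t h sh; apply: (safe_always_avail cF c2 c3) => //.
- by move=> rl; apply: c6.
- by move=> rr; apply: c7.
Qed.

Lemma measurable_avail t h : measurable [set w | av w t h].
Proof.
have [mF _] := hF; have hM := @sigma_algebra_measurable _ Omega.
apply: (mS_or hM); first exact: (mS_const hM).
apply: (mS_and hM).
  by apply: (mS_and hM); [exact: (mS_const hM)|exact: (m_eta hlaw Hole h)].
apply: (mS_not hM); apply: (mS_exists hM) => b; apply: (mS_and hM).
  by apply: (mS_and hM); [exact: (mS_const hM)|exact: (m_eta hlaw Ball b)].
apply: (mS_and hM); last exact: mF.
apply: (mS_ext (M := measurable)) (m_clock hlaw b (A := `]-oo, t[%classic) (measurable_itv _)) => w.
by rewrite /= in_itv.
Qed.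

Definition gap_set h0 n := [set w | gap_at (dat w) (F w) h0 n].

Lemma measurable_gap_set h0 n : measurable (gap_set h0 n).
Proof.
have hM := @sigma_algebra_measurable _ Omega.
have : measurable [set w | av w 1 h0 /\ (av w 1 (h0 + (n%:Z + 1)) /\
    forall x, h0 < x < h0 + (n%:Z + 1) -> ~ av w 1 x)].
  apply: (mS_and hM); first exact: measurable_avail.
  apply: (mS_and hM); first exact: measurable_avail.
  apply: (mS_forall hM) => x; apply: (mS_imp hM); first exact: (mS_const hM).
  by apply: (mS_not hM); exact: measurable_avail.
by apply: (mS_ext (M := measurable)) => w; split=> [[? []]|[]].
Qed.

(** The two events differ only where [N] sites next to an end of the gap contain no safe hole, up to
    a null set. The bound is uniform in the place and length of the gap. *)
Lemma gap_set_windows (e : R) : 0 < e -> exists N, forall h0 n,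
  `|Pr P (gap_set h0 n) - Pr P (dat @^-1` windows_event h0 n N)| <= e.
Proof.
move=> e0; have e2 : 0 < e / 2 by rewrite divr_gt0.
have [N HN] := @small_no_safe_block _ _ _ P eta U xi rho_b rho_h p hb hbh hsum hp0 hp1 hind hlaw _ e2.
exists N => h0 n; set h1 := h0 + (n%:Z + 1).
have s0 := negligible_small regular_ae.
have := smallU s0 (smallU (HN (h0 - N%:Z)) (HN (h1 + 1))).
rewrite add0r -splitr => sm.
have [mW _] := windows_eventP hb hbh hsum hp0 hp1 hind hlaw h0 n N.
apply: (Pr_eq_near (measurable_gap_set h0 n) (m_data hlaw mW) sm) => w.
move=> /not_orP[/contrapT[cF c01 ci sav]] /not_orP[/existsNP[a /not_implyP[aI /contrapT sa]] /existsNP[c /not_implyP[cI /contrapT sc]]].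
have clt1 b : U b w < 1 by case/andP: (c01 b).
have aL : h0 - (N%:Z + 1) < a < h0 by clear -aI; lia.
have cR : h1 < c < h1 + (N%:Z + 1) by clear -cI; lia.
exact: (@gap_at_windows R (dat w) (F w) n N h0 a c cF ci clt1 aL cR sa sc (fun t => sav t a sa) (fun t => sav t c sc)).
Qed.

(** For a given error the windows yield one constant [c] such that every gap of length [n] has
    probability close to [c * beta n]. Length 0, where [beta] is 1, eliminates [c]. *)
Lemma Pr_gap_set h0 n : Pr P (gap_set h0 n) = Pr P (gap_set 0 0) * beta n.
Proof.
have /andP[b0 b1] := @closed_block_prob01 _ _ _ P eta U xi rho_b rho_h p hlaw n.
apply/eqP; rewrite -subr_eq0 -normr_le0; apply/ler_addgt0Pr => e e0; rewrite add0r.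
have e2 : 0 < e / 2 by rewrite divr_gt0.
have [N HN] := gap_set_windows e2.
have := HN h0 n; have := HN 0 0%N.
rewrite !(windows_eventP hb hbh hsum hp0 hp1 hind hlaw _ _ N).2 closed_block_prob0 mul1r.
set c1 := no_exit_right_prob _ _ _ _ _; set c2 := no_exit_left_prob _ _ _ _ _.
move: (Pr P (gap_set 0 0)) (Pr P (gap_set h0 n)) => K g; rewrite !ler_norml.
set c := c1 * (rho_h * (rho_h * c2)).
have -> : c1 * (rho_h * (beta n * (rho_h * c2))) = c * beta n by rewrite /c; ring.
move=> /andP[k1 k2] /andP[g1 g2].
have m1 : - (e / 2) <= (K - c) * beta n by nra.
have m2 : (K - c) * beta n <= e / 2 by nra.
by rewrite mulrBl in m1 m2; apply/andP; split; lra.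
Qed.

(** A gap of [l] sites can lie around the origin in [l + 1] ways, the same factor that rotation
    produces on the cycle. *)
Lemma gap_eventE l : gap_event eta U F l = [set w | exists2 i, i \in iota 0 l.+1 & gap_set (- i%:Z) l w].
Proof.
apply/seteqP; split=> w.
- move=> [h0 [h1 [h00 [h10 [e [/free_at_avail f0 [/free_at_avail f1 mid]]]]]]].
  exists (absz h0); first by rewrite mem_iota; lia.
  have -> : - (absz h0)%:Z = h0 by lia.
  have e1 : h0 + (l%:Z + 1) = h1 by lia.
  rewrite /gap_set /mkset /gap_at e1; split=> // x /andP[x0 x1] /free_at_avail; exact: mid.
- move=> [i]; rewrite mem_iota => il [f0 f1 mid]; exists (- i%:Z), (- i%:Z + (l%:Z + 1)).
  split; first lia.
  split; first lia.
  split; first lia.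
  split; first exact/free_at_avail.
  split; first exact/free_at_avail.
  by move=> x x0 x1 /free_at_avail; apply: mid; rewrite x0.
Qed.

Lemma measurable_gap_event l : measurable (gap_event eta U F l).
Proof. by rewrite gap_eventE; apply: measurable_seq => i; exact: measurable_gap_set. Qed.

Lemma gap_at_unique w h0 n h0' n' : gap_at (dat w) (F w) h0 n -> gap_at (dat w) (F w) h0' n' ->
  h0 <= 0 -> 0 < h0 + (n%:Z + 1) -> h0' <= 0 -> 0 < h0' + (n'%:Z + 1) -> h0 = h0' /\ n = n'.
Proof.
move=> [f0 f1 m] [f0' f1' m'] a b a' b'.
have E : h0 = h0'.
  by case: (ltgtP h0 h0') => // lt; [case: (m h0')|case: (m' h0)] => //; lia.
split=> //; subst h0'.
case: (ltgtP n n') => // lt.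
- by case: (m' (h0 + (n%:Z + 1))) => //; lia.
- by case: (m (h0 + (n'%:Z + 1))) => //; lia.
Qed.

Lemma Pr_gap_event l : rho_h * Pr P (gap_event eta U F l) = Pr P (gap_set 0 0) * u l.+1.
Proof.
(* The bound on [i] is built into the event because [Pr_seq] wants disjointness for all indices, and
   two gaps exclude each other only if both surround the origin. *)
pose A i := [set w | gap_set (- i%:Z) l w /\ (i < l.+1)%N].
have hM := @sigma_algebra_measurable _ Omega.
have mA i : measurable (A i).
  by apply: (mS_and hM); [exact: measurable_gap_set|exact: (mS_const hM)].
have -> : gap_event eta U F l = [set w | exists2 i, i \in iota 0 l.+1 & A i w].
  rewrite gap_eventE; apply/seteqP; split=> w [i il gi]; exists i => //; last by case: gi.
  by split=> //; move: il; rewrite mem_iota.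
rewrite (Pr_seq P (iota_uniq _ _) mA); last first.
  move=> i j w [gi il] [gj jl].
  have [||||e _] := gap_at_unique gi gj; try by clear -il jl; lia.
  by clear -e; lia.
rewrite (eq_big_seq (fun=> Pr P (gap_set 0 0) * beta l)); last first.
  move=> i; rewrite mem_iota add0n => /andP[_ il]; rewrite -(Pr_gap_set (- i%:Z) l).
  by congr Pr; apply/seteqP; split=> w //= [].
rewrite big_const_seq count_predT size_iota iter_addr_0 -mulr_natl.
rewrite -(@closed_block_probE _ _ _ P eta U xi rho_b rho_h p hb hbh hsum hp0 hp1 hind hlaw l).
by ring.
Qed.

Lemma gap_event_unique l l' w : gap_event eta U F l w -> gap_event eta U F l' w -> l = l'.
Proof.
rewrite !gap_eventE => -[i]; rewrite mem_iota => il gi [j]; rewrite mem_iota => jl gj.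
by have [||||_ ->] := gap_at_unique gi gj; try by clear -il jl; lia.
Qed.

(** Safe holes within [N] sites on both sides of the origin stay free, so the gap has fewer than
    [2 * N] sites. *)
Lemma gap_event_total (e : R) : 0 < e -> exists M0, forall M, (M0 <= M)%N ->
  1 - e <= \sum_(l < M) Pr P (gap_event eta U F l) <= 1.
Proof.
move=> e0; have e2 : 0 < e / 2 by rewrite divr_gt0.
have [N HN] := @small_no_safe_block _ _ _ P eta U xi rho_b rho_h p hb hbh hsum hp0 hp1 hind hlaw _ e2.
exists (N + N).+1 => M NM.
pose T := [set w | exists2 l, l \in iota 0 M & gap_event eta U F l w].
have mT : measurable T by apply: measurable_seq => l; exact: measurable_gap_event.
have PT : Pr P T = \sum_(l < M) Pr P (gap_event eta U F l).
  rewrite (Pr_seq P (iota_uniq _ _) measurable_gap_event); last exact: gap_event_unique.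
  by rewrite -[M in iota _ M]subn0 -/(index_iota 0 M) big_mkord.
rewrite -PT Pr_le1 // andbT.
have := smallU (negligible_small regular_ae) (smallU (HN (- N%:Z)) (HN 1)).
rewrite add0r -splitr => -[C [mC sC PC]].
have : Pr P (~` T) <= e; last by rewrite PrC // => ?; lra.
apply: le_trans PC; apply: Pr_le => //; first exact: measurableC.
move=> w nT; apply: sC; apply: contrapT.
move=> /not_orP[/contrapT[cF c01 ci sav]] /not_orP[/existsNP[a /not_implyP[aI /contrapT sa]] /existsNP[c /not_implyP[cI /contrapT sc]]].
apply: nT.
have a1 : a < 1 by clear -aI; lia.
have c0 : 0 < c by clear -cI; lia.
have [x [xa fx mx]] := nearest_left (Q := fun h => av w 1 h) (sav 1 a sa) a1.
have [z [zc fz mz]] := nearest_right (Q := fun h => av w 1 h) (sav 1 c sc) c0.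
exists (absz (z - x - 1)%R).
  by rewrite mem_iota; clear -aI cI xa zc NM; lia.
exists x, z; split; first by clear -xa; lia.
split; first by clear -zc; lia.
split; first by clear -xa zc; lia.
split; first exact/free_at_avail.
split; first exact/free_at_avail.
move=> v xv vz /free_at_avail fv.
have [v0|v0] := leP v 0.
- by apply: (mx v) => //; clear -xv v0; lia.
- by apply: (mz v) => //; clear -vz v0; lia.
Qed.

(* The gap probabilities are [K / rho_h] times those of an excess of one; both families are
   summed to identify [K]. *)
Lemma gap_density : Pr P (gap_set 0 0) = rho_h * (rho_h - rho_b).
Proof.
have hh : 0 < rho_h := lt_trans hb hbh.
have D0 : 0 < rho_h - rho_b by rewrite subr_gt0.
set K := Pr P _; pose x := K / (rho_h * (rho_h - rho_b)).
have x0 : 0 <= x by rewrite divr_ge0 ?Pr_ge0 // mulr_ge0 // ltW.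
have Kx : K = x * (rho_h * (rho_h - rho_b)) by rewrite /x divfK // mulf_neq0 // gt_eqF.
suff x1 : x = 1 by rewrite Kx x1 mul1r.
(* A gap of [l] corresponds to [l + 1] letters; the extra term of the shifted sum is [u 0 = 0]. *)
have gapE M : \sum_(l < M) Pr P (gap_event eta U F l) = x * ((rho_h - rho_b) * \sum_(n < M.+1) u n).
  rewrite big_ord_recl excess_one_prob0 add0r !mulr_sumr; apply: eq_bigr => l _.
  apply: (mulfI (x := rho_h)); first by rewrite gt_eqF.
  by rewrite Pr_gap_event -/K Kx; ring.
(* Both partial sums eventually lie between [1 - e] and 1, which squeezes their ratio [x]. *)
have bound (e : R) : 0 < e -> e < 1 -> 1 - e <= x /\ x * (1 - e) <= 1.
  move=> e0 e1; have [M0 H0] := gap_event_total e0.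
  have [M1 H1] := @excess_one_sum R rho_b rho_h hb hbh hsum e e0.
  have := H0 (maxn M0 M1) (leq_maxl _ _).
  have := H1 (maxn M0 M1).+1 (leq_trans (leq_maxr _ _) (leqnSn _)).
  rewrite gapE; move: (_ * \sum_(n < _) _) => s /andP[s1 s2] /andP[t1 t2].
  by split; nra.
apply/eqP; rewrite eq_le; apply/andP; split.
- rewrite leNgt; apply/negP => x1.
  have x00 : 0 < x by exact: lt_trans x1.
  (* Now [1 - e] is the midpoint of [1 / x] and 1, hence larger than [1 / x]. *)
  pose e := (1 - x^-1) / 2.
  have xi1 : x^-1 < 1 by rewrite invf_lt1.
  have xi0 : 0 < x^-1 by rewrite invr_gt0.
  have e0 : 0 < e by rewrite /e; lra.
  have e1 : e < 1 by rewrite /e; lra.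
  have [_ H] := bound e e0 e1.
  have : 1 - e <= x^-1 by rewrite -[leRHS]mul1r ler_pdivlMr // mulrC.
  by rewrite /e; lra.
- rewrite leNgt; apply/negP => x1.
  have e0 : 0 < (1 - x) / 2 by lra.
  have e1 : (1 - x) / 2 < 1 by lra.
  by have [H _] := bound _ e0 e1; lra.
Qed.

End Final.

Theorem mainTheorem9 (d : measure_display) (Omega : measurableType d)
  (R : realType) (P : probability Omega R)
  (eta : int -> Omega -> site) (U : int -> Omega -> R)
  (xi : int -> nat -> Omega -> bool)
  (rho_b rho_h p : R)
  (hb : 0 < rho_b) (hbh : rho_b < rho_h) (hsum : rho_b + rho_h <= 1)
  (hp0 : 0 <= p) (hp1 : p <= 1)
  (hind : golf_indep P eta U xi)
  (hlaw : golf_laws P eta U xi rho_b rho_h p)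
  (F : Omega -> int -> option int)
  (hF : golf_process P eta U xi F)
  (l0 : nat) :
  P (gap_event eta U F l0) =
  ((rho_h - rho_b) *
   \sum_(b0 < l0.+1 | (2 * b0 <= l0)%N)
     ((l0.+1)%:R / (b0.+1)%:R *
      ((l0`!)%:R / ((b0`!)%:R * (b0`!)%:R * ((l0 - 2 * b0)`!)%:R)) *
      rho_b ^+ b0 * rho_h ^+ b0.+1 * (1 - rho_b - rho_h) ^+ (l0 - 2 * b0)))%:E.

Proof.
rewrite (PrE P (measurable_gap_event hb hbh hsum hp0 hp1 hlaw hF l0)); congr EFin.
have hh : 0 < rho_h := lt_trans hb hbh.
apply: (mulfI (x := rho_h)); first by rewrite gt_eqF.
rewrite (Pr_gap_event hb hbh hsum hp0 hp1 hind hlaw hF l0).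
rewrite (gap_density hb hbh hsum hp0 hp1 hind hlaw hF).
by rewrite (excess_one_probE hb hbh hsum l0) mulrA.
Qed.
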